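(* Let $\Pi_{\mathsf{OSM}}$ be a one-shot message authentication code (OSMAC) scheme and let $\Pi_{\mathsf{UTE}}$ be the encryption scheme built from $\Pi_{\mathsf{OSM}}$ by the MAC-chain construction with length parameter $n=n(\lambda)$ (defined in the context). Suppose $\Pi_{\mathsf{OSM}}$ is correct and $n=\omega(\log\lambda)$. Then $\Pi_{\mathsf{UTE}}$ is not $k$-adversary one-way unclonable secure for any $k=\mathrm{poly}(\lambda)$ in the classical oracle model.
   Context: $\lambda$ is the security parameter; QPT means quantum polynomial time; $x\xleftarrow{R}X$ denotes uniform sampling; $\mathrm{negl}$ is a negligible function; $\epsilon$ denotes the empty string. OSMAC. A tuple of QPT algorithms: $\mathsf{Setup}(1^\lambda)\to(\mathsf{pp},\mathsf{mvk})$; $\mathsf{KeyGen}(\mathsf{pp})\to(|\mathsf{sk}\rangle,\mathsf{vk})$ with quantum signing key and classical verification key; $\mathsf{Sign}(|\mathsf{sk}\rangle,m)\to\sigma$; $\mathsf{Vrfy}(\mathsf{pp},\mathsf{mvk},\mathsf{vk},m,\sigma)\to\{0,1\}$. Correctness: for every message $m$, $\Pr[\mathsf{Vrfy}(\mathsf{pp},\mathsf{mvk},\mathsf{vk},m,\sigma)=1]\ge1-\mathrm{negl}(\lambda)$ where $(\mathsf{pp},\mathsf{mvk})\leftarrow\mathsf{Setup}(1^\lambda)$, $(|\mathsf{sk}\rangle,\mathsf{vk})\leftarrow\mathsf{KeyGen}(\mathsf{pp})$, $\sigma\leftarrow\mathsf{Sign}(|\mathsf{sk}\rangle,m)$. Classical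 oracle model: algorithms can efficiently generate a black-box oracle for any classical function with polynomial-size description; other parties given the oracle (including adversaries in all stages) have only quantum oracle access to it. MAC-chain construction (separate encryption/decryption keys, message space $\{\mathcal{M}_\lambda\}$). For $r\in\{0,1\}^n$ let $V_r=\{\epsilon,r[1],r[1,2],\dots,r[1,n-1],r\}$ be the set of all prefixes of $r$. The message space $\{0,1\}^{\ell(\lambda)}$ of the OSMAC is large enough to contain (encodings of) concatenations of two verification keys and strings in $\{0,1\}^{n+\lambda}$. - $\mathsf{Gen}(1^\lambda)$: $s\xleftarrow{R}\{0,1\}^{n+\lambda}$, $(\mathsf{pp},\mathsf{mvk})\leftarrow\mathsf{OSM.Setup}(1^\lambda)$; output $\mathsf{ek}=(\mathsf{pp},\mathsf{mvk},s)$, $\mathsf{dk}=s$. - $\mathsf{Enc}(\mathsf{ek},m)$: $(|\mathsf{sk}_\epsilon\rangle,\mathsf{vk}_\epsilon)\leftarrow\mathsf{OSM.KeyGen}(\mathsf{pp})$; generate the classical oracle $\mathcal{O}_{\mathsf{ek},m,\mathsf{vk}_\epsilon}$ which on input $s'\in\{0,1\}^{n+\lambda}$, $r\in\{0,1\}^n$, $\{\mathsf{st}_v\}_{v\in V_r}$ parses $\mathsf{st}_\epsilon=(\mathsf{vk}_0,\mathsf{vk}_1,\sigma_\epsilon)$, $\mathsf{st}_v=(\mathsf{vk}_v,\mathsf{vk}_{v\|0},\mathsf{vk}_{v\|1},\sigma_v)$ for $v\in V_r\setminus\{\epsilon,r\}$, $\mathsf{st}_r=(\mathsf{vk}_r,\sigma_r)$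 (keys occurring in several tuples must agree) and outputs $m$ if $s'=s$, $\mathsf{OSM.Vrfy}(\mathsf{pp},\mathsf{mvk},\mathsf{vk}_v,\mathsf{vk}_{v\|0}\|\mathsf{vk}_{v\|1},\sigma_v)=1$ for all $v\in V_r\setminus\{r\}$, and $\mathsf{OSM.Vrfy}(\mathsf{pp},\mathsf{mvk},\mathsf{vk}_r,s',\sigma_r)=1$; otherwise it outputs $\bot$. Output $(|\mathsf{sk}_\epsilon\rangle,\mathcal{O}_{\mathsf{ek},m,\mathsf{vk}_\epsilon},\mathsf{pp})$. - $\mathsf{Dec}(\mathsf{dk},(|\mathsf{sk}_\epsilon\rangle,\mathcal{O},\mathsf{pp}))$: sample OSMAC key pairs for every $v\in V_{0^n}\setminus\{\epsilon\}$ and for each such $v$ with its last bit flipped; set $\sigma_v\leftarrow\mathsf{OSM.Sign}(|\mathsf{sk}_v\rangle,\mathsf{vk}_{v\|0}\|\mathsf{vk}_{v\|1})$ for $v\in V_{0^n}\setminus\{0^n\}$ and $\sigma_{0^n}\leftarrow\mathsf{OSM.Sign}(|\mathsf{sk}_{0^n}\rangle,\mathsf{dk})$; form the tuples $\mathsf{st}_v$ and output $\mathcal{O}(\mathsf{dk},0^n,\{\mathsf{st}_v\}_{v\in V_{0^n}})$. $k$-adversary one-way unclonable security: the challenger samples $(\mathsf{ek},\mathsf{dk})\leftarrow\mathsf{Gen}(1^\lambda)$, $m\xleftarrow{R}\mathcal{M}_\lambda$ and gives one ciphertext $\mathsf{Enc}(\mathsf{ek},m)$ to $\mathcal{A}$;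 $\mathcal{A}$ outputs a quantum state on registers $B_1,\dots,B_k$, given respectively to second-stage adversaries $\mathcal{B}_1,\dots,\mathcal{B}_k$ (who cannot communicate); each $\mathcal{B}_j$ also receives $\mathsf{dk}$ and outputs a string. The adversary wins iff all $k$ outputs equal $m$. Security: every QPT $(\mathcal{A},\mathcal{B}_1,\dots,\mathcal{B}_k)$ wins with negligible probability.
   Formalization: Correctness of the OSMAC is required also for messages depending on pp (for messages fixed before Setup the claim is false: Vrfy may reject messages containing a random string planted in pp and in all vk); Vrfy is deterministic classical, and n, k, message length are efficiently computable. *)

(* Defs.v *)
From mathcomp Require Import all_boot all_order all_algebra all_field.

Set Implicit Arguments.
Unset Strict Implicit.
Unset Printing Implicit Defensive.

Import Order.TTheory GRing.Theory Num.Theory.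
Local Open Scope ring_scope.

Notation bits := (seq bool).

(** * Deterministic polynomial time

  The machine model is a WHILE language on binary trees.  Evaluation is
  call-by-value with de Bruijn environments.  Reading a variable and building a
  node both cost the size of the resulting tree, so that sharing cannot produce
  superpolynomially large results in polynomially many steps. *)

Inductive tree := Lf | Nd (l r : tree).

Fixpoint tree_size (x : tree) : nat :=
  if x is Nd l r then (tree_size l + tree_size r).+1 else 1%N.

Inductive expr :=
| Var (i : nat)
| Leaf
| Node (a b : expr)
| Case (a b c : expr)  (* c is evaluated with both subtrees of a pushed *)
| Let (a b : expr)
| While (b : expr).    (* iterates b on the top of the environment *)

(* [eval env e v t]: in environment [env], [e] returns [v] at cost [t].
   The loop state of [While] is a pair (flag, value): the loop stops and returns
   the value when the flag is [Lf]. *)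
Inductive eval : seq tree -> expr -> tree -> nat -> Prop :=
| EvalVar env i :
    (i < size env)%N -> eval env (Var i) (nth Lf env i) (tree_size (nth Lf env i))
| EvalLeaf env : eval env Leaf Lf 1
| EvalNode env a b x y s t :
    eval env a x s -> eval env b y t ->
    eval env (Node a b) (Nd x y) (s + t + tree_size (Nd x y))
| EvalCaseLf env a b c v s t :
    eval env a Lf s -> eval env b v t -> eval env (Case a b c) v (s + t).+1
| EvalCaseNd env a b c x y v s t :
    eval env a (Nd x y) s -> eval [:: x, y & env] c v t ->
    eval env (Case a b c) v (s + t).+1
| EvalLet env a b x v s t :
    eval env a x s -> eval (x :: env) b v t -> eval env (Let a b) v (s + t).+1
| EvalStop env b v : eval (Nd Lf v :: env) (While b) v (tree_size v)
| EvalStep env b f g x y v s t :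
    eval (Nd (Nd f g) x :: env) b y s -> eval (y :: env) (While b) v t ->
    eval (Nd (Nd f g) x :: env) (While b) v (s + t).+1.

Fixpoint unary (n : nat) : tree := if n is n'.+1 then Nd Lf (unary n') else Lf.

Definition tbool (b : bool) : tree := if b then Nd Lf Lf else Lf.

Fixpoint tlist (T : Type) (enc : T -> tree) (s : seq T) : tree :=
  if s is x :: s' then Nd (enc x) (tlist enc s') else Lf.

(* One program computes [out lam x] from 1^lam and [x], for all [x] in the
   domain [D lam], in time polynomial in [lam]: every polynomial is bounded on
   all of nat by [lam.+2 ^ d] for some [d]. *)
Definition polytime (T : Type) (D : nat -> T -> Prop)
    (inp : T -> tree) (out : nat -> T -> tree) : Prop :=
  exists (p : expr) (d : nat), forall (lam : nat) (x : T), D lam x ->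
    exists2 t : nat, (t <= lam.+2 ^ d)%N
                   & eval [:: Nd (unary lam) (inp x)] p (out lam x) t.

(* A length parameter: as its value is output in unary, it is in particular
   bounded by a polynomial. *)
Definition poly_param (f : nat -> nat) : Prop :=
  polytime (fun _ (_ : unit) => True) (fun=> Lf) (fun lam _ => unary (f lam)).

(** * Quantum circuits

  Amplitudes live in [algC]: all entries of the gates are algebraic. *)

Inductive gate :=
| Had (i : nat)
| Tgate (i : nat)
| Cnot (i j : nat)              (* control i, target j *)
| Oracle (xs ys : seq nat).     (* |x>|y> |-> |x>|y + f(x)> *)

(* Wires are 0, ..., c_in + c_anc - 1: first the inputs, then ancillas
   initialised to 0.  The outputs are wires 0, ..., c_out - 1; the others are
   traced out. *)
Record circuit := Circuit {
  c_in : nat; c_anc : nat; c_out : nat; c_gates : seq gate }.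

Definition c_wires (C : circuit) : nat := (c_in C + c_anc C)%N.

Definition gate_wf (N : nat) (g : gate) : bool :=
  match g with
  | Had i | Tgate i => (i < N)%N
  | Cnot i j => [&& (i < N)%N, (j < N)%N & i != j]
  | Oracle xs ys => uniq (xs ++ ys) && all (fun i => (i < N)%N) (xs ++ ys)
  end.

Definition circuit_wf (C : circuit) : bool :=
  (c_out C <= c_wires C)%N && all (gate_wf (c_wires C)) (c_gates C).

Definition tgate (g : gate) : tree :=
  match g with
  | Had i => Nd (unary 0) (unary i)
  | Tgate i => Nd (unary 1) (unary i)
  | Cnot i j => Nd (unary 2) (Nd (unary i) (unary j))
  | Oracle xs ys => Nd (unary 3) (Nd (tlist unary xs) (tlist unary ys))
  end.

Definition tcircuit (C : circuit) : tree :=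
  Nd (unary (c_in C)) (Nd (unary (c_anc C))
    (Nd (unary (c_out C)) (tlist tgate (c_gates C)))).

(* QPT algorithms are polynomial-time uniform families of circuits. *)
Definition qpt (C : nat -> circuit) : Prop :=
  (forall lam, circuit_wf (C lam)) /\
  polytime (fun _ (_ : unit) => True) (fun=> Lf) (fun lam _ => tcircuit (C lam)).

(* A uniform family of k(lam) QPT algorithms: the index is part of the input of
   the program that generates the circuits. *)
Definition qpt_family (k : nat -> nat) (C : nat -> nat -> circuit) : Prop :=
  (forall lam j, (j < k lam)%N -> circuit_wf (C lam j)) /\
  polytime (fun lam j => (j < k lam)%N) unary (fun lam j => tcircuit (C lam j)).

(* Vectors and matrices of a register of n qubits are given by their entries on
   bit strings of length n; entries on other strings are irrelevant. *)
Definition vec := bits -> algC.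
Definition op := bits -> bits -> algC.
Definition oracle := bits -> bits.

Definition no_oracle : oracle := fun=> [::].

Definition ket (x : bits) : vec := fun y => (y == x)%:R.

Definition ketbra (x : bits) : op := fun u v => ket x u * ket x v.

(* The tensor product, the first factor having n qubits. *)
Definition tensor (n : nat) (rho sigma : op) : op := fun u v =>
  rho (take n u) (take n v) * sigma (drop n u) (drop n v).

Definition xor_wires (x : bits) (ys : seq nat) (z : bits) : bits :=
  mkseq (fun i => nth false x i (+) nth false (take (size ys) z) (index i ys))
        (size x).

Definition apply_gate (f : oracle) (psi : vec) (g : gate) : vec := fun x =>
  match g with
  | Had i => (sqrtC 2)^-1 * (psi (set_nth false x i false)
               + (-1) ^+ nth false x i * psi (set_nth false x i true))
  | Tgate i => (if nth false x i then (1 + 'i) / sqrtC 2 else 1) * psi x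
  | Cnot i j => psi (xor_wires x [:: j] [:: nth false x i])
  | Oracle xs ys => psi (xor_wires x ys (f [seq nth false x i | i <- xs]))
  end.

Definition run (f : oracle) (C : circuit) (u : bits) : vec :=
  foldl (apply_gate f) (ket (u ++ nseq (c_anc C) false)) (c_gates C).

(* <x| C(|u><v|) |y> where C is the channel computed by the circuit. *)
Definition channel (f : oracle) (C : circuit) (x y u v : bits) : algC :=
  \sum_(z : (c_wires C - c_out C).-tuple bool)
    run f C u (x ++ z) * (run f C v (y ++ z))^*.

Definition apply (f : oracle) (C : circuit) (rho : op) : op := fun x y =>
  \sum_(u : (c_in C).-tuple bool) \sum_(v : (c_in C).-tuple bool)
    channel f C x y u v * rho u v.

(** * Finite distributions, as lists of weighted outcomes *)

Definition dist (T : Type) := seq (algC * T).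

Definition ret (T : Type) (x : T) : dist T := [:: (1, x)].

Definition bind (T U : Type) (d : dist T) (f : T -> dist U) : dist U :=
  flatten [seq [seq (p.1 * q.1, q.2) | q <- f p.2] | p <- d].

Notation "'let*' p := d 'in' e" := (bind d (fun p => e))
  (at level 200, p as pattern, right associativity).

Definition expect (T : Type) (d : dist T) (f : T -> algC) : algC :=
  \sum_(p <- d) p.1 * f p.2.

Definition prob (d : dist bool) : algC := expect d (fun b => b%:R).

Definition uniform (n : nat) (A : {set n.-tuple bool}) : dist bits :=
  [seq (#|A|%:R^-1, tval x) | x <- enum A].

Definition measure (n : nat) (rho : op) : dist bits :=
  [seq (rho (tval x) (tval x), tval x) | x <- enum {: n.-tuple bool}].

(* Measures the last b of a + b qubits and returns the normalised
   post-measurement state of the first a qubits with the outcome. *)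
Definition measure_last (a b : nat) (rho : op) : dist (op * bits) :=
  let outcome (x : bits) :=
    let p := \sum_(u : a.-tuple bool) rho (u ++ x) (u ++ x) in
    (p, ((fun u v => p^-1 * rho (u ++ x) (v ++ x)) : op, x)) in
  [seq outcome (tval x) | x <- enum {: b.-tuple bool}].

Definition negligible (f : nat -> algC) : Prop :=
  forall c : nat, exists N : nat, forall lam : nat, (N <= lam)%N ->
    `|f lam| <= (lam%:R ^+ c)^-1.

(** * One-shot message authentication codes

  Verification is evaluated inside a classical function by the MAC-chain
  construction, hence is a deterministic classical polynomial-time algorithm. *)

Definition tvrfy_input (x : bits * bits * bits * bits * bits) : tree :=
  let: (pp, mvk, vk, m, sg) := x in
  tlist (tlist tbool) [:: pp; mvk; vk; m; sg].

Record osmac := OSMAC {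
  l_pp : nat -> nat;
  l_mvk : nat -> nat;
  l_sk : nat -> nat;    (* qubits of the signing key *)
  l_vk : nat -> nat;
  l_msg : nat -> nat;
  l_sig : nat -> nat;
  setup_circuit : nat -> circuit;
  keygen_circuit : nat -> circuit;
  sign_circuit : nat -> circuit;
  vrfy : nat -> bits -> bits -> bits -> bits -> bits -> bool;
  _ : [/\ poly_param l_pp, poly_param l_mvk & poly_param l_sk];
  _ : [/\ poly_param l_vk, poly_param l_msg & poly_param l_sig];
  _ : [/\ qpt setup_circuit, forall lam, c_in (setup_circuit lam) = 0%N
        & forall lam, c_out (setup_circuit lam) = (l_pp lam + l_mvk lam)%N];
  _ : [/\ qpt keygen_circuit, forall lam, c_in (keygen_circuit lam) = l_pp lam
        & forall lam, c_out (keygen_circuit lam) = (l_sk lam + l_vk lam)%N];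
  _ : [/\ qpt sign_circuit,
          forall lam, c_in (sign_circuit lam) = (l_sk lam + l_msg lam)%N
        & forall lam, c_out (sign_circuit lam) = l_sig lam];
  _ : polytime
        (fun lam (x : bits * bits * bits * bits * bits) =>
           let: (pp, mvk, vk, m, sg) := x in
           [/\ size pp = l_pp lam, size mvk = l_mvk lam, size vk = l_vk lam,
               size m = l_msg lam & size sg = l_sig lam])
        tvrfy_input
        (fun lam '(pp, mvk, vk, m, sg) => tbool (vrfy lam pp mvk vk m sg)) }.

Definition setup (S : osmac) (lam : nat) : dist (bits * bits) :=
  let* x := measure (l_pp S lam + l_mvk S lam)
          (apply no_oracle (setup_circuit S lam) (ketbra [::])) in
  ret (take (l_pp S lam) x, drop (l_pp S lam) x).

Definition keygen (S : osmac) (lam : nat) (pp : bits) : dist (op * bits) :=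
  measure_last (l_sk S lam) (l_vk S lam)
    (apply no_oracle (keygen_circuit S lam) (ketbra pp)).

Definition sign (S : osmac) (lam : nat) (sk : op) (m : bits) : dist bits :=
  measure (l_sig S lam)
    (apply no_oracle (sign_circuit S lam) (tensor (l_sk S lam) sk (ketbra m))).

(* The bound is uniform in the message, which may depend on the public
   parameters; constant functions [m] give the fixed messages.  The MAC chain
   signs verification keys generated from pp, so correctness for messages fixed
   before Setup says nothing about it. *)
Definition osmac_correct (S : osmac) : Prop :=
  exists2 e : nat -> algC, negligible e &
    forall (lam : nat) (m : bits -> bits),
      (forall pp, size (m pp) = l_msg S lam) ->
      1 - e lam <= prob
        (let* (pp, mvk) := setup S lam in
         let* (sk, vk) := keygen S lam pp in
         let* sg := sign S lam sk (m pp) in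
         ret (vrfy S lam pp mvk vk (m pp) sg)).

(** * Encryption with quantum ciphertexts in the classical oracle model *)

(* A ciphertext has a quantum part, an oracle, and a classical part. *)
Record ciphertext := Ciphertext {
  ct_q : op; ct_oracle : oracle; ct_c : bits }.

Record scheme := Scheme {
  ek_type : Type;
  l_dk : nat -> nat;
  l_ctq : nat -> nat;
  l_ctc : nat -> nat;
  l_plain : nat -> nat;
  msg_space : forall lam, {set (l_plain lam).-tuple bool};
  gen : nat -> dist (ek_type * bits);
  enc : nat -> ek_type -> bits -> dist ciphertext;
  dec : nat -> bits -> ciphertext -> dist (option bits) }.

(* The probability that k non-communicating parties B_0, ..., B_(k-1), given the
   blocks (of b_0, ..., b_(k-1) qubits) of the state rho, oracle f and the
   classical string dk, all output m:
   the entry at (m, ..., m), (m, ..., m) of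
   (B_0 (x) ... (x) B_(k-1)) (rho (x) |dk><dk|^k). *)
Definition win_prob (k : nat) (b : nat -> nat) (B : nat -> circuit)
    (f : oracle) (rho : op) (dk m : bits) : algC :=
  let block (U : bits) (j : nat) := nth [::] (reshape (mkseq b k) U) j in
  let N := (\sum_(j < k) b j)%N in
  \sum_(U : N.-tuple bool) \sum_(V : N.-tuple bool)
    rho U V *
    \prod_(j < k) channel f (B j) m m (block U j ++ dk) (block V j ++ dk).

Definition unclonable_game (E : scheme) (k : nat -> nat)
    (b : nat -> nat -> nat) (A : nat -> circuit) (B : nat -> nat -> circuit)
    (lam : nat) : algC :=
  expect
    (let* (ek, dk) := gen E lam in
     let* m := uniform (msg_space E lam) in
     let* ct := enc lam ek m in
     ret (dk, m, ct))
    (fun '(dk, m, ct) =>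
       let rho := apply (ct_oracle ct) (A lam)
                    (tensor (l_ctq E lam) (ct_q ct) (ketbra (ct_c ct))) in
       win_prob (k lam) (b lam) (B lam) (ct_oracle ct) rho dk m).

Definition ow_unclonable_secure (E : scheme) (k : nat -> nat) : Prop :=
  forall (b : nat -> nat -> nat) (A : nat -> circuit) (B : nat -> nat -> circuit),
    qpt A ->
    (forall lam, c_in (A lam) = (l_ctq E lam + l_ctc E lam)%N) ->
    (forall lam, c_out (A lam) = (\sum_(j < k lam) b lam j)%N) ->
    qpt_family k B ->
    (forall lam j, (j < k lam)%N -> c_in (B lam j) = (b lam j + l_dk E lam)%N) ->
    (forall lam j, (j < k lam)%N -> c_out (B lam j) = l_plain E lam) ->
    negligible (unclonable_game E k b A B).

(** * The MAC-chain construction *)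

Definition pad (l : nat) (x : bits) : bits := x ++ nseq (l - size x) false.

Section MacChain.

Variables (S : osmac) (n : nat -> nat) (l_m : nat -> nat).
Variable M : forall lam, {set (l_m lam).-tuple bool}.

Definition encode (lam : nat) (x : bits) : bits := pad (l_msg S lam) x.

Definition ute_gen (lam : nat) : dist (bits * bits * bits * bits) :=
  let* s := uniform [set: (n lam + lam).-tuple bool] in
  let* (pp, mvk) := setup S lam in
  ret ((pp, mvk, s), s).

(* The tuples st_v, for v in V_r by increasing length, concatenated:
     (vk_0, vk_1, sg)  (vk_v, vk_v0, vk_v1, sg_v) ...  (vk_r, sg_r)
   is regrouped below as
     (vk_0, vk_1, sg, vk_v)  (vk_v0, vk_v1, sg_v, vk_v') ...  sg_r.
   [chain_valid] reads the rest of this string at a node whose key is [vk], the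
   remaining part of the path to the leaf being [r]. *)
Fixpoint chain_valid (lam : nat) (pp mvk s' : bits) (r vk st : bits) : bool :=
  if r is b :: r' then
    let: (vk0, st1) := (take (l_vk S lam) st, drop (l_vk S lam) st) in
    let: (vk1, st2) := (take (l_vk S lam) st1, drop (l_vk S lam) st1) in
    let: (sg, st3) := (take (l_sig S lam) st2, drop (l_sig S lam) st2) in
    let: (vk', st4) := (take (l_vk S lam) st3, drop (l_vk S lam) st3) in
    [&& vrfy S lam pp mvk vk (encode lam (vk0 ++ vk1)) sg,
        vk' == (if b then vk1 else vk0)
      & chain_valid lam pp mvk s' r' vk' st4]
  else vrfy S lam pp mvk vk (encode lam s') st.

Definition l_query (lam : nat) : nat :=
  (n lam + lam + n lam
   + (n lam * (l_vk S lam + l_vk S lam + l_sig S lam + l_vk S lam)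
      + l_sig S lam))%N.

(* The output m is written 1 m, the output bot is written 0 0^|m|. *)
Definition ute_oracle (lam : nat) (pp mvk s m vk : bits) : oracle := fun x =>
  let: (s', y) := (take (n lam + lam) x, drop (n lam + lam) x) in
  let: (r, st) := (take (n lam) y, drop (n lam) y) in
  if [&& size x == l_query lam, s' == s & chain_valid lam pp mvk s' r vk st]
  then true :: m else nseq (l_m lam).+1 false.

Definition ute_enc (lam : nat) (ek : bits * bits * bits) (m : bits) :
    dist ciphertext :=
  let: (pp, mvk, s) := ek in
  let* (sk, vk) := keygen S lam pp in
  ret (Ciphertext sk (ute_oracle lam pp mvk s m vk) pp).

(* Signs the path 0^i below a node with signing key [sk]. *)
Fixpoint dec_chain (lam : nat) (pp dk : bits) (i : nat) (sk : op) : dist bits :=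
  if i is i'.+1 then
    let* (sk0, vk0) := keygen S lam pp in
    let* (_, vk1) := keygen S lam pp in
    let* sg := sign S lam sk (encode lam (vk0 ++ vk1)) in
    let* st := dec_chain lam pp dk i' sk0 in
    ret (vk0 ++ vk1 ++ sg ++ vk0 ++ st)
  else sign S lam sk (encode lam dk).

Definition ute_dec (lam : nat) (dk : bits) (ct : ciphertext) :
    dist (option bits) :=
  let* st := dec_chain lam (ct_c ct) dk (n lam) (ct_q ct) in
  let y := ct_oracle ct (dk ++ nseq (n lam) false ++ st) in
  ret (if head false y then Some (behead y) else None).

Definition mac_chain : scheme := {|
  ek_type := (bits * bits * bits)%type;
  l_dk := fun lam => (n lam + lam)%N;
  l_ctq := l_sk S;
  l_ctc := l_pp S;
  l_plain := l_m;
  msg_space := M;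
  gen := ute_gen;
  enc := ute_enc;
  dec := ute_dec |}.

End MacChain.

(* The messages of the code can encode pairs of verification keys and strings
   of length n + lam. *)
Definition large_messages (S : osmac) (n : nat -> nat) : Prop :=
  forall lam : nat,
    (l_vk S lam + l_vk S lam <= l_msg S lam)%N /\ (n lam + lam <= l_msg S lam)%N.

Definition superlogarithmic (n : nat -> nat) : Prop :=
  forall c : nat, exists N : nat, forall lam : nat, (N <= lam)%N ->
    (c * trunc_log 2 lam <= n lam)%N.

(* Main.v *)
(** The adversary A builds a tree of one-shot keys below the root key, as an
  honest decryptor would: each node signs the verification keys of its two
  children.  A tree of depth n has 2 ^ n >= k leaves, so A can stop at k leaves
  and hand the signing key of the j-th leaf, together with the signed path to
  it, to B_j.  When dk is revealed, every B_j signs it with its own leaf key and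
  queries the oracle; no key ever signs twice.

  Verification keys and signatures are only ever copied, so the success
  probability is that of the following classical experiment: every node draws
  its verification key and its signature from the honest distribution, given
  the message it signs.  This message depends on the keys of the children and
  on pp, but not on the key of the node itself.  Correctness, applied to the
  message that is worst for each pp, bounds the failure probability of a node
  by a negligible e, and a union bound over the polynomially many nodes shows
  that all B_j win with probability at least 1 - poly e. *)
From HB Require Import structures.
Require Import Defs.
From mathcomp Require Import all_boot all_order all_algebra all_field.
From mathcomp Require Import zify ring.

Set Implicit Arguments.
Unset Strict Implicit.
Unset Printing Implicit Defensive.

(** That the attack behaves like a classical experiment is a statement about interference. The OSMAC
    circuits trace out wires, so every run is purified: a configuration records, for each node, all
    final wires of KeyGen except the signing key, and all final wires of Sign, garbage included.
    Apart from the signing keys, everything that a configuration records stays on wires that the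
    challenger, A or some B_j traces out (or is the measured root key). Distinct configurations
    therefore leave orthogonal environments and cannot interfere. Each signing key enters the
    amplitude of exactly one node, so the amplitude of a configuration is a product over nodes. Only
    a lower bound is wanted: the squared amplitudes of the configurations in which all verifications
    succeed are kept and the others dropped.

    Uniformity requires an explicit program that prints the circuits. This is why the tree is
    replaced by a layered graph numbered by arithmetic; it gives well-formed circuits for every
    [lam], even where [k < 2 ^ n] fails. That inequality matters only in the analysis, for large
    [lam]. *)

(** * Encodings and polynomial bounds *)

(** Encodings are inferred from types. The canonical instances unfold to [unary], [tlist] and
    [tcircuit], and the one for pairs is the shape in which [polytime] passes [lam] together with
    its input. *)
Structure encType := EncType { esort :> Type; enc : esort -> tree }.

Canonical tree_enc := @EncType tree id.
Canonical nat_enc := @EncType nat unary.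
Canonical bool_enc := @EncType bool tbool.
Canonical unit_enc := @EncType unit (fun=> Lf).
Canonical seq_enc (T : encType) := @EncType (seq T) (tlist (@enc T)).
Canonical prod_enc (T U : encType) :=
  @EncType (T * U)%type (fun x => Nd (enc x.1) (enc x.2)).
Canonical gate_enc := @EncType gate tgate.
Canonical circuit_enc := @EncType circuit tcircuit.

Definition sz (T : encType) (x : T) : nat := tree_size (enc x).

Lemma tree_size_gt0 t : 0 < tree_size t.
Proof. by case: t. Qed.

(** Reading a variable and building a node are charged the full size of the result. Time bounds thus
    bound sizes, which keeps compositions polynomial. *)
Lemma eval_size env p v t : eval env p v t -> tree_size v <= t.
Proof. by elim=> //= *; lia. Qed.

(** Indices count from the top of the environment, so bindings added at the bottom are invisible. A
    program for one argument can therefore run inside [Let] and [Case]. *)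
Lemma eval_weaken env env' p v t : eval env p v t -> eval (env ++ env') p v t.
Proof.
move=> H; elim: {env p v t}H.
- move=> env i lt_i.
  have -> : nth Lf env i = nth Lf (env ++ env') i by rewrite nth_cat lt_i.
  by constructor; rewrite size_cat ltn_addr.
- by constructor.
- by move=> *; constructor.
- by move=> *; apply: EvalCaseLf.
- by move=> *; apply: EvalCaseNd; eauto.
- by move=> *; apply: EvalLet; eauto.
- by move=> *; apply: EvalStop.
- by move=> *; apply: EvalStep; eauto.
Qed.

Lemma eval1 x env p v t : eval [:: x] p v t -> eval (x :: env) p v t.
Proof. exact: (@eval_weaken [:: x] env). Qed.

Lemma leq_exp2rW m n e : m <= n -> m ^ e <= n ^ e.
Proof. by case: e => // e le_mn; rewrite leq_exp2r. Qed.

(** As the base is at least 2, a single exponent absorbs constants, sums and products. *)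
Definition polyb (A : encType) (g : A -> nat) : Prop :=
  exists d, forall a, g a <= (sz a).+2 ^ d.

Section PolyBounds.

Variables A B : encType.

Lemma polyb_le (g h : A -> nat) : polyb h -> (forall a, g a <= h a) -> polyb g.
Proof. by case=> d Hh le_gh; exists d => a; apply: leq_trans (Hh a). Qed.

Lemma polyb_const c : polyb (fun _ : A => c).
Proof.
exists c => a; apply: leq_trans (_ : 2 ^ c <= _); last exact: leq_exp2rW.
exact: ltnW (ltn_expl _ _).
Qed.

Lemma polyb_sz : polyb (fun a : A => sz a).
Proof. by exists 1 => a; rewrite expn1; lia. Qed.

Lemma polyb_add (g h : A -> nat) : polyb g -> polyb h -> polyb (fun a => g a + h a).
Proof.
case=> d Hg [e Hh]; exists (d + e).+1 => a.
have := Hg a; have := Hh a; rewrite expnS expnD.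
have := expn_gt0 (sz a).+2 d; have := expn_gt0 (sz a).+2 e; rewrite /=.
move: (_ ^ d) (_ ^ e) => x y; nia.
Qed.

Lemma polyb_mul (g h : A -> nat) : polyb g -> polyb h -> polyb (fun a => g a * h a).
Proof.
by case=> d Hg [e Hh]; exists (d + e) => a; rewrite expnD leq_mul.
Qed.

Lemma polyb_comp (f : A -> B) (g : B -> nat) :
  polyb (fun a => sz (f a)) -> polyb g -> polyb (fun a => g (f a)).
Proof.
case=> e Hf [d Hg]; exists ((e + 2) * d) => a; apply: leq_trans (Hg _) _.
rewrite expnM; apply: leq_exp2rW; have := Hf a; rewrite expnD.
by have := expn_gt0 (sz a).+2 e; rewrite /=; move: (_ ^ e) => x; nia.
Qed.

End PolyBounds.

Ltac polyb_tac :=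
  repeat first [ assumption | exact: polyb_const | exact: polyb_sz
               | exact: polyb_comp | apply: polyb_add | apply: polyb_mul ].

(** Removes an auxiliary argument, such as a loop state, whose size is already controlled by [a]. *)
Lemma polyb_pair (A T : encType) (g : A * T -> nat) (h : A -> nat) :
  polyb g -> polyb h ->
  exists2 g' : A -> nat, polyb g' & forall a t, sz t <= h a -> g (a, t) <= g' a.
Proof.
case=> d Hg Hh; exists (fun a => (sz a + h a + 3) ^ d).
  have [e He] : polyb (fun a : A => sz a + h a + 3) by polyb_tac.
  by exists (e * d) => a; rewrite expnM leq_exp2rW.
move=> a t le_t; apply: leq_trans (Hg _) _; apply: leq_exp2rW.
by move: le_t; rewrite /sz /=; lia.
Qed.

(** * Polynomial-time computable functions *)

(** The time bound is a function of [a] rather than an explicit power, so that bounds add up along a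
    program and are compared with powers only through [polyb]. *)
Definition pt (A B : encType) (f : A -> B) : Prop :=
  exists p, exists2 g : A -> nat, polyb g
    & forall a, exists2 t, t <= g a & eval [:: enc a] p (enc (f a)) t.

Section PT.

Variables A B C : encType.

Lemma pt_ext (f g : A -> B) : f =1 g -> pt f -> pt g.
Proof. by move=> fg [p [h Hh Hp]]; exists p, h => // a; rewrite -fg. Qed.

(* Only the encodings of the values matter: this is how functions on one type
   are used on another one with the same encoding. *)
Lemma pt_recode (A' B' : encType) (f : A -> B) (f' : A' -> B') (i : A' -> A) :
  (forall a, enc (i a) = enc a) -> (forall a, enc (f (i a)) = enc (f' a)) ->
  pt f -> pt f'.
Proof.
move=> Ei Ef [p [h [d Hh] Hp]]; exists p, (fun a => h (i a)).
  by exists d => a; apply: leq_trans (Hh _) _; rewrite /sz Ei.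
by move=> a; have [t le_t He] := Hp (i a); exists t; rewrite // -Ei -Ef.
Qed.

Lemma pt_size (f : A -> B) : pt f -> polyb (fun a => sz (f a)).
Proof.
case=> p [h Hh Hp]; apply: polyb_le Hh _ => a.
by have [t le_t /eval_size le_s] := Hp a; apply: leq_trans le_t.
Qed.

Lemma pt_id : pt (fun a : A => a).
Proof.
exists (Var 0), (fun a => sz a); first exact: polyb_sz.
by move=> a; exists (sz a) => //; apply: (@EvalVar [:: enc a] 0).
Qed.

Lemma pt_comp (f : A -> B) (g : B -> C) : pt f -> pt g -> pt (fun a => g (f a)).
Proof.
move=> Hf; have Sf := pt_size Hf; case: Hf => p [h Hh Hp] [q [k Hk Hq]].
exists (Let p q), (fun a => (h a + k (f a)) + 1).
  by polyb_tac.
move=> a; have [s le_s Es] := Hp a; have [t le_t Et] := Hq (f a).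
by exists (s + t).+1; [lia | apply: EvalLet Es _; apply: eval1].
Qed.

Lemma pt_pair (f : A -> B) (g : A -> C) : pt f -> pt g -> pt (fun a => (f a, g a)).
Proof.
move=> [p [h Hh Hp]] [q [k Hk Hq]].
exists (Node p q), (fun a => (h a + k a) + (h a + k a) + 1).
  by polyb_tac.
move=> a; have [s le_s Es] := Hp a; have [t le_t Et] := Hq a.
exists (s + t + sz (f a, g a)); last exact: EvalNode.
by have := eval_size Es; have := eval_size Et; rewrite /sz /=; lia.
Qed.

Fixpoint quote (t : tree) : expr :=
  if t is Nd l r then Node (quote l) (quote r) else Leaf.

Lemma pt_const (b : B) : pt (fun _ : A => b).
Proof.
have [t Et] : exists t, forall env, eval env (quote (enc b)) (enc b) t.
  elim: (enc b) => [|l [s Hs] r [t Ht]]; first by exists 1 => env; constructor.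
  by exists (s + t + tree_size (Nd l r)) => env; constructor.
exists (quote (enc b)), (fun=> t); first exact: polyb_const.
by move=> a; exists t.
Qed.

Lemma pt_if (c : A -> bool) (f g : A -> B) :
  pt c -> pt f -> pt g -> pt (fun a => if c a then f a else g a).
Proof.
move=> [r [l Hl Hr]] [p [h Hh Hp]] [q [k Hk Hq]].
(* [Case] pushes both subtrees of the condition, so the input has index 2 in the true branch and is
   rebound on top for [p]. *)
exists (Case r q (Let (Var 2) p)), (fun a => l a + h a + k a + sz a + 2).
  by polyb_tac.
move=> a; have [u le_u] := Hr a; case: (c a) => Eu.
  have [s le_s Es] := Hp a; exists (u + (sz a + s).+1).+1; first lia.
  apply: EvalCaseNd Eu _; apply: EvalLet; last exact: eval1 Es.
  exact: (@EvalVar [:: Lf; Lf; enc a] 2).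
have [s le_s Es] := Hq a; exists (u + s).+1; first lia.
exact: EvalCaseLf.
Qed.

End PT.

Section PolytimeFunctions.

Implicit Types A B C T S U : encType.

Lemma pt_left A (f : A -> tree) :
  pt f -> pt (fun a => if f a is Nd l _ then l else Lf : tree).
Proof.
move=> Hf; suff H : pt (fun t : tree => if t is Nd l _ then l else Lf : tree).
  exact: pt_comp Hf H.
exists (Case (Var 0) Leaf (Var 0)), (fun t => sz t + sz t + 2).
  by polyb_tac.
case=> [|l r].
  exists (1 + 1).+1; first by rewrite /sz /=; lia.
  by apply: EvalCaseLf; [apply: (@EvalVar [:: Lf] 0) | constructor].
exists (tree_size (Nd l r) + tree_size l).+1; first by rewrite /sz /=; lia.
by apply: EvalCaseNd; [apply: (@EvalVar [:: Nd l r] 0) | apply: (@EvalVar [:: l; r;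
  Nd l r] 0)].
Qed.

Lemma pt_right A (f : A -> tree) :
  pt f -> pt (fun a => if f a is Nd _ r then r else Lf : tree).
Proof.
move=> Hf; suff H : pt (fun t : tree => if t is Nd _ r then r else Lf : tree).
  exact: pt_comp Hf H.
exists (Case (Var 0) Leaf (Var 1)), (fun t => sz t + sz t + 2).
  by polyb_tac.
case=> [|l r].
  exists (1 + 1).+1; first by rewrite /sz /=; lia.
  by apply: EvalCaseLf; [apply: (@EvalVar [:: Lf] 0) | constructor].
exists (tree_size (Nd l r) + tree_size r).+1; first by rewrite /sz /=; lia.
by apply: EvalCaseNd; [apply: (@EvalVar [:: Nd l r] 0) | apply: (@EvalVar [:: l; r;
  Nd l r] 1)].
Qed.

(* The tree is nonempty; on naturals, lists and booleans this is the test for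
   a positive, nonempty or true argument. *)
Lemma pt_isnode A (f : A -> tree) :
  pt f -> pt (fun a => if f a is Nd _ _ then true else false).
Proof.
move=> Hf; suff H : pt (fun t : tree => if t is Nd _ _ then true else false).
  exact: pt_comp Hf H.
exists (Case (Var 0) Leaf (Node Leaf Leaf)), (fun t => sz t + 7).
  by polyb_tac.
case=> [|l r].
  exists (1 + 1).+1; first by rewrite /sz /=; lia.
  by apply: EvalCaseLf; [apply: (@EvalVar [:: Lf] 0) | constructor].
exists (tree_size (Nd l r) + (1 + 1 + 3)).+1; first by rewrite /sz /=; lia.
by apply: EvalCaseNd; [apply: (@EvalVar [:: Nd l r] 0) | do !constructor].
Qed.

Lemma pt_fst A B C (f : A -> B * C) : pt f -> pt (fun a => (f a).1).
Proof.
move=> Hf; have Hl := pt_left (@pt_id tree_enc).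
by apply: pt_comp Hf _; apply: (pt_recode (i := fun x : B * C => enc x)) Hl.
Qed.

Lemma pt_snd A B C (f : A -> B * C) : pt f -> pt (fun a => (f a).2).
Proof.
move=> Hf; have Hl := pt_right (@pt_id tree_enc).
by apply: pt_comp Hf _; apply: (pt_recode (i := fun x : B * C => enc x)) Hl.
Qed.

Lemma sz_cat_r (T : encType) (s1 s2 : seq T) : sz s2 <= sz (s1 ++ s2).
Proof. by elim: s1 => //= x s1 IH; rewrite /sz /= in IH *; lia. Qed.

Lemma sz_mem (T : encType) (s1 s2 : seq T) x : sz x < sz (s1 ++ x :: s2).
Proof.
apply: leq_trans (sz_cat_r s1 _); rewrite /sz /=.
by have := tree_size_gt0 (tlist (@enc T) s2); lia.
Qed.

Lemma size_sz (T : encType) (s : seq T) : size s < sz s.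
Proof. by elim: s => //= x s; rewrite /sz /=; have := tree_size_gt0 (enc x); lia. Qed.

(** The state is [(list, (a, s))]. Behind the two outer [Case]s, [Var 0] and [Var 1] are the head
    and the tail of the list and [Var 3] is [(a, s)]; the next state is
    [(tail, (a, F (a, s, head)))]. The [Leaf] branches are never reached. *)
Definition loop_body (p : expr) : expr :=
  Case (Var 0) Leaf
    (Case (Var 0) Leaf
       (Node (Var 1)
          (Node (Case (Var 3) Leaf (Var 0)) (Let (Node (Var 3) (Var 0)) p)))).

(* [While] tests whether the left subtree of its state is [Lf], so a list put
   there is consumed one element per iteration. *)
Lemma pt_foldl_loop A T S (F : A * S * T -> S) (s0 : A -> S) (l : A -> seq T)
    (h : A -> nat) :
  pt F -> pt s0 -> pt l -> polyb h ->
  (forall a i, i <= size (l a) ->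
     sz (foldl (fun s t => F (a, s, t)) (s0 a) (take i (l a))) <= h a) ->
  pt (fun a => (a, foldl (fun s t => F (a, s, t)) (s0 a) (l a))).
Proof.
case=> p [g Hg Hp] H0 Hl Hh Hbound.
have Sl := pt_size Hl; have Hi := pt_pair Hl (pt_pair (pt_id A) H0).
have [g' Hg' le_g] : exists2 g', polyb g' & forall a s t, sz s <= h a ->
    sz t <= sz (l a) -> g (a, s, t) <= g' a.
  have [e He] := Hg; pose u a := (sz a + h a + sz (l a) + 6) ^ e.
  exists u.
    have [d Hd] : polyb (fun a : A => sz a + h a + sz (l a) + 6).
      by polyb_tac.
    by exists (d * e) => a; rewrite expnM leq_exp2rW.
  move=> a s t le_s le_t; apply: leq_trans (He _) _; apply: leq_exp2rW.
  by move: le_s le_t; rewrite /sz /=; lia.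
case: Hi => q [k Hk Hq].
(* [c a] bounds the cost of one pass: the body reads and builds a fixed number of trees no larger
   than the state, for which 20 leaves ample room, and [g' a] pays for [p]. *)
pose c a := 20 * (sz a + h a + sz (l a) + 6) + g' a.
exists (Let q (While (loop_body p))), (fun a => k a + sz (l a) * c a + c a + 2).
  by rewrite /c; polyb_tac.
move=> a; have [u le_u Eu] := Hq a.
have loop l1 l2 env : l a = l1 ++ l2 ->
    let s := foldl (fun s t => F (a, s, t)) (s0 a) l1 in
    exists2 t, t <= size l2 * c a + c a
      & eval (Nd (enc l2) (Nd (enc a) (enc s)) :: env) (While (loop_body p))
          (Nd (enc a) (enc (foldl (fun s t => F (a, s, t)) (s0 a) (l a)))) t.
  elim: l2 l1 => [|x l2 IH] l1 El /=.
    rewrite cats0 in El; rewrite El; eexists; last exact: EvalStop.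
    have := Hbound a (size (l a)) (leqnn _); rewrite take_size El /c /sz /=; lia.
  set s := foldl _ _ l1.
  have [] := IH (rcons l1 x); first by rewrite cat_rcons.
  rewrite foldl_rcons -/s => t le_t Et.
  have [v le_v Ev] := Hp (a, s, x).
  have Ss : sz s <= h a.
    have := Hbound a (size l1); rewrite El size_cat leq_addr => /(_ isT).
    by rewrite take_size_cat.
  have Sx : sz x <= sz (l a) by rewrite El ltnW // sz_mem.
  have S2 : sz (x :: l2) <= sz (l a) by rewrite El sz_cat_r.
  have Ss' : sz (F (a, s, x)) <= h a.
    have := Hbound a (size l1).+1; rewrite El size_cat /= addnS ltnS leq_addr.
    move=> /(_ isT); rewrite -cat_rcons take_size_cat ?size_rcons //.
    by rewrite foldl_rcons.
  have le_vg := leq_trans le_v (le_g a s x Ss Sx).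
  eexists; last first.
    apply: EvalStep Et; set X := Nd (Nd _ _) _; set env' := X :: env.
    apply: EvalCaseNd; first exact: (@EvalVar env' 0).
    apply: EvalCaseNd.
      exact: (@EvalVar [:: Nd (enc x) (enc l2), Nd (enc a) (enc s) & env'] 0).
    set env2 := _ :: _; apply: EvalNode; first exact: (@EvalVar env2 1).
    apply: EvalNode.
      apply: EvalCaseNd; first exact: (@EvalVar env2 3).
      exact: (@EvalVar [:: enc a, enc s & env2] 0).
    apply: EvalLet; last exact: eval1 Ev.
    by apply: EvalNode; [exact: (@EvalVar env2 3) | exact: (@EvalVar env2 0)].
  move: le_t le_vg Ss Sx S2 Ss'; rewrite mulSn /c /sz /=.
  move: (_ * _) => z; lia.
have [t le_t Et] := loop [::] (l a) [:: enc a] erefl.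
exists (u + t).+1; last by apply: EvalLet Eu Et.
by have := size_sz (l a); nia.
Qed.

(** The bound on all intermediate states has to be supplied: a polynomial-time step may double its
    argument, so a polynomial number of steps does not by itself keep the state small. *)
Lemma pt_foldl A T S (F : A * S * T -> S) (s0 : A -> S) (l : A -> seq T)
    (h : A -> nat) :
  pt F -> pt s0 -> pt l -> polyb h ->
  (forall a i, i <= size (l a) ->
     sz (foldl (fun s t => F (a, s, t)) (s0 a) (take i (l a))) <= h a) ->
  pt (fun a => foldl (fun s t => F (a, s, t)) (s0 a) (l a)).
Proof.
move=> HF H0 Hl Hh Hb.
exact: (pt_snd (pt_foldl_loop HF H0 Hl Hh Hb)).
Qed.

Lemma sz_nat (n : nat) : sz n = n.*2.+1.
Proof. by elim: n => //= n; rewrite /sz /=; lia. Qed.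

Lemma sz_pair A B (a : A) (b : B) : sz (a, b) = (sz a + sz b).+1.
Proof. by []. Qed.

Lemma sz_cons T (x : T) (s : seq T) : sz (x :: s) = (sz x + sz s).+1.
Proof. by []. Qed.

Lemma sz_catrev T (s1 s2 : seq T) : (sz (catrev s1 s2)).+1 = sz s1 + sz s2.
Proof. by elim: s1 s2 => //= x s1 IH s2; rewrite IH !sz_cons; lia. Qed.

Lemma sz_cat T (s1 s2 : seq T) : (sz (s1 ++ s2)).+1 = sz s1 + sz s2.
Proof. by elim: s1 s2 => //= x s1 IH s2; rewrite !sz_cons; have := IH s2; lia. Qed.

Lemma sz_take T i (s : seq T) : sz (take i s) <= sz s.
Proof. by have := sz_cat (take i s) (drop i s); rewrite cat_take_drop {1}/sz;
  have := tree_size_gt0 (enc (drop i s)); rewrite -!/(sz _); lia. Qed.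

Lemma all_sz T (s : seq T) : all (fun t => sz t <= sz s) s.
Proof.
elim: s => //= x s IH; apply/andP; split; first by rewrite sz_cons; lia.
by apply: sub_all IH => t; rewrite sz_cons; lia.
Qed.

(** Accumulating from the left reverses, so [catrev] is the primitive from which reversal and
    concatenation are obtained. *)
Lemma pt_catrev A T (f g : A -> seq T) :
  pt f -> pt g -> pt (fun a => catrev (f a) (g a)).
Proof.
move=> Hf Hg.
have cr a s : foldl (fun s (x : T) => x :: s) (g a) s = catrev s (g a).
  by elim: s (g a) => //= x s IH t; rewrite IH.
apply: (pt_ext (fun a => cr a (f a))).
apply: (@pt_foldl _ _ _ (fun p : A * seq T * T => p.2 :: p.1.2) _ _
  (fun a => sz (f a) + sz (g a))) => //.
- apply: (@pt_recode _ _ _ _ (fun p : A * seq T * T => (p.2, p.1.2)) _ id) => //.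
  apply: pt_pair; first exact: pt_snd (pt_id _).
  exact: pt_snd (pt_fst (pt_id _)).
- by have Sf := pt_size Hf; have Sg := pt_size Hg; polyb_tac.
move=> a i le_i; rewrite cr.
have := sz_catrev (take i (f a)) (g a); have := sz_take i (f a); lia.
Qed.

Lemma pt_rev A T (f : A -> seq T) : pt f -> pt (fun a => rev (f a)).
Proof. by move=> Hf; apply: pt_catrev Hf (pt_const _ _). Qed.

Lemma pt_cat A T (f g : A -> seq T) : pt f -> pt g -> pt (fun a => f a ++ g a).
Proof.
move=> Hf Hg; apply: (pt_ext (f := fun a => catrev (rev (f a)) (g a))) => [a|];
  first by rewrite catrevE revK.
by apply: pt_catrev => //; apply: pt_rev.
Qed.

Lemma pt_cons A T (f : A -> T) (g : A -> seq T) :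
  pt f -> pt g -> pt (fun a => f a :: g a).
Proof.
move=> Hf Hg.
by apply: (@pt_recode _ _ _ _ (fun a => (f a, g a)) _ id) => //; apply: pt_pair.
Qed.

Lemma pt_flatmap A T U (F : A -> T -> seq U) (l : A -> seq T) :
  pt (fun p : A * T => F p.1 p.2) -> pt l ->
  pt (fun a => flatten [seq F a t | t <- l a]).
Proof.
move=> HF Hl; have Sl := pt_size Hl.
have [g Hg le_g] := polyb_pair (pt_size HF) Sl.
have fl a s : foldl (fun s t => catrev (F a t) s) [::] s
    = rev (flatten [seq F a t | t <- s]).
  elim/last_ind: s => // s x IH; rewrite foldl_rcons IH catrevE.
  by rewrite map_rcons flatten_rcons rev_cat.
apply: (pt_ext (f := fun a => rev (rev (flatten [seq F a t | t <- l a])))) => [a|];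
  first by rewrite revK.
apply: pt_rev; apply: (pt_ext (fun a => fl a (l a))).
apply: (@pt_foldl _ _ _ (fun p : A * seq U * T => catrev (F p.1.1 p.2) p.1.2) _ _
  (fun a => sz (l a) * g a + 1)) => //.
- apply: pt_catrev; last exact: pt_snd (pt_fst (pt_id _)).
  apply: (@pt_comp _ _ _ (fun p : A * seq U * T => (p.1.1, p.2))) HF.
  apply: pt_pair; first exact: pt_fst (pt_fst (pt_id _)).
  exact: pt_snd (pt_id _).
- exact: pt_const.
- by polyb_tac.
move=> a i le_i.
suff : forall s, all (fun t => sz t <= sz (l a)) s ->
    sz (foldl (fun s t => catrev (F a t) s) [::] s) <= size s * g a + 1.
  move/(_ (take i (l a))) => H; apply: leq_trans (H _) _.
    have := all_cat (fun t => sz t <= sz (l a)) (take i (l a)) (drop i (l a)).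
    by rewrite cat_take_drop all_sz => /esym/andP[].
  rewrite leq_add2r leq_mul2r size_takel //; have := size_sz (l a); lia.
elim/last_ind => // s x IH; rewrite all_rcons => /andP[Hx /IH Hs].
rewrite foldl_rcons size_rcons mulSn.
have := sz_catrev (F a x) (foldl (fun s t => catrev (F a t) s) [::] s).
have := le_g a x Hx; rewrite /=; move: Hs; set y := foldl _ _ _; lia.
Qed.

Lemma pt_map A T U (F : A -> T -> U) (l : A -> seq T) :
  pt (fun p : A * T => F p.1 p.2) -> pt l -> pt (fun a => [seq F a t | t <- l a]).
Proof.
move=> HF Hl.
apply: (pt_ext (fun a => flatten_map1 (F a) (l a))).
apply: pt_flatmap => //.
exact: pt_cons HF (pt_const _ _).
Qed.

(** A unary number is encoded like a list of that many units, so iteration is a fold over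
    [nseq (N a) tt]. *)
Lemma pt_iter A S (F : A -> S -> S) (s0 : A -> S) (N : A -> nat) (h : A -> nat) :
  pt (fun p : A * S => F p.1 p.2) -> pt s0 -> pt N -> polyb h ->
  (forall a i, i <= N a -> sz (iter i (F a) (s0 a)) <= h a) ->
  pt (fun a => iter (N a) (F a) (s0 a)).
Proof.
move=> HF H0 HN Hh Hb.
have fl a n s : foldl (fun s (_ : unit) => F a s) s (nseq n tt) = iter n (F a) s.
  by elim: n s => //= n IH s; rewrite IH -iterSr.
apply: (pt_ext (fun a => fl a (N a) (s0 a))).
apply: (@pt_foldl _ _ _ (fun p : A * S * unit => F p.1.1 p.1.2) _ _ h) => //.
- exact: (@pt_comp _ _ _ (fun p : A * S * unit => p.1) _ (pt_fst (pt_id _)) HF).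
- apply: (pt_recode (i := id)) HN => // a /=.
  by elim: (N a) => //= n ->.
move=> a i; rewrite size_nseq => le_i.
have -> : take i (nseq (N a) tt) = nseq i tt.
  by rewrite -(subnKC le_i) nseqD take_size_cat // size_nseq.
by rewrite fl; apply: Hb.
Qed.

Lemma pt_S A (f : A -> nat) : pt f -> pt (fun a => (f a).+1).
Proof.
move=> Hf; apply: (@pt_recode _ _ _ _ (fun a => (tt, f a)) _ id) => //.
exact: pt_pair (pt_const _ _) Hf.
Qed.

Lemma pt_pred A (f : A -> nat) : pt f -> pt (fun a => (f a).-1).
Proof.
move=> Hf; apply: (pt_recode (i := id) (A := A)) (pt_right (pt_recode (i := id) (f' :=
  fun a => enc (f a)) _ _ Hf)) => // a.
by case: (f a).
Qed.

Lemma pt_nat_size A (f : A -> nat) : pt f -> polyb f.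
Proof.
move=> Hf; have Sf := pt_size Hf; apply: polyb_le Sf _ => a; rewrite sz_nat; lia.
Qed.

Lemma pt_add A (f g : A -> nat) : pt f -> pt g -> pt (fun a => f a + g a).
Proof.
move=> Hf Hg; have Sf := pt_nat_size Hf; have Sg := pt_nat_size Hg.
apply: (pt_ext (f := fun a => iter (g a) succn (f a))) => [a|];
  first by rewrite iter_succn.
apply: (@pt_iter _ _ (fun=> succn) _ _ (fun a => 2 * (f a + g a) + 1)) => //.
- exact: pt_S (pt_snd (pt_id _)).
- by polyb_tac.
by move=> a i le_i; rewrite iter_succn sz_nat; lia.
Qed.

Lemma pt_mul A (f g : A -> nat) : pt f -> pt g -> pt (fun a => f a * g a).
Proof.
move=> Hf Hg; have Sf := pt_nat_size Hf; have Sg := pt_nat_size Hg.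
apply: (pt_ext (f := fun a => iter (g a) (addn (f a)) 0)) => [a|];
  first by rewrite iter_addn_0.
apply: (@pt_iter _ _ (fun a => addn (f a)) _ _ (fun a => 2 * (f a * g a) + 1)) => //.
- apply: pt_add; last exact: pt_snd (pt_id _).
  exact: pt_comp (pt_fst (pt_id _)) Hf.
- exact: pt_const.
- by polyb_tac.
by move=> a i le_i; rewrite iter_addn_0 sz_nat; nia.
Qed.

Lemma pt_sub A (f g : A -> nat) : pt f -> pt g -> pt (fun a => f a - g a).
Proof.
move=> Hf Hg; have Sf := pt_nat_size Hf; have Sg := pt_nat_size Hg.
have E m n : iter n predn m = m - n.
  by elim: n => [|n /= ->]; rewrite ?subn0 // subnS.
apply: (pt_ext (fun a => E (f a) (g a))).
apply: (@pt_iter _ _ (fun=> predn) _ _ (fun a => 2 * f a + 1)) => //.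
- exact: pt_pred (pt_snd (pt_id _)).
- by polyb_tac.
by move=> a i le_i; rewrite E sz_nat; lia.
Qed.

Lemma pt_gt0 A (f : A -> nat) : pt f -> pt (fun a => 0 < f a).
Proof.
move=> Hf; apply: (pt_recode (i := id) (A := A)) (pt_isnode (pt_recode (i := id) (f' :=
  fun a => enc (f a)) _ _ Hf)) => // a.
by case: (f a).
Qed.

Lemma pt_ltn A (f g : A -> nat) : pt f -> pt g -> pt (fun a => f a < g a).
Proof.
move=> Hf Hg; apply: (pt_ext (f := fun a => (0 < g a - f a))) => [a|];
  first by rewrite subn_gt0.
exact: pt_gt0 (pt_sub _ _).
Qed.

(** Unary division by counting: [step] increments the remainder and carries into the quotient when
    the divisor is reached. *)
Lemma pt_edivn A (f g : A -> nat) :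
  pt f -> pt g -> (forall a, 0 < g a) -> pt (fun a => (f a %/ g a, f a %% g a)).
Proof.
move=> Hf Hg g_gt0; have Sf := pt_nat_size Hf; have Sg := pt_nat_size Hg.
pose step d (p : nat * nat) := if p.2.+1 < d then (p.1, p.2.+1) else (p.1.+1, 0).
have E a n : iter n (step (g a)) (0, 0) = (n %/ g a, n %% g a).
  elim: n => [|n /= ->]; first by rewrite div0n mod0n.
  have En := divn_eq n (g a); have lt_r := ltn_pmod n (g_gt0 a).
  rewrite /step /=; move: lt_r En; set q := n %/ _; set r := n %% _ => lt_r En.
  have -> : n.+1 = q * g a + r.+1 by rewrite En addnS.
  rewrite divnMDl // modnMDl; case: ltnP => [lt_r1 | ge_r].
    by rewrite divn_small // modn_small // addn0.
  have -> : r.+1 = g a by apply/eqP; rewrite eqn_leq lt_r.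
  by rewrite divnn modnn g_gt0 addn1.
apply: (pt_ext (fun a => E a (f a))).
apply: (@pt_iter _ _ (fun a => step (g a)) _ _ (fun a => 4 * f a + 3)) => //.
- rewrite /step.
  have Hp : pt (fun p : A * (nat * nat) => p.2.1) by apply/pt_fst/pt_snd/pt_id.
  have Hq : pt (fun p : A * (nat * nat) => p.2.2) by apply/pt_snd/pt_snd/pt_id.
  apply: pt_if.
  + apply: pt_ltn; first exact: pt_S.
    exact: pt_comp (pt_fst (pt_id _)) Hg.
  + by apply: pt_pair => //; apply: pt_S.
  + by apply: pt_pair; [apply: pt_S | apply: pt_const].
- exact: pt_const.
- by polyb_tac.
move=> a i le_i; rewrite E sz_pair !sz_nat.
have := leq_div i (g a); have := leq_mod i (g a); lia.
Qed.

Lemma pt_divn A (f g : A -> nat) :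
  pt f -> pt g -> (forall a, 0 < g a) -> pt (fun a => f a %/ g a).
Proof. by move=> Hf Hg g_gt0; exact: (pt_fst (pt_edivn Hf Hg g_gt0)). Qed.

Lemma pt_modn A (f g : A -> nat) :
  pt f -> pt g -> (forall a, 0 < g a) -> pt (fun a => f a %% g a).
Proof. by move=> Hf Hg g_gt0; exact: (pt_snd (pt_edivn Hf Hg g_gt0)). Qed.

(** In unary, [2 ^ g a] can be exponentially long and must not be computed; halving [g a] times
    avoids it. *)
Lemma pt_divn_pow2 A (f g : A -> nat) :
  pt f -> pt g -> pt (fun a => f a %/ 2 ^ g a).
Proof.
move=> Hf Hg; have Sf := pt_nat_size Hf.
have E m n : iter n (divn^~ 2) m = m %/ 2 ^ n.
  by elim: n => [|n /= ->]; rewrite ?divn1 // expnSr divnMA.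
apply: (pt_ext (fun a => E (f a) (g a))).
apply: (@pt_iter _ _ (fun=> divn^~ 2) _ _ (fun a => 2 * f a + 1)) => //.
- by apply: pt_divn => //; [apply/pt_snd/pt_id | apply: pt_const].
- by polyb_tac.
move=> a i le_i; rewrite E sz_nat.
have := leq_div (f a) (2 ^ i); lia.
Qed.

Lemma pt_iota A (f g : A -> nat) : pt f -> pt g -> pt (fun a => iota (f a) (g a)).
Proof.
move=> Hf Hg; have Sf := pt_nat_size Hf; have Sg := pt_nat_size Hg.
pose step (p : nat * seq nat) := (p.1.+1, p.1 :: p.2).
have E m n : iter n step (m, [::]) = (m + n, rev (iota m n)).
  elim: n => [|n IH]; first by rewrite addn0.
  rewrite iterS IH; have -> : iota m n.+1 = rcons (iota m n) (m + n) by rewrite -addn1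
    iotaD cats1.
  by rewrite /step /= addnS rev_rcons.
apply: (pt_ext (f := fun a => rev (iter (g a) step (f a, [::])).2)) => [a|];
  first by rewrite E revK.
apply/pt_rev/pt_snd.
apply: (@pt_iter _ _ (fun=> step) _ _
  (fun a => (g a + 1) * (2 * (f a + g a) + 4) + 2)) => //.
- have H1 : pt (fun p : A * (nat * seq nat) => p.2.1) by apply/pt_fst/pt_snd/pt_id.
  have H2 : pt (fun p : A * (nat * seq nat) => p.2.2) by apply/pt_snd/pt_snd/pt_id.
  by apply: pt_pair; [apply: pt_S | apply: pt_cons].
- exact: pt_pair Hf (pt_const _ _).
- by polyb_tac.
move=> a i le_i.
have le2 : (sz (iter i step (f a, [::])).2 <= i * (2 * (f a + g a) + 4) + 1).
  elim: i le_i => // i IH lt_i; have := IH (ltnW lt_i).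
  have -> : (iter i.+1 step (f a, [::])).2 = (f a + i) :: (iter i step (f a, [::])).2.
    by rewrite !E -[i.+1]addn1 iotaD cats1 rev_rcons.
  by rewrite sz_cons sz_nat mulSn; lia.
move: le2; rewrite E sz_pair sz_nat /=; nia.
Qed.

(** * Gates and circuits as data *)

Lemma pt_Had A (f : A -> nat) : pt f -> pt (fun a => Had (f a)).
Proof.
move=> Hf; apply: (@pt_recode _ _ _ _ (fun a => (0, f a)) _ id) => //.
exact: pt_pair (pt_const _ _) Hf.
Qed.

Lemma pt_Tgate A (f : A -> nat) : pt f -> pt (fun a => Tgate (f a)).
Proof.
move=> Hf; apply: (@pt_recode _ _ _ _ (fun a => (1, f a)) _ id) => //.
exact: pt_pair (pt_const _ _) Hf.
Qed.

Lemma pt_Cnot A (f g : A -> nat) : pt f -> pt g -> pt (fun a => Cnot (f a) (g a)).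
Proof.
move=> Hf Hg; apply: (@pt_recode _ _ _ _ (fun a => (2, (f a, g a))) _ id) => //.
exact: pt_pair (pt_const _ _) (pt_pair Hf Hg).
Qed.

Lemma pt_Oracle A (f g : A -> seq nat) :
  pt f -> pt g -> pt (fun a => Oracle (f a) (g a)).
Proof.
move=> Hf Hg; apply: (@pt_recode _ _ _ _ (fun a => (3, (f a, g a))) _ id) => //.
exact: pt_pair (pt_const _ _) (pt_pair Hf Hg).
Qed.

Lemma pt_Circuit A (f g h : A -> nat) (gs : A -> seq gate) :
  pt f -> pt g -> pt h -> pt gs ->
  pt (fun a => Circuit (f a) (g a) (h a) (gs a)).
Proof.
move=> Hf Hg Hh Hgs.
apply: (@pt_recode _ _ _ _ (fun a => (f a, (g a, (h a, gs a)))) _ id) => //.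
by do !apply: pt_pair.
Qed.

Lemma pt_circuit_tuple A (C : A -> circuit) : pt C ->
  pt (fun a => (c_in (C a), (c_anc (C a), (c_out (C a), c_gates (C a))))).
Proof. exact: (@pt_recode _ _ _ _ _ _ id). Qed.

Lemma pt_c_in A (C : A -> circuit) : pt C -> pt (fun a => c_in (C a)).
Proof. by move/pt_circuit_tuple/pt_fst. Qed.

Lemma pt_c_anc A (C : A -> circuit) : pt C -> pt (fun a => c_anc (C a)).
Proof. by move/pt_circuit_tuple/pt_snd/pt_fst. Qed.

Lemma pt_c_gates A (C : A -> circuit) : pt C -> pt (fun a => c_gates (C a)).
Proof. by move/pt_circuit_tuple/pt_snd/pt_snd/pt_snd. Qed.

(* [no_oracle] answers with the empty string, so that oracle gates run with it
   do nothing; they are dropped, as the surrounding circuit has an oracle. *)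
Definition shift_gate (o : nat) (g : gate) : seq gate :=
  match g with
  | Had i => [:: Had (o + i)]
  | Tgate i => [:: Tgate (o + i)]
  | Cnot i j => [:: Cnot (o + i) (o + j)]
  | Oracle _ _ => [::]
  end.

Definition shift_gates (o : nat) (gs : seq gate) : seq gate :=
  flatten [seq shift_gate o g | g <- gs].

Definition copy (s d l : nat) : seq gate :=
  [seq Cnot (s + i) (d + i) | i <- iota 0 l].

(* This is a swap only if the wires from [d] on are initially 0. *)
Definition move (s d l : nat) : seq gate := copy s d l ++ copy d s l.

(** Addition to a unary numeral on raw trees, for use where the type of the encoded object has been
    forgotten. *)
Definition tree_add (o : nat) (t : tree) : tree := iter o (Nd Lf) t.

Lemma tree_addE o i : tree_add o (unary i) = unary (o + i).
Proof. by elim: o => //= o ->. Qed.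

Lemma pt_tree_add A (f : A -> nat) (g : A -> tree) :
  pt f -> pt g -> pt (fun a => tree_add (f a) (g a)).
Proof.
move=> Hf Hg; have Sf := pt_nat_size Hf; have Sg := pt_size Hg.
apply: (@pt_iter _ _ (fun=> Nd Lf) _ _ (fun a => 2 * f a + sz (g a))) => //.
- apply: (@pt_recode _ _ _ _ (fun p : A * tree => (tt, p.2)) _ id) => //.
  exact: pt_pair (pt_const _ _) (pt_snd (pt_id _)).
- by polyb_tac.
move=> a i le_i; apply: leq_trans (_ : 2 * i + sz (g a) <= _); last by lia.
by elim: i {le_i} => //= i IH; rewrite /sz /= in IH *; lia.
Qed.

Lemma pt_Nd A (f g : A -> tree) : pt f -> pt g -> pt (fun a => Nd (f a) (g a)).
Proof.
move=> Hf Hg; apply: (@pt_recode _ _ _ _ (fun a => (f a, g a)) _ id) => //.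
exact: pt_pair.
Qed.

Lemma pt_shift_gate : pt (fun p : nat * gate => shift_gate p.1 p.2).
Proof.
pose lt (t : tree) : tree := if t is Nd l _ then l else Lf.
pose rt (t : tree) : tree := if t is Nd _ r then r else Lf.
pose isn (t : tree) := if t is Nd _ _ then true else false.
(* [lt p.2] is the unary tag of the gate. Its right subtree is a node exactly for tags 2 and 3, and
   the right subtree of that one only for tag 3, the oracle gate, which is dropped. *)
pose raw (p : nat * tree) : seq tree :=
  if isn (rt (lt p.2)) then
    if isn (rt (rt (lt p.2))) then [::]
    else [:: Nd (lt p.2) (Nd (tree_add p.1 (lt (rt p.2))) (tree_add p.1 (rt (rt p.2))))]
  else [:: Nd (lt p.2) (tree_add p.1 (rt p.2))].
have H : pt raw.
  rewrite /raw /lt /rt /isn.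
  have H1 := pt_fst (pt_id (nat_enc * tree_enc)%type).
  have H2 := pt_snd (pt_id (nat_enc * tree_enc)%type).
  repeat first [ exact: H1 | exact: H2 | exact: pt_const | apply: pt_if | apply: pt_isnode
    | apply: pt_left | apply: pt_right | apply: pt_cons | apply: pt_Nd | apply:
      pt_tree_add].
apply: (@pt_recode _ _ _ _ raw _ (fun p : nat * gate => (p.1, enc p.2))) H => //.
case=> o [i|i|i j|xs ys]; rewrite /raw //=.
- by rewrite tree_addE.
- by rewrite tree_addE.
- by rewrite !tree_addE.
Qed.

Lemma pt_shift_gates A (f : A -> nat) (gs : A -> seq gate) :
  pt f -> pt gs -> pt (fun a => shift_gates (f a) (gs a)).
Proof.
move=> Hf Hgs; apply: (@pt_flatmap _ _ _ (fun a => shift_gate (f a))) => //.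
apply: (@pt_comp _ _ _ (fun p : A * gate => (f p.1, p.2))) pt_shift_gate.
by apply: pt_pair; [exact: pt_comp (pt_fst (pt_id _)) Hf | exact: pt_snd (pt_id _)].
Qed.

Lemma pt_copy A (f g h : A -> nat) :
  pt f -> pt g -> pt h -> pt (fun a => copy (f a) (g a) (h a)).
Proof.
move=> Hf Hg Hh.
apply: (@pt_map _ _ _ (fun a i => Cnot (f a + i) (g a + i))).
  have H1 := pt_fst (pt_id (A * nat_enc)%type).
  have H2 := pt_snd (pt_id (A * nat_enc)%type).
  apply: pt_Cnot; apply: pt_add => //; [exact: pt_comp H1 Hf | exact: pt_comp H1 Hg].
by apply: pt_iota => //; apply: pt_const.
Qed.

Lemma pt_move A (f g h : A -> nat) :
  pt f -> pt g -> pt h -> pt (fun a => move (f a) (g a) (h a)).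
Proof. by move=> *; apply: pt_cat; apply: pt_copy. Qed.

Lemma polytime_pt (B : encType) (f : nat -> B) :
  polytime (fun _ (_ : unit) => True) (fun=> Lf) (fun lam _ => enc (f lam)) -> pt f.
Proof.
case=> p [d Hp].
have H : pt (fun x : nat * unit => f x.1).
  exists p, (fun x => (sz x).+2 ^ d); first by exists d.
  case=> lam []; have [t le_t Et] := Hp lam tt I; exists t => //=.
  apply: leq_trans le_t _; apply: leq_exp2rW.
  by rewrite sz_pair sz_nat; lia.
exact: (pt_comp (pt_pair (pt_id _) (pt_const _ tt)) H).
Qed.

(** The program ignores [inp x], but reading its input costs the size of [inp x], hence the bound
    [h]. *)
Lemma pt_polytime (B : encType) (T : Type) (D : nat -> T -> Prop) (inp : T -> tree)
    (f : nat -> B) (h : nat -> nat) :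
  pt f -> polyb h -> (forall lam x, D lam x -> tree_size (inp x) <= h lam) ->
  polytime D inp (fun lam _ => enc (f lam)).
Proof.
move=> Hf Hh Hinp.
have [p [g Hg Hp]] := pt_comp (pt_fst (pt_id (nat_enc * tree_enc)%type)) Hf.
have [g' [d Hg'] le_g] := polyb_pair Hg Hh.
(* The exponent comes from [(sz lam).+2 = 2 * lam + 3 <= lam.+2 ^ 3]. *)
exists p, (3 * d) => lam x /Hinp le_h.
have [t le_t Et] := Hp (lam, inp x); exists t => //.
apply: leq_trans le_t _; apply: leq_trans (le_g _ _ le_h) _.
apply: leq_trans (Hg' _) _; rewrite expnM; apply: leq_exp2rW.
by rewrite sz_nat; nia.
Qed.

End PolytimeFunctions.

Import Order.TTheory GRing.Theory Num.Theory.

Local Open Scope ring_scope.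

(** * Sums over words and bit strings *)

(** Plain sequences instead of tuples let a sum over length [m + n] split without casts. With
    strings as letters, the same enumeration runs over configurations. *)
Fixpoint words (T : Type) (n : nat) (s : seq T) : seq (seq T) :=
  if n is n'.+1 then [seq a :: w | a <- s, w <- words n' s] else [:: [::]].

Definition strs (n : nat) : seq bits := words n [:: false; true].

Section Words.

Variables (T : eqType) (s : seq T).

Lemma mem_words n w : (w \in words n s) = (size w == n) && all (mem s) w.
Proof.
elim: n w => [|n IH] [|a w] //=.
  by apply/negbTE/negP => /allpairsP[[b v] []].
rewrite eqSS; apply/allpairsP/andP => [[[b v] /= [Hb Hv [-> ->]]]|[Hw /andP[Ha Hall]]].
  by move: Hv; rewrite IH Hb => /andP[-> ->].
by exists (a, w); split => //=; rewrite IH Hw.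
Qed.

Lemma uniq_words n : uniq s -> uniq (words n s).
Proof.
move=> Us; elim: n => //= n IH; apply: allpairs_uniq => //.
by move=> [a v] [b w] _ _ [-> ->].
Qed.

Lemma size_word n w : w \in words n s -> size w = n.
Proof. by rewrite mem_words => /andP[/eqP]. Qed.

Lemma nth_word n w x0 i : w \in words n s -> (i < n)%N -> nth x0 w i \in s.
Proof.
by rewrite mem_words => /andP[/eqP <- /allP Hw] lt_i; apply: Hw; rewrite mem_nth.
Qed.

Lemma words_cat m n u v :
  (u \in words m s) -> (v \in words n s) -> u ++ v \in words (m + n) s.
Proof.
rewrite !mem_words size_cat all_cat => /andP[/eqP-> ->] /andP[/eqP-> ->].
by rewrite eqxx.
Qed.

End Words.

Lemma mem_strs n x : (x \in strs n) = (size x == n).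
Proof.
by rewrite mem_words (_ : all _ x) ?andbT //; apply/allP => -[] _; rewrite !inE.
Qed.

Lemma size_strs n x : x \in strs n -> size x = n.
Proof. by rewrite mem_strs => /eqP. Qed.

Lemma uniq_strs n : uniq (strs n).
Proof. exact: uniq_words. Qed.

Lemma tuple_strs n : perm_eq [seq tval x | x <- enum {: n.-tuple bool}] (strs n).
Proof.
apply: uniq_perm.
- by rewrite map_inj_uniq ?enum_uniq //; apply: val_inj.
- exact: uniq_strs.
move=> x; rewrite mem_strs; apply/mapP/eqP => [[t _ ->]|Ex]; first exact: size_tuple.
by exists (tcast Ex (in_tuple x)); rewrite ?mem_enum // val_tcast.
Qed.

Section WordSums.

Variable R : comNzRingType.

Lemma big_words_cons (T : Type) (s : seq T) n (F : seq T -> R) :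
  \sum_(w <- words n.+1 s) F w = \sum_(a <- s) \sum_(w <- words n s) F (a :: w).
Proof. by rewrite big_flatten big_map; apply: eq_bigr => a _; rewrite big_map. Qed.

Lemma big_words_cat (T : Type) (s : seq T) m n (F : seq T -> R) :
  \sum_(w <- words (m + n) s) F w
    = \sum_(u <- words m s) \sum_(v <- words n s) F (u ++ v).
Proof.
elim: m F => [|m IH] F; first by rewrite big_seq1.
by rewrite addSn !big_words_cons; apply: eq_bigr => a _; rewrite IH.
Qed.

Lemma big_words0 (T : Type) (s : seq T) (F : seq T -> R) :
  \sum_(w <- words 0 s) F w = F [::].
Proof. by rewrite big_seq1. Qed.

(** Distributivity; it factorises sums over configurations into one factor per node. *)
Lemma big_words_prod (T : Type) (s : seq T) n x0 (F : nat -> T -> R) :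
  \sum_(w <- words n s) \prod_(i < n) F i (nth x0 w i)
    = \prod_(i < n) \sum_(a <- s) F i a.
Proof.
elim: n F => [|n IH] F; first by rewrite big_words0 !big_ord0.
rewrite big_words_cons big_ord_recl big_distrl /=; apply: eq_bigr => a _.
rewrite -(IH (fun i => F i.+1)) big_distrr /=; apply: eq_bigr => w _.
by rewrite big_ord_recl.
Qed.

Lemma big_seq_delta (T : eqType) (s : seq T) a (F : T -> R) :
  uniq s -> a \in s -> \sum_(x <- s) F x * (x == a)%:R = F a.
Proof.
move=> Us Ha; rewrite (bigD1_seq a) //= eqxx mulr1 big1 ?addr0 // => x /negbTE->.
by rewrite mulr0.
Qed.

(** Mostly used from right to left: a single term is expanded into a sum so that two sums can be
    compared term by term. *)
Lemma big_strs_delta n a (F : bits -> R) :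
  size a = n -> \sum_(x <- strs n) F x * (x == a)%:R = F a.
Proof. by move=> Ha; rewrite big_seq_delta ?uniq_strs // mem_strs Ha. Qed.

Lemma big_tuple_strs n (F : bits -> R) :
  \sum_(x : n.-tuple bool) F x = \sum_(x <- strs n) F x.
Proof.
by rewrite -(perm_big _ (tuple_strs n)) big_map big_enum.
Qed.

Lemma big_seq_cond1 (T : eqType) (s : seq T) (F G : T -> R) :
  {in s, F =1 G} -> \sum_(x <- s) F x = \sum_(x <- s) G x.
Proof. by move=> FG; rewrite big_seq [RHS]big_seq; apply: eq_bigr. Qed.

Lemma reindex_strs n (h : bits -> bits) (F : bits -> R) :
  (forall x, size x = n -> size (h x) = n) ->
  (forall x, size x = n -> h (h x) = x) ->
  \sum_(x <- strs n) F (h x) = \sum_(x <- strs n) F x.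
Proof.
move=> size_h hK; rewrite -(big_map h xpredT); apply: perm_big.
have inj : {in strs n &, injective h}.
  by move=> x y /size_strs Hx /size_strs Hy E; rewrite -(hK x) // E hK.
apply: uniq_perm; rewrite ?map_inj_in_uniq ?uniq_strs // => x.
rewrite mem_strs; apply/mapP/eqP => [[y /size_strs Hy ->]|Hx]; first exact: size_h.
by exists (h x); rewrite ?mem_strs ?size_h ?hK.
Qed.

End WordSums.

(** * Circuits *)

Definition eqn_vec (n : nat) (psi phi : vec) : Prop :=
  forall x, size x = n -> psi x = phi x.

Lemma size_set_nth_in (x : bits) i b : (i < size x)%N -> size (set_nth false x i b) =
  size x.
Proof. by move=> lt_i; rewrite size_set_nth; apply/maxn_idPr. Qed.

Lemma size_xor_wires x ys z : size (xor_wires x ys z) = size x.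
Proof. by rewrite size_mkseq. Qed.

Lemma apply_gate_ext n f g psi phi :
  gate_wf n g -> eqn_vec n psi phi -> eqn_vec n (apply_gate f psi g) (apply_gate f phi g).
Proof.
move=> Hg E x Hx; case: g Hg => [i|i|i j|xs ys] /= Hg.
- by rewrite !E ?size_set_nth_in ?Hx.
- by rewrite E.
- by rewrite E // size_xor_wires.
- by rewrite E // size_xor_wires.
Qed.

Lemma apply_gates_ext n f gs psi phi :
  all (gate_wf n) gs -> eqn_vec n psi phi ->
  eqn_vec n (foldl (apply_gate f) psi gs) (foldl (apply_gate f) phi gs).
Proof.
elim: gs psi phi => //= g gs IH psi phi /andP[Hg Hgs] E.
by apply: IH => //; apply: apply_gate_ext.
Qed.

Section Linearity.

Variables (f : oracle) (I : Type) (r : seq I) (a : I -> algC) (psi : I -> vec).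

Lemma apply_gate_sum g x :
  apply_gate f (fun y => \sum_(i <- r) a i * psi i y) g x
    = \sum_(i <- r) a i * apply_gate f (psi i) g x.
Proof.
case: g => [j|j|j l|xs ys] //=; last by rewrite big_distrr /=; apply: eq_bigr => i _;
  ring.
rewrite big_distrr -big_split big_distrr /=; apply: eq_bigr => i _; ring.
Qed.

End Linearity.

Lemma apply_gates_sum n f (I : Type) (r : seq I) (a : I -> algC) (psi : I -> vec) gs :
  all (gate_wf n) gs ->
  eqn_vec n (foldl (apply_gate f) (fun y => \sum_(i <- r) a i * psi i y) gs)
    (fun x => \sum_(i <- r) a i * foldl (apply_gate f) (psi i) gs x).
Proof.
elim: gs psi => //= g gs IH psi /andP[Hg Hgs] x Hx; rewrite -IH //.
by apply: (apply_gates_ext _ Hgs) Hx => y _; apply: apply_gate_sum.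
Qed.

Lemma apply_gates_ket n f gs psi : all (gate_wf n) gs ->
  eqn_vec n (foldl (apply_gate f) psi gs)
    (fun x => \sum_(w <- strs n) psi w * foldl (apply_gate f) (ket w) gs x).
Proof.
move=> Hgs x Hx; rewrite -(@apply_gates_sum n) //.
apply: (apply_gates_ext _ Hgs) Hx => y Hy.
by rewrite /ket -{1}(big_strs_delta psi Hy); apply: eq_bigr => w _; rewrite eq_sym.
Qed.

Definition norm2 (n : nat) (psi : vec) : algC := \sum_(x <- strs n) `|psi x| ^+ 2.

Lemma set_nth_cat (a c : bits) b b' : set_nth false (a ++ b ::
  c) (size a) b' = a ++ b' :: c.
Proof. by elim: a => //= x a ->. Qed.

Lemma xor_wires_nil x ys : xor_wires x ys [::] = x.
Proof.
apply: (@eq_from_nth _ false); rewrite size_xor_wires // => i lt_i.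
by rewrite nth_mkseq // nth_nil addbF.
Qed.

Lemma nth_xor_wires x ys z i : (i < size x)%N ->
  nth false (xor_wires x ys z) i
    = nth false x i (+) nth false (take (size ys) z) (index i ys).
Proof. by move=> lt_i; rewrite nth_mkseq. Qed.

Lemma nth_xor1 x j b i : (i < size x)%N ->
  nth false (xor_wires x [:: j] [:: b]) i = nth false x i (+) ((j == i) && b).
Proof. by move=> lt_i; rewrite nth_xor_wires //=; case: eqP. Qed.

Lemma sqrt2_norm : `|(sqrtC 2)^-1 : algC| ^+ 2 = 2^-1.
Proof. by rewrite -normrX exprVn sqrtCK ger0_norm // invr_ge0 ler0n. Qed.

Lemma parallelogram (p q : algC) :
  `|p + q| ^+ 2 + `|p - q| ^+ 2 = 2 * (`|p| ^+ 2 + `|q| ^+ 2).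
Proof. rewrite !normCK !rmorphD rmorphN /=; ring. Qed.

(** Unitarity, gate by gate: the parallelogram law on the wire of [Had], a phase of modulus 1 for
    [Tgate], an involution of basis states for [Cnot], and the identity for an oracle gate answered
    by the empty string. *)
Lemma norm2_gate n g psi : gate_wf n g ->
  norm2 n (apply_gate no_oracle psi g) = norm2 n psi.
Proof.
rewrite /norm2; case: g => [i|i|i j|xs ys] /= Hg.
- have -> : n = (i + (1 + (n - i.+1)))%N by lia.
  rewrite !big_words_cat; apply: big_seq_cond1 => a /size_strs Ha.
  rewrite !big_words_cat !big_words_cons !big_cons !big_nil /=.
  rewrite !addr0 -!big_split /=; apply: eq_bigr => c _.
  rewrite -Ha !set_nth_cat !nth_cat ltnn subnn /=.
  rewrite expr0 expr1 mul1r mulN1r !normrM !exprMn -mulrDr parallelogram sqrt2_norm.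
  by rewrite mulrA mulVf ?mul1r // pnatr_eq0.
- apply: eq_bigr => x _; rewrite normrM exprMn; case: ifP => _; last by rewrite normr1;
  ring.
  rewrite -[RHS]mul1r; congr (_ * _).
  rewrite normrM exprMn sqrt2_norm -['i]mulr1 normC2_rect ?rpred1 //.
  by rewrite !expr1n -mulr2n divff // pnatr_eq0.
- move: Hg => /and3P[Hi Hj ij].
  apply: reindex_strs => x Hx; first by rewrite size_xor_wires.
  apply: (@eq_from_nth _ false); rewrite !size_xor_wires // => l lt_l.
  rewrite !nth_xor1 ?size_xor_wires // ?Hx //.
  by rewrite (eq_sym j i) (negbTE ij) /= addbF -addbA addbb addbF.
- by apply: eq_bigr => x _; rewrite xor_wires_nil.
Qed.

Lemma norm2_gates n gs psi : all (gate_wf n) gs ->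
  norm2 n (foldl (apply_gate no_oracle) psi gs) = norm2 n psi.
Proof.
by elim: gs psi => //= g gs IH psi /andP[Hg Hgs]; rewrite IH // norm2_gate.
Qed.

Lemma norm2_ket n x : size x = n -> norm2 n (ket x) = 1.
Proof.
move=> Hx; rewrite /norm2 -(big_strs_delta (fun=> 1) Hx).
by apply: eq_bigr => y _; rewrite mul1r /ket; case: (y == x);
  rewrite (normr1, normr0) (expr1n, expr0n).
Qed.

(** The surrounding oracle [f] does not matter, because [shift_gate] has dropped the only gates that
    consult it. *)
Lemma shift_gate_embed n f g psi a b y : gate_wf n g -> size y = n ->
  foldl (apply_gate f) psi (shift_gate (size a) g) (a ++ y ++ b)
    = apply_gate no_oracle (fun w => psi (a ++ w ++ b)) g y.
Proof.
have nthE i : (i < n)%N -> size y = n -> nth false (a ++ y ++ b) (size a + i) = nth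
  false y i.
  by move=> lt_i Hy; rewrite nth_cat ltnNge leq_addr /= addKn nth_cat Hy lt_i.
have setE i c : (i < n)%N -> size y = n ->
    set_nth false (a ++ y ++ b) (size a + i) c = a ++ set_nth false y i c ++ b.
  move=> lt_i Hy; elim: a {nthE} => [|x a IH] /=; last by rewrite IH.
  rewrite -Hy add0n in lt_i *; elim: y i lt_i {Hy} => //= x y IH [|i] //= lt_i.
  by rewrite IH.
case: g => [i|i|i j|xs ys] /=.
- by move=> Hi Hy; rewrite !setE ?nthE.
- by move=> Hi Hy; rewrite !nthE.
- move=> /and3P[Hi Hj ij] Hy; rewrite nthE //; congr psi.
  apply: (@eq_from_nth _ false) => [|l]; first by rewrite !size_cat !size_xor_wires
    !size_cat.
  rewrite size_xor_wires => lt_l; rewrite nth_xor1 // !nth_cat size_xor_wires Hy.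
  case: ltnP => Hla; first by case: eqP => // E; lia.
  case: ltnP => Hlb.
    rewrite nth_xor1 ?Hy //; congr (_ (+) (_ && _)); apply/eqP/eqP; lia.
  by case: eqP => E; [lia | rewrite addbF].
- by move=> _ _; rewrite xor_wires_nil.
Qed.

Lemma shift_gates_embed n f gs psi a b y : all (gate_wf n) gs -> size y = n ->
  foldl (apply_gate f) psi (shift_gates (size a) gs) (a ++ y ++ b)
    = foldl (apply_gate no_oracle) (fun w => psi (a ++ w ++ b)) gs y.
Proof.
elim: gs psi => //= g gs IH psi /andP[Hg Hgs] Hy.
rewrite /shift_gates /= foldl_cat IH //; apply: (apply_gates_ext _ Hgs) Hy => w Hw.
exact: shift_gate_embed Hg Hw.
Qed.

Lemma shift_gates_wf n N o gs : all (gate_wf n) gs -> (o + n <= N)%N ->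
  all (gate_wf N) (shift_gates o gs).
Proof.
move=> Hgs le_N; elim: gs Hgs => //= g gs IH /andP[Hg /IH Hgs].
rewrite /shift_gates /= all_cat Hgs andbT.
case: g Hg => [i|i|i j|xs ys] //= Hg; rewrite ?andbT; lia.
Qed.

(** * Register layouts *)

Section Layout.

Variables (Reg : eqType) (regs : seq Reg) (off len : Reg -> nat) (N : nat).
Hypothesis off_bound : {in regs, forall r, (off r + len r <= N)%N}.
Hypothesis off_disjoint : {in regs &, forall r r', r != r' ->
  (off r + len r <= off r')%N \/ (off r' + len r' <= off r)%N}.

Variable f : oracle.

Definition memory := Reg -> bits.

Definition inreg (i : nat) (r : Reg) : bool := (off r <= i < off r + len r)%N.

(** Wires outside all registers are 0. Taking the first register that contains a wire makes the
    definition total; disjointness makes the choice irrelevant. *)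
Definition layout (X : memory) : bits :=
  mkseq (fun i => if [seq r <- regs | inreg i r] is r :: _
                  then nth false (X r) (i - off r) else false) N.

Lemma size_layout X : size (layout X) = N.
Proof. exact: size_mkseq. Qed.

Lemma nth_layout_in X r i : r \in regs -> (off r <= i < off r + len r)%N ->
  nth false (layout X) i = nth false (X r) (i - off r).
Proof.
move=> Hr Hi; have lt_i : (i < N)%N by have := off_bound Hr; lia.
rewrite nth_mkseq //; have : r \in [seq r <- regs | inreg i r] by rewrite mem_filter Hr
  andbT.
case E : [seq _ <- _ | _] => [|r' s] // _.
have : r' \in [seq r <- regs | inreg i r] by rewrite E mem_head.
rewrite mem_filter /inreg => /andP[Hi' Hr'].
have [-> //|ne] := eqVneq r' r; have := off_disjoint Hr' Hr ne; lia.
Qed.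

Lemma nth_layout X r i : r \in regs -> (i < len r)%N ->
  nth false (layout X) (off r + i) = nth false (X r) i.
Proof. by move=> Hr Hi; rewrite (@nth_layout_in X r) // ?addKn //; lia. Qed.

Lemma nth_layout_out X i : ~~ has (inreg i) regs -> nth false (layout X) i = false.
Proof.
case: (ltnP i N) => lt_i; last by rewrite nth_default // size_layout.
by rewrite nth_mkseq // has_filter negbK => /eqP->.
Qed.

Lemma layout_ext X Y :
  (forall r i, r \in regs -> (i < len r)%N -> nth false (X r) i = nth false (Y r) i) ->
  layout X = layout Y.
Proof.
move=> E; apply: (@eq_from_nth _ false); rewrite !size_layout // => i lt_i.
have [/hasP[r Hr Hi]|Hi] := boolP (has (inreg i) regs); last by rewrite !nth_layout_out.
by rewrite !(@nth_layout_in _ r) // E //; move: Hi; rewrite /inreg; lia.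
Qed.

Definition upd (X : memory) (r : Reg) (w : bits) : memory :=
  fun r' => if r' == r then w else X r'.

Lemma size_take_layout X r : r \in regs -> size (take (off r) (layout X)) = off r.
Proof. by move=> /off_bound le_N; rewrite size_takel // size_layout; lia. Qed.

Lemma layout_split X r : r \in regs -> size (X r) = len r ->
  layout X = take (off r) (layout X) ++ X r ++ drop (off r + len r) (layout X).
Proof.
move=> Hr Hs; have le_N := off_bound Hr.
apply: (@eq_from_nth _ false) => [|i lt_i].
  by rewrite !size_cat size_take_layout // size_drop size_layout Hs; lia.
rewrite !nth_cat size_take_layout // Hs.
case: ltnP => Hi; first by rewrite nth_take.
case: ltnP => Hj; first by rewrite (@nth_layout_in X r) //; lia.
by rewrite nth_drop; congr nth; lia.
Qed.

Lemma layout_upd X r w : r \in regs -> size w = len r ->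
  layout (upd X r w)
    = take (off r) (layout X) ++ w ++ drop (off r + len r) (layout X).
Proof.
move=> Hr Hs; have le_N := off_bound Hr.
apply: (@eq_from_nth _ false) => [|i].
  by rewrite !size_cat size_take_layout // size_drop !size_layout Hs; lia.
rewrite size_layout => lt_i; rewrite !nth_cat size_take_layout // Hs.
have out : ~~ inreg i r -> nth false (layout (upd X r w)) i = nth false (layout X) i.
  move=> Hi; have [/hasP[r' Hr' Hi']|Ho] := boolP (has (inreg i) regs).
    rewrite !(@nth_layout_in _ r') // /upd; case: eqP => // E.
    by rewrite -E Hi' in Hi.
  by rewrite !nth_layout_out.
case: ltnP => Hi; first by rewrite nth_take // out // /inreg; lia.
case: ltnP => Hj; first by rewrite (@nth_layout_in _ r) /upd ?eqxx //; lia.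
by rewrite nth_drop out /inreg; [congr nth; lia | lia].
Qed.

(** Well-formedness travels with the semantics, so that the derivation of the final state also shows
    that the big circuit is well formed. *)
Definition evolves (gs : seq gate) (psi phi : vec) : Prop :=
  all (gate_wf N) gs /\ eqn_vec N (foldl (apply_gate f) psi gs) phi.

Lemma evolves_cat gs hs psi phi chi :
  evolves gs psi phi -> evolves hs phi chi -> evolves (gs ++ hs) psi chi.
Proof.
move=> [W1 E1] [W2 E2]; split; first by rewrite all_cat W1.
move=> x Hx; rewrite foldl_cat -E2 //.
by apply: (apply_gates_ext _ W2) Hx => y Hy; apply: E1.
Qed.

(** Linearity. Well-formedness is a separate hypothesis because [s] may be empty. *)
Lemma evolves_sum (I : eqType) (s : seq I) (a : I -> algC) (psi phi : I -> vec) gs :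
  all (gate_wf N) gs -> {in s, forall i, evolves gs (psi i) (phi i)} ->
  evolves gs (fun x => \sum_(i <- s) a i * psi i x) (fun x => \sum_(i <- s) a i * phi i
    x).
Proof.
move=> Hw E; split => // x Hx; rewrite (apply_gates_sum _ _ _ _ Hw) //.
by apply: big_seq_cond1 => i Hi; have [_ ->] := E i Hi.
Qed.

Lemma evolves_ext gs psi phi psi' phi' :
  eqn_vec N psi psi' -> eqn_vec N phi phi' ->
  evolves gs psi phi -> evolves gs psi' phi'.
Proof.
move=> E E' [W H]; split=> // x Hx; rewrite -E' // -H //.
by apply: (apply_gates_ext _ W) Hx => y Hy; rewrite E.
Qed.

(** A basis string is cut before, inside and after register [r]. The outer parts are untouched and
    only contribute the condition that they agree with the layout. *)
Lemma evolves_embed n gs X r : all (gate_wf n) gs -> r \in regs -> len r = n ->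
  size (X r) = n ->
  evolves (shift_gates (off r) gs) (ket (layout X))
    (fun x => \sum_(y <- strs n)
       foldl (apply_gate no_oracle) (ket (X r)) gs y * ket (layout (upd X r y)) x).
Proof.
move=> Hgs Hr Hlen Hsize; have le_N := off_bound Hr.
split; first by apply: shift_gates_wf Hgs _; rewrite -Hlen.
move=> x Hx; pose a := take (off r) x; pose y := take n (drop (off r) x).
pose b := drop (off r + n) x.
have Ex : x = a ++ y ++ b.
  by rewrite /a /y /b addnC -drop_drop cat_take_drop cat_take_drop.
have Ha : size a = off r by rewrite size_takel // Hx; lia.
have Hy : size y = n by rewrite size_takel // size_drop Hx; lia.
pose La := take (off r) (layout X); pose Lb := drop (off r + n) (layout X).
have HLa : size La = off r by rewrite size_takel // size_layout; lia.
have catE u v : size u = n -> size v = n ->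
    (a ++ u ++ b == La ++ v ++ Lb) = [&& u == v, a == La & b == Lb].
  move=> Hu Hv; rewrite eqseq_cat ?Ha ?HLa // eqseq_cat ?Hu ?Hv //.
  by rewrite andbCA.
have ketX w : size w = n -> ket (layout X) (a ++ w ++ b) = ((w == X r) && ((a == La) &&
  (b == Lb)))%:R.
  by move=> Hw; rewrite /ket (layout_split Hr) ?Hsize // Hlen catE.
rewrite {1}Ex -{1}Ha (shift_gates_embed _ _ _ _ Hgs) // (apply_gates_ket _ _ Hgs) //.
transitivity (foldl (apply_gate no_oracle) (ket (X r)) gs y * ((a == La) && (b ==
  Lb))%:R).
  rewrite -(big_strs_delta (fun w => foldl _ (ket w) gs y * _) Hsize).
  apply: big_seq_cond1 => w /size_strs Hw; rewrite ketX // -mulnb natrM; ring.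
rewrite -(big_strs_delta (fun z => foldl _ (ket (X r)) gs z * _) Hy).
apply: big_seq_cond1 => z /size_strs Hz.
rewrite /ket layout_upd ?Hlen //.
have := catE y z Hy Hz; rewrite -Ex /La /Lb => ->; rewrite (eq_sym y).
by case: (z == y); rewrite /= ?mulr1 ?mulr0.
Qed.

Definition xors (q p : bits) : bits := [seq x.1 (+) x.2 | x <- zip q p].

Lemma size_xors q p : size q = size p -> size (xors q p) = size q.
Proof. by move=> E; rewrite size_map size_zip E minnn. Qed.

Lemma nth_xors q p i : size q = size p ->
  nth false (xors q p) i = nth false q i (+) nth false p i.
Proof.
move=> E; have [lt_i|ge_i] := ltnP i (size q).
  by rewrite (nth_map (false, false)) ?size_zip -?E ?minnn // nth_zip.
by rewrite !nth_default ?size_xors -?E.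
Qed.

Lemma xors0 l p : size p = l -> xors (nseq l false) p = p.
Proof.
move=> E; apply: (@eq_from_nth _ false); rewrite size_xors ?size_nseq ?E // => i lt_i.
by rewrite nth_xors ?size_nseq ?E // nth_nseq if_same.
Qed.

Lemma xorsx p : xors p p = nseq (size p) false.
Proof.
apply: (@eq_from_nth _ false); rewrite size_xors ?size_nseq // => i lt_i.
by rewrite nth_xors // addbb nth_nseq if_same.
Qed.

End Layout.

(** The permutation of basis states performed by [copy]. On disjoint ranges it is an involution, so
    pulling amplitudes back along it and pushing kets forward are the same. *)
Definition copied (s d l : nat) (x : bits) : bits :=
  mkseq (fun i => nth false x i (+) ((d <= i < d + l)%N && nth false x (s + (i - d))))
    (size x).

Section Copy.

Variables (s d l : nat).
Hypothesis disj : (s + l <= d)%N \/ (d + l <= s)%N.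

Lemma copy_wf N : (s + l <= N)%N -> (d + l <= N)%N -> all (gate_wf N) (copy s d l).
Proof.
move=> Hs Hd; rewrite all_map; apply/allP => i; rewrite mem_iota /= => Hi.
by apply/and3P; split; [lia | lia | apply/eqP; lia].
Qed.

Lemma copiedK x : (s + l <= size x)%N -> (d + l <= size x)%N ->
  copied s d l (copied s d l x) = x.
Proof.
move=> Hs Hd; apply: (@eq_from_nth _ false); rewrite !size_mkseq // => i lt_i.
rewrite nth_mkseq ?size_mkseq // [X in X (+) _ = _]nth_mkseq //.
case: (boolP (d <= i < d + l)%N) => Hi /=; last by rewrite !addbF.
rewrite nth_mkseq; last lia.
have -> : (d <= s + (i - d) < d + l)%N = false by lia.
by rewrite addbF -addbA addbb addbF.
Qed.

End Copy.

Lemma apply_copy f psi s d l x : (s + l <= d)%N \/ (d + l <= s)%N ->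
  foldl (apply_gate f) psi (copy s d l) x = psi (copied s d l x).
Proof.
elim: l x => [|l IH] x disj.
  rewrite /copied; congr psi; apply: (@eq_from_nth _ false) => [|i lt_i];
    first by rewrite size_mkseq.
  rewrite nth_mkseq //; have -> : (d <= i < d + 0)%N = false by lia.
  by rewrite addbF.
rewrite /copy -addn1 iotaD map_cat foldl_cat /= -/(copy s d l) IH; last lia.
rewrite /copied; congr psi; apply: (@eq_from_nth _ false);
  rewrite !size_mkseq // => i lt_i.
rewrite nth_mkseq ?size_xor_wires // [RHS]nth_mkseq // nth_xor1 // !add0n.
case: (boolP (d <= i < d + l)%N) => Hi.
  have -> : (d <= i < d + (l + 1))%N by lia.
  have -> : (d + l == i) = false by lia.
  rewrite /= addbF; congr (_ (+) _).
  have [Hn|Hn] := ltnP (s + (i - d)) (size x); last by rewrite [LHS]nth_default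
    ?size_xor_wires // nth_default.
  by rewrite nth_xor1 //; have -> : (d + l == s + (i - d))%N = false by [lia];
    rewrite addbF.
rewrite addbF; congr (_ (+) _); have [E|ne] := eqVneq.
  by have -> : (d <= i < d + (l + 1))%N by [lia]; rewrite -E addKn.
by have -> : (d <= i < d + (l + 1))%N = false by lia.
Qed.

(** The gate set has no NOT: this is [H T^4 H = H Z H = X]. It prepares the constant 1, since
    ancillas start at 0. *)
Definition flip (i : nat) : seq gate :=
  [:: Had i; Tgate i; Tgate i; Tgate i; Tgate i; Had i].

Lemma apply_flip f psi a b c :
  foldl (apply_gate f) psi (flip (size a)) (a ++ b :: c) = psi (a ++ ~~ b :: c).
Proof.
have T4 : (1 + 'i) / sqrtC 2 * ((1 + 'i) / sqrtC 2 * ((1 + 'i) / sqrtC 2 * ((1 + 'i) /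
  sqrtC 2))) = -1 :> algC.
  set z := (1 + 'i) / _.
  have -> : z * (z * (z * z)) = (z ^+ 2) ^+ 2 by ring.
  rewrite /z (expr_div_n _ _ 2) sqrtCK sqrrD sqrCi expr1n mul1r.
  rewrite addrAC subrr add0r -mulr_natr mulfK ?pnatr_eq0 //; exact: sqrCi.
have H2 : (sqrtC 2)^-1 * (sqrtC 2)^-1 * 2 = 1 :> algC.
  by rewrite -expr2 exprVn sqrtCK mulVf // pnatr_eq0.
rewrite /= !set_nth_cat !nth_cat ltnn subnn /=.
move: T4; move: ((1 + 'i) / sqrtC 2) => z T4.
rewrite ?mul1r.
have z4 t : z * (z * (z * (z * t))) = - t.
  by rewrite -[RHS]mulN1r -T4; ring.
rewrite z4 -[RHS]mul1r -[in RHS]H2 expr1.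
by case: b => /=; rewrite ?expr0 ?expr1; ring.
Qed.

Lemma flip_wf N i : (i < N)%N -> all (gate_wf N) (flip i).
Proof. by move=> lt_i; rewrite /= lt_i. Qed.

Lemma big_words_rcons (R : comNzRingType) (T : Type) (s : seq T) n (F : seq T -> R) :
  \sum_(w <- words n.+1 s) F w
    = \sum_(w <- words n s) \sum_(a <- s) F (rcons w a).
Proof.
rewrite -addn1 big_words_cat; apply: eq_bigr => w _; rewrite big_words_cons.
by apply: eq_bigr => a _; rewrite big_words0 cats1.
Qed.

Lemma nseq_words (T : eqType) (s : seq T) n a : a \in s -> nseq n a \in words n s.
Proof.
by move=> Ha; rewrite mem_words size_nseq eqxx; apply/allP => y /nseqP[->].
Qed.

Section Layout2.

Variables (Reg : eqType) (regs : seq Reg) (off len : Reg -> nat) (N : nat).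
Hypothesis off_bound : {in regs, forall r, (off r + len r <= N)%N}.
Hypothesis off_disjoint : {in regs &, forall r r', r != r' ->
  (off r + len r <= off r')%N \/ (off r' + len r' <= off r)%N}.
Variable f : oracle.

Local Notation layout := (layout regs off len N).
Local Notation evolves := (evolves N f).

Lemma evolves_copy X r1 r2 o1 o2 l u p v a q c :
  r1 \in regs -> r2 \in regs -> r1 != r2 ->
  X r1 = u ++ p ++ v -> X r2 = a ++ q ++ c ->
  size (X r1) = len r1 -> size (X r2) = len r2 ->
  size u = o1 -> size p = l -> size a = o2 -> size q = l ->
  evolves (copy (off r1 + o1) (off r2 + o2) l) (ket (layout X))
    (ket (layout (upd X r2 (a ++ xors q p ++ c)))).
Proof.
move=> H1 H2 ne E1 E2 S1 S2 Su Sp Sa Sq.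
have B1 := off_bound H1; have B2 := off_bound H2.
have D := off_disjoint H1 H2 ne.
have L1 : (o1 + l <= len r1)%N by rewrite -S1 E1 !size_cat; lia.
have L2 : (o2 + l <= len r2)%N by rewrite -S2 E2 !size_cat; lia.
have disj : (off r1 + o1 + l <= off r2 + o2)%N \/ (off r2 + o2 + l <= off r1 + o1)%N by
  lia.
split; first by apply: copy_wf => //; lia.
set Y := upd X r2 _.
have SY : size (Y r2) = len r2.
  by rewrite /Y /upd eqxx !size_cat size_xors ?Sp // -S2 E2 !size_cat.
have LY : copied (off r1 + o1) (off r2 + o2) l (layout X) = layout Y.
  apply: (@eq_from_nth _ false) => [|i]; rewrite size_mkseq ?size_layout // => lt_i.
  rewrite nth_mkseq ?size_layout //.
  case: (boolP (off r2 + o2 <= i < off r2 + o2 + l)%N) => Hi /=.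
    rewrite !(@nth_layout_in _ _ _ _ _ off_bound off_disjoint _ r2 i) //; try lia.
    rewrite (@nth_layout_in _ _ _ _ _ off_bound off_disjoint _ r1) //; last lia.
    rewrite /Y /upd eqxx E1 E2 !nth_cat Su Sa size_xors ?Sp // Sq.
    case: ifP => Hj; first lia; case: ifP => Hk; last lia.
    case: ifP => Hj'; first lia; case: ifP => Hk'; last lia.
    by rewrite nth_xors ?Sp //; congr (_ (+) nth _ _ _); lia.
  rewrite addbF; have [/hasP[r Hr Hri]|Ho] := boolP (has (inreg off len i) regs).
    rewrite !(@nth_layout_in _ _ _ _ _ off_bound off_disjoint _ r) // /Y /upd.
    case: eqP => // E; rewrite E E2 !nth_cat Sa size_xors ?Sp // Sq.
    case: ifP => Hj //; case: ifP => Hk //; move: Hri; rewrite /inreg E; lia.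
  by rewrite !nth_layout_out.
move=> x Hx; rewrite apply_copy // /ket; congr (_%:R); congr nat_of_bool.
rewrite -LY; apply/eqP/eqP => [<-|->]; rewrite copiedK // ?size_layout ?Hx; lia.
Qed.

Lemma evolves_copy0 X r1 r2 o1 o2 l u p v a c :
  r1 \in regs -> r2 \in regs -> r1 != r2 ->
  X r1 = u ++ p ++ v -> X r2 = a ++ nseq l false ++ c ->
  size (X r1) = len r1 -> size (X r2) = len r2 ->
  size u = o1 -> size p = l -> size a = o2 ->
  evolves (copy (off r1 + o1) (off r2 + o2) l) (ket (layout X))
    (ket (layout (upd X r2 (a ++ p ++ c)))).
Proof.
move=> H1 H2 ne E1 E2 S1 S2 Su Sp Sa.
rewrite -{1}(xors0 Sp); apply: evolves_copy E1 E2 _ _ _ _ _ _ => //.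
exact: size_nseq.
Qed.

Lemma evolves_move X r1 r2 o1 o2 l u p v a c :
  r1 \in regs -> r2 \in regs -> r1 != r2 ->
  X r1 = u ++ p ++ v -> X r2 = a ++ nseq l false ++ c ->
  size (X r1) = len r1 -> size (X r2) = len r2 ->
  size u = o1 -> size p = l -> size a = o2 ->
  evolves (move (off r1 + o1) (off r2 + o2) l) (ket (layout X))
    (ket (layout (upd (upd X r2 (a ++ p ++ c)) r1 (u ++ nseq l false ++ v)))).
Proof.
move=> H1 H2 ne E1 E2 S1 S2 Su Sp Sa.
apply: evolves_cat; first exact: evolves_copy0 E1 E2 _ _ _ _ _.
have -> : nseq l false = xors p p by rewrite xorsx Sp.
apply: evolves_copy => //; rewrite ?(eq_sym r2) // /upd.
- by rewrite eqxx.
- by rewrite (negbTE ne) E1.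
- by rewrite eqxx !size_cat Sp -S2 E2 !size_cat size_nseq.
- by rewrite (negbTE ne).
- exact: Sa.
Qed.

Lemma evolves_flip X r o a b c :
  r \in regs -> X r = a ++ b :: c -> size (X r) = len r -> size a = o ->
  evolves (flip (off r + o)) (ket (layout X)) (ket (layout (upd X r (a ++ ~~ b :: c)))).
Proof.
move=> Hr E S Sa; have B := off_bound Hr.
have lt_o : (o < len r)%N by rewrite -S E size_cat /=; lia.
split; first by apply: flip_wf; lia.
set Y := upd X r _.
have SY : size (Y r) = len r by rewrite /Y /upd eqxx -S E !size_cat.
move=> x Hx.
have [t [e [d [Ex St]]]] : exists t e d, x = t ++ e :: d /\ size t = (off r + o)%N.
  exists (take (off r + o) x), (nth false x (off r + o)), (drop (off r + o).+1 x).
  by rewrite -drop_nth ?cat_take_drop ?size_takel // Hx; lia.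
rewrite Ex -St apply_flip /ket; congr (_%:R); congr nat_of_bool.
rewrite (layout_split off_bound off_disjoint Hr S).
rewrite (layout_upd off_bound off_disjoint) //; last by rewrite -S E !size_cat.
have Sl : size (take (off r) (layout X) ++ a) = size t.
  by rewrite St size_cat (size_take_layout off_bound) // Sa.
rewrite E -!catA !cat_cons !(catA (take (off r) _)) !eqseq_cat ?Sl // !eqseq_cons.
by congr (_ && (_ && _)); clear; case: b; case: e.
Qed.

Lemma evolves_nil psi : evolves [::] psi psi.
Proof. by []. Qed.

Lemma evolves_loop (g : nat -> seq gate) (psi : nat -> vec) n :
  (forall i, (i < n)%N -> evolves (g i) (psi i) (psi i.+1)) ->
  evolves (flatten [seq g i | i <- iota 0 n]) (psi 0%N) (psi n).
Proof.
elim: n => [|n IH] H; first exact: evolves_nil.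
rewrite -addn1 iotaD map_cat flatten_cat /= cats0 addn1; apply: evolves_cat.
  by apply: IH => i lt_i; apply: H; lia.
exact: H.
Qed.

(** Each subcircuit splits every branch by the letter it appends, and amplitudes multiply along the
    word by linearity. The letter [s0] also shows that [words i s] is nonempty, so that
    well-formedness of [g i] can be extracted from [H]. *)
Lemma evolves_words (T : eqType) (s : seq T) (s0 : T) (g : nat -> seq gate)
    (a : nat -> seq T -> T -> algC) (X : seq T -> memory Reg) n :
  s0 \in s ->
  (forall i c, (i < n)%N -> c \in words i s ->
     evolves (g i) (ket (layout (X c)))
       (fun x => \sum_(y <- s) a i c y * ket (layout (X (rcons c y))) x)) ->
  evolves (flatten [seq g i | i <- iota 0 n]) (ket (layout (X [::])))
    (fun x => \sum_(c <- words n s)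
       (\prod_(i < n) a i (take i c) (nth s0 c i)) * ket (layout (X c)) x).
Proof.
move=> Hs H.
pose psi n x := \sum_(c <- words n s)
       (\prod_(i < n) a i (take i c) (nth s0 c i)) * ket (layout (X c)) x.
apply: (evolves_ext (psi := psi 0%N) (phi := psi n)) => //.
  by move=> x _; rewrite /psi big_words0 big_ord0 mul1r.
apply: evolves_loop => i lt_i.
apply: (evolves_ext (psi := psi i) (phi := fun x => \sum_(c <- words i s)
   (\prod_(j < i) a j (take j c) (nth s0 c j)) *
   \sum_(y <- s) a i c y * ket (layout (X (rcons c y))) x)) => //.
  move=> x _; rewrite /psi big_words_rcons; apply: big_seq_cond1 => c /size_word Sc.
  rewrite big_distrr /=; apply: eq_bigr => y _; rewrite big_ord_recr /= mulrA.
  congr (_ * _ * _).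
    apply: eq_bigr => j _; rewrite nth_rcons Sc ltn_ord -cats1 takel_cat //.
    by rewrite Sc ltnW.
  by rewrite nth_rcons Sc ltnn eqxx -cats1 take_size_cat.
apply: evolves_sum; last by move=> c Hc; apply: H.
by have [] := H i _ lt_i (nseq_words _ Hs).
Qed.

End Layout2.

(** * The attack *)

(* [p_sk], [p_pp], [p_vk], [p_sg], [p_ms] are the lengths of the objects of the
   OSMAC, [p_lm] and [p_dl] those of plaintexts and of dk, and [p_kg] and [p_sgn]
   are the circuits of KeyGen and Sign. *)
Record params := Params {
  p_sk : nat; p_pp : nat; p_vk : nat; p_sg : nat; p_ms : nat;
  p_lm : nat; p_n : nat; p_dl : nat; p_k : nat;
  p_kg : circuit; p_sgn : circuit }.

Section Attack.

Variable P : params.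
Local Notation sk := (p_sk P).
Local Notation pp := (p_pp P).
Local Notation vk := (p_vk P).
Local Notation sg := (p_sg P).
Local Notation ms := (p_ms P).
Local Notation lm := (p_lm P).
Local Notation n := (p_n P).
Local Notation dl := (p_dl P).
Local Notation k := (p_k P).
Local Notation kg := (p_kg P).
Local Notation sgn := (p_sgn P).
Local Notation G := (c_wires kg).
Local Notation F := (c_wires sgn).

Local Open Scope nat_scope.

(* Node [v = i * width + a] is the node in column [a] of level [i].  Its
   children are the nodes in columns [2a] and [2a + 1] of the next level, taken
   modulo [width] so that every child exists: nodes may share children, which
   does no harm, as each key signs once.  The ancestors of column [a] of level
   [n] are in columns [a / 2 ^ j], so that the root is the node 0. *)
Definition width := k.+1.

Definition child (b v : nat) := width * (v %/ width).+1 + (2 * v + b) %% width.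

(* The nodes [v < nodes] are signed by the first adversary, node [nodes + j] is
   the leaf of the second-stage adversary [j]; the remaining slots are unused. *)
Definition nodes := (n * width).+1.
Definition keys := nodes + k.
Definition slots := n * width + width + width.

(** Column [j.+1] rather than [j] puts the leaf of party [j] at node [nodes + j]; in particular no
    leaf is node 0, whose key comes with the ciphertext. *)
Definition path_node (j i : nat) := i * width + j.+1 %/ 2 ^ (n - i).
Definition turn (j i : nat) := j.+1 %/ 2 ^ (n - i.+1) %% 2.

(* The share of a second-stage adversary consists of [lm] wires that are 0, the
   path to its leaf, the tuples on this path and the signing key of the leaf. *)
Definition step_len := vk + vk + sg + vk.
Definition share_sk := lm + n + n * step_len.
Definition share_len := share_sk + sk.

(** Outputs must occupy the first wires, so the shares start at wire 0, where the input arrives; the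
    input has to be moved away first. The summand [sk + pp] in [off_in] keeps its target disjoint
    from the input even if the shares are short. *)
Definition off_blk (j : nat) := j * share_len.
Definition off_in := k * share_len + (sk + pp).
Definition off_one := off_in + (sk + pp).
Definition off_key (v : nat) := off_one + 2 + v * G.
Definition off_sig (v : nat) := off_one + 2 + slots * G + v * F.

(** The signing key moves to the register where Sign will run; what remains serves only as a source
    of copies. *)
Definition key_gates (v : nat) : seq gate :=
  copy (off_in + sk) (off_key v) pp ++
  (shift_gates (off_key v) (c_gates kg) ++ move (off_key v) (off_sig v) sk).

Definition sign_gates (v : nat) : seq gate :=
  copy (off_key (child 0 v) + sk) (off_sig v + sk) vk ++
  (copy (off_key (child 1 v) + sk) (off_sig v + (sk + vk)) vk ++
   shift_gates (off_sig v) (c_gates sgn)).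

(** The program that prints the circuit knows [turn j i]; it writes this bit by choosing which of
    the two constant wires, 0 or 1, is copied. *)
Definition turn_gates (j i : nat) : seq gate :=
  copy (off_one + turn j i) (off_blk j + (lm + i)) 1.

Definition step_gates (j i : nat) : seq gate :=
  copy (off_key (child 0 (path_node j i)) + sk)
    (off_blk j + (lm + n + i * step_len)) vk ++
  (copy (off_key (child 1 (path_node j i)) + sk)
    (off_blk j + (lm + n + i * step_len + vk)) vk ++
  (copy (off_sig (path_node j i))
    (off_blk j + (lm + n + i * step_len + vk + vk)) sg ++
  copy (off_key (path_node j i.+1) + sk)
    (off_blk j + (lm + n + i * step_len + vk + vk + sg)) vk)).

Definition share_gates (j : nat) : seq gate :=
  flatten [seq turn_gates j i | i <- iota 0 n] ++
  (flatten [seq step_gates j i | i <- iota 0 n] ++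
   move (off_sig (nodes + j)) (off_blk j + share_sk) sk).

(** [off_sig slots] is the end of the last signature register, hence the number of wires. Key
    generation starts at node 1, the key of node 0 being part of the input. *)
Definition first_stage : circuit :=
  Circuit (sk + pp) (off_sig slots - (sk + pp)) (k * share_len)
    (move 0 off_in (sk + pp) ++
     (flip (off_one + 1) ++
      (move off_in (off_sig 0) sk ++
       (flatten [seq key_gates i.+1 | i <- iota 0 keys.-1] ++
        (flatten [seq sign_gates i | i <- iota 0 nodes] ++
         flatten [seq share_gates j | j <- iota 0 k]))))).

(* The key dk is copied before signing, which consumes the message register. *)
Definition second_stage : circuit :=
  Circuit (share_len + dl) (F - sk + 1) lm
    (copy share_len (share_sk + F) dl ++
     (shift_gates share_sk (c_gates sgn) ++
      [:: Oracle (iota (share_sk + F) dl ++ iota lm (n + n * step_len) ++ iota share_sk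
        sg)
                 ((share_sk + F + dl) :: iota 0 lm)])).

End Attack.

Arguments width : simpl never.
Arguments nodes : simpl never.
Arguments keys : simpl never.
Arguments slots : simpl never.

(** * Uniformity of the attack circuits *)

Section AttackPolytime.

Variable P : nat -> params.
Hypothesis pt_sk : pt (fun lam => p_sk (P lam)).
Hypothesis pt_pp : pt (fun lam => p_pp (P lam)).
Hypothesis pt_vk : pt (fun lam => p_vk (P lam)).
Hypothesis pt_sg : pt (fun lam => p_sg (P lam)).
Hypothesis pt_lm : pt (fun lam => p_lm (P lam)).
Hypothesis pt_n : pt (fun lam => p_n (P lam)).
Hypothesis pt_dl : pt (fun lam => p_dl (P lam)).
Hypothesis pt_k : pt (fun lam => p_k (P lam)).
Hypothesis pt_kg : pt (fun lam => p_kg (P lam)).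
Hypothesis pt_sgn : pt (fun lam => p_sgn (P lam)).

Lemma pt_at (A B : encType) (g : A -> nat) (h : nat -> B) :
  pt g -> pt h -> pt (fun a => h (g a)).
Proof. exact: pt_comp. Qed.

Ltac pt_step :=
  lazymatch goal with
  | |- pt (fun _ => ?c) => exact: pt_const
  | |- pt (fun a => a) => exact: pt_id
  | |- pt fst => exact: (pt_fst (pt_id _))
  | |- pt snd => exact: (pt_snd (pt_id _))
  | |- pt (fun a => fst _) => apply: pt_fst
  | |- pt (fun a => snd _) => apply: pt_snd
  | |- pt (fun a => addn _ _) => apply: pt_add
  | |- pt (fun a => subn _ _) => apply: pt_sub
  | |- pt (fun a => muln _ _) => apply: pt_mul
  | |- pt (fun a => divn _ (expn 2 _)) => apply: pt_divn_pow2
  | |- pt (fun a => divn _ _) => apply: pt_divn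
  | |- pt (fun a => modn _ _) => apply: pt_modn
  | |- pt (fun a => S _) => apply: pt_S
  | |- pt (fun a => predn _) => apply: pt_pred
  | |- pt (fun a => copy _ _ _) => apply: pt_copy
  | |- pt (fun a => move _ _ _) => apply: pt_move
  | |- pt (fun a => shift_gates _ _) => apply: pt_shift_gates
  | |- pt (fun a => cat _ _) => apply: pt_cat
  | |- pt (fun a => cons _ _) => apply: pt_cons
  | |- pt (fun a => iota _ _) => apply: pt_iota
  | |- pt (fun a => c_in _) => apply: pt_c_in
  | |- pt (fun a => c_anc _) => apply: pt_c_anc
  | |- pt (fun a => c_gates _) => apply: pt_c_gates
  | |- pt (fun a => Had _) => apply: pt_Had
  | |- pt (fun a => Tgate _) => apply: pt_Tgate
  | |- pt (fun a => Oracle _ _) => apply: pt_Oracle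
  | |- pt (fun a => Circuit _ _ _ _) => apply: pt_Circuit
  | |- pt (fun a => p_sk (P _)) => apply: (pt_at _ pt_sk)
  | |- pt (fun a => p_pp (P _)) => apply: (pt_at _ pt_pp)
  | |- pt (fun a => p_vk (P _)) => apply: (pt_at _ pt_vk)
  | |- pt (fun a => p_sg (P _)) => apply: (pt_at _ pt_sg)
  | |- pt (fun a => p_lm (P _)) => apply: (pt_at _ pt_lm)
  | |- pt (fun a => p_n (P _)) => apply: (pt_at _ pt_n)
  | |- pt (fun a => p_dl (P _)) => apply: (pt_at _ pt_dl)
  | |- pt (fun a => p_k (P _)) => apply: (pt_at _ pt_k)
  | |- pt (fun a => p_kg (P _)) => apply: (pt_at _ pt_kg)
  | |- pt (fun a => p_sgn (P _)) => apply: (pt_at _ pt_sgn)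
  end.

Ltac pt_tac := repeat (cbv beta; pt_step).

Lemma pt_second_stage : pt (fun lam => second_stage (P lam)).
Proof. by rewrite /second_stage /share_len /share_sk /step_len /c_wires; pt_tac. Qed.

Lemma pt_first_stage : pt (fun lam => first_stage (P lam)).
Proof.
have Hwidth (A : encType) (g : A -> nat) : pt g -> pt (fun a => width (P (g a))).
  by move=> Hg; rewrite /width; pt_tac; exact: Hg.
have Hchild (A : encType) b (g h : A -> nat) : pt g -> pt h ->
    pt (fun a => child (P (g a)) b (h a)).
  move=> Hg Hh; rewrite /child.
  by pt_tac => //; try exact: Hwidth; try exact: Hh.
have Hpath (A : encType) (g h i : A -> nat) : pt g -> pt h -> pt i ->
    pt (fun a => path_node (P (g a)) (h a) (i a)).
  move=> Hg Hh Hi; rewrite /path_node.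
  by pt_tac => //; try exact: Hwidth.
have Hflat (A T U : encType) (F : A -> T -> seq U) (l : A -> seq T) :=
  @pt_flatmap A T U F l.
have {}Hwidth : pt (fun lam => width (P lam)) := Hwidth _ _ (pt_id _).
rewrite /first_stage /share_gates /turn_gates /step_gates /key_gates /sign_gates /turn.
rewrite /off_sig /off_key /off_blk /off_one /off_in /share_len /share_sk /step_len.
rewrite /slots /keys /nodes /c_wires /flip.
repeat (cbv beta; first
  [ pt_step
  | lazymatch goal with
    | |- pt (fun a => flatten (map (@?F a) (@?l a))) => apply: (pt_flatmap (F := F))
    | |- pt (fun a => child (P _) _ _) => apply: Hchild
    | |- pt (fun a => path_node (P _) _ _) => apply: Hpath
    | |- pt (fun a => width (P _)) => apply: (pt_at _ Hwidth)
    end ]) => //.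
Qed.

End AttackPolytime.

(** * The second-stage circuit *)

Lemma map_nth_iota_cat (a p b : bits) o l : size a = o -> size p = l ->
  [seq nth false (a ++ p ++ b) i | i <- iota o l] = p.
Proof.
move=> Sa Sp; apply: (@eq_from_nth _ false); rewrite size_map size_iota // => i lt_i.
rewrite (nth_map 0%N) ?size_iota // nth_iota // nth_cat Sa ltnNge leq_addr /=.
by rewrite addKn nth_cat Sp lt_i.
Qed.

Lemma copied_cat a p b c s d l : size a = s -> size p = l ->
  size (a ++ p ++ b) = d ->
  copied s d l (a ++ p ++ b ++ nseq l false ++ c) = a ++ p ++ b ++ p ++ c.
Proof.
rewrite !size_cat => Sa Sp Sd.
apply: (@eq_from_nth _ false) => [|i]; rewrite size_mkseq.
  by rewrite !size_cat size_nseq Sp.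
move=> lt_i; rewrite nth_mkseq //; case: (boolP (d <= i < d + l)%N) => Hi /=.
  rewrite !nth_cat nth_nseq size_nseq Sa Sp.
  have -> : (s + (i - d) < s)%N = false by lia.
  have -> : (s + (i - d) - s < l)%N by lia.
  have -> : (i < s)%N = false by lia.
  have -> : (i - s < l)%N = false by lia.
  have -> : (i - s - l < size b)%N = false by lia.
  have -> : (i - s - l - size b < l)%N by lia.
  by rewrite /=; congr nth; lia.
rewrite addbF !nth_cat size_nseq Sa Sp.
case: ifP => // H1; case: ifP => // H2; case: ifP => // H3.
by have -> : (i - s - l - size b < l)%N = false by lia.
Qed.

Lemma apply_OracleE f psi xs ys x :
  apply_gate f psi (Oracle xs ys) x
    = psi (xor_wires x ys (f [seq nth false x i | i <- xs])).
Proof. by []. Qed.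

Record valid_params (P : params) : Prop := ValidParams {
  v_kg_wf : circuit_wf (p_kg P);
  v_kg_in : c_in (p_kg P) = p_pp P;
  v_kg_out : c_out (p_kg P) = (p_sk P + p_vk P)%N;
  v_sgn_wf : circuit_wf (p_sgn P);
  v_sgn_in : c_in (p_sgn P) = (p_sk P + p_ms P)%N;
  v_sgn_out : c_out (p_sgn P) = p_sg P;
  v_vk_ms : (p_vk P + p_vk P <= p_ms P)%N;
  v_dl_ms : (p_dl P <= p_ms P)%N }.

Section SecondStage.

Variable P : params.
Local Notation sk := (p_sk P).
Local Notation vk := (p_vk P).
Local Notation sg := (p_sg P).
Local Notation ms := (p_ms P).
Local Notation lm := (p_lm P).
Local Notation n := (p_n P).
Local Notation dl := (p_dl P).
Local Notation sgn := (p_sgn P).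
Local Notation F := (c_wires sgn).

Hypothesis HP : valid_params P.
Let sgn_wf := v_sgn_wf HP.
Let sgn_in := v_sgn_in HP.
Let sgn_out := v_sgn_out HP.
Let dl_ms := v_dl_ms HP.

Lemma sign_wires : F = (sk + ms + c_anc sgn)%N.
Proof. by rewrite /c_wires sgn_in. Qed.

Lemma sg_wires : (sg <= F)%N.
Proof. by move: sgn_wf => /andP[]; rewrite sgn_out. Qed.

Lemma second_stage_wires :
  c_wires (second_stage P) = (share_sk P + F + dl + 1)%N.
Proof.
by rewrite {1}/c_wires /= /share_len; have := sign_wires; lia.
Qed.

Lemma second_stage_wf : circuit_wf (second_stage P).
Proof.
have EF := sign_wires; have Esg := sg_wires.
rewrite /circuit_wf second_stage_wires /= /share_len.
have lm_le : (lm <= share_sk P)%N by rewrite /share_sk; lia.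
apply/andP; split; first by lia.
rewrite !all_cat /= andbT; apply/and3P; split.
- by apply: copy_wf; lia.
- by apply: (shift_gates_wf (n := F)); [case/andP: sgn_wf | lia].
set s := share_sk P in lm_le *.
have Es : s = (lm + (n + n * step_len P))%N by rewrite /s /share_sk; lia.
apply/andP; split; last first.
  by apply/allP => i; rewrite !mem_cat inE !mem_iota; lia.
rewrite !cat_uniq /= !iota_uniq /= !andbT mem_iota.
repeat (apply/andP; split); try apply/hasPn => i;
  rewrite /= ?(mem_cat, mem_iota); try lia.
rewrite negb_or; apply/andP; split; first by lia.
by apply/hasPn => i; rewrite /= !mem_cat !mem_iota; lia.
Qed.

(** The amplitude is pulled back from the final basis state. The oracle gate turns the output [m]
    and the flag [true] into zeros, the embedded Sign circuit gives a sum over strings [w], and the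
    copy of [dk] leaves the single [w] that is the honest input of Sign. *)
Lemma run_second_stage f R T u dk m y :
  size R = n -> size T = (n * step_len P)%N -> size u = sk -> size dk = dl ->
  size m = lm -> size y = F -> f (dk ++ R ++ T ++ take sg y) = true :: m ->
  run f (second_stage P) (nseq lm false ++ R ++ T ++ u ++ dk)
      (m ++ R ++ T ++ y ++ dk ++ [:: true])
    = run no_oracle sgn (u ++ pad ms dk) y.
Proof.
move=> SR ST Su Sd Sm Sy Hf; have EF := sign_wires; have Esg := sg_wires.
have sgn_gates : all (gate_wf F) (c_gates sgn) by case/andP: sgn_wf.
rewrite {1}/run [c_gates _]/= !foldl_cat.
set psi0 := ket _; set psi1 := foldl _ psi0 _.
rewrite [foldl _ _ [:: _]]/=.
pose a := nseq lm false ++ R ++ T; pose b := dk ++ [:: false].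
have Sa : size a = share_sk P by rewrite !size_cat size_nseq SR ST /share_sk; lia.
have query : [seq nth false (m ++ R ++ T ++ y ++ dk ++ [:: true]) i | i <-
      iota (share_sk P + F) dl ++ iota lm (n + n * step_len P) ++ iota (share_sk P) sg]
    = dk ++ R ++ T ++ take sg y.
  rewrite !map_cat; congr (_ ++ _).
    rewrite !(catA m) !(catA (m ++ _)) !(catA ((m ++ _) ++ _)) map_nth_iota_cat //.
    by rewrite !size_cat Sm SR ST Sy /share_sk; lia.
  rewrite !(catA R); congr (_ ++ _).
    by rewrite map_nth_iota_cat // size_cat SR ST.
  rewrite -{1}(cat_take_drop sg y) !(catA m) -!(catA (take sg y)).
  rewrite map_nth_iota_cat ?size_takel ?Sy //.
  by rewrite !size_cat Sm SR ST /share_sk; lia.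
have final : xor_wires (m ++ R ++ T ++ y ++ dk ++ [:: true])
    ((share_sk P + F + dl)%N :: iota 0 lm) (true :: m) = a ++ y ++ b.
  apply: (@eq_from_nth _ false) => [|i]; rewrite size_xor_wires.
    by rewrite !size_cat size_nseq Sm /=; lia.
  move=> lt_i; rewrite nth_xor_wires // take_oversize /=; last by rewrite /= size_iota Sm.
  have [lt_m|ge_m] := ltnP i lm.
    have -> : (share_sk P + F + dl == i)%N = false by rewrite /share_sk; lia.
    rewrite /= -{2}(add0n i) -(nth_iota 0 0 lt_m) index_uniq ?size_iota ?iota_uniq //.
    by rewrite !nth_cat !size_cat !size_nseq Sm SR lt_m ltn_addr // nth_nseq lt_m addbb.
  have Hout : nth false (a ++ y ++ b) i
      = nth false (m ++ R ++ T ++ y ++ dk ++ [:: false]) i.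
    by rewrite /a /b -!catA !(nth_cat _ (nseq _ _)) !(nth_cat _ m) size_nseq Sm ltnNge
      ge_m.
  rewrite Hout; have [E|ne] := eqVneq.
    have EL : i = size (m ++ R ++ T ++ y ++ dk).
      by rewrite -E !size_cat Sm SR ST Sy Sd /share_sk; lia.
    have catE c : m ++ R ++ T ++ y ++ dk ++ c = (m ++ R ++ T ++ y ++ dk) ++ c.
      by rewrite -!catA.
    by rewrite !(catE [:: _]) !nth_cat EL ltnn subnn.
  rewrite /= memNindex ?mem_iota ?size_iota; last by lia.
  rewrite (nth_default _ (_ : size m <= lm)%N) ?Sm // addbF.
  have lt_i' : (i < size (m ++ R ++ T ++ y ++ dk))%N.
    move: lt_i ne; rewrite !size_cat Sm SR ST Sy Sd /share_sk /=; lia.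
  have catE c : m ++ R ++ T ++ y ++ dk ++ c = (m ++ R ++ T ++ y ++ dk) ++ c.
    by rewrite -!catA.
  by rewrite !(catE [:: _]) !nth_cat lt_i'.
rewrite apply_OracleE query Hf final -Sa (shift_gates_embed _ _ _ _ sgn_gates) //.
rewrite (apply_gates_ket _ _ sgn_gates) //.
pose w0 := u ++ dk ++ nseq (F - sk - dl) false.
have Sw0 : size w0 = F by rewrite !size_cat size_nseq Su Sd; lia.
have -> : run no_oracle sgn (u ++ pad ms dk) y
    = foldl (apply_gate no_oracle) (ket w0) (c_gates sgn) y.
  rewrite /run /w0 /pad Sd -!catA -nseqD.
  by congr (foldl _ (ket (_ ++ _ ++ nseq _ _)) _ _); lia.
rewrite -(big_strs_delta (fun w => foldl _ (ket w) _ y) Sw0).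
apply: big_seq_cond1 => w /size_strs Sw; rewrite mulrC; congr (_ * _).
rewrite /psi1 apply_copy; last by rewrite /share_len; lia.
rewrite /psi0 /ket; congr (_%:R); congr nat_of_bool.
set X0 := _ ++ nseq _ false.
have EX0 : X0 = (a ++ u) ++ dk ++ nseq (F - sk - dl) false ++ nseq dl false ++ [:: false].
  rewrite /X0 /a -!catA; do 5 congr (_ ++ _).
  rewrite (_ : [:: false] = nseq 1 false) // -!nseqD; congr nseq => /=; lia.
have CX0 : copied (share_len P) (share_sk P + F) dl X0 = a ++ w0 ++ b.
  have S1 : size (a ++ u) = share_len P by rewrite size_cat Sa Su.
  have S2 : size ((a ++ u) ++ dk ++ nseq (F - sk - dl) false) = (share_sk P + F)%N.
    by rewrite size_cat S1 size_cat size_nseq Sd /share_len; lia.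
  by rewrite EX0 copied_cat // /w0 /b -!catA.
clearbody a; have SX0 : size X0 = (share_sk P + F + dl + 1)%N.
  by rewrite EX0 !size_cat !size_nseq Sa Su Sd /=; lia.
have disj : (share_len P + dl <= share_sk P + F)%N \/ (share_sk P + F + dl <= share_len
  P)%N.
  by left; rewrite /share_len; lia.
have -> : (w == w0) = (a ++ w ++ b == a ++ w0 ++ b).
  by rewrite eqseq_cat // eqxx eqseq_cat ?Sw ?Sw0 // eqxx andbT.
rewrite -CX0; apply/eqP/eqP => [<-|->]; rewrite copiedK // ?SX0 ?size_cat ?Sa ?Sw ?Sd
  /share_len /=; lia.
Qed.

End SecondStage.

(** * The state prepared by the first adversary *)

Inductive reg := RIn | ROne | RKey of nat | RSig of nat | RBlk of nat.

Lemma reg_eq_dec : comparable reg.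
Proof. by rewrite /comparable /decidable; do !decide equality. Qed.
HB.instance Definition _ := hasDecEq.Build reg (compareP reg_eq_dec).

Section FirstStage.

Variable P : params.
Local Notation sk := (p_sk P).
Local Notation pp := (p_pp P).
Local Notation vk := (p_vk P).
Local Notation sg := (p_sg P).
Local Notation ms := (p_ms P).
Local Notation lm := (p_lm P).
Local Notation n := (p_n P).
Local Notation dl := (p_dl P).
Local Notation k := (p_k P).
Local Notation kg := (p_kg P).
Local Notation sgn := (p_sgn P).
Local Notation G := (c_wires kg).
Local Notation F := (c_wires sgn).
Local Notation W := (width P).

Hypothesis HP : valid_params P.
Let kg_wf := v_kg_wf HP.
Let kg_in := v_kg_in HP.
Let kg_out := v_kg_out HP.
Let sgn_wf := v_sgn_wf HP.
Let sgn_in := v_sgn_in HP.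
Let sgn_out := v_sgn_out HP.
Let vk_ms := v_vk_ms HP.

Lemma key_wires : (sk + vk <= G)%N.
Proof. by move: kg_wf => /andP[]; rewrite kg_out. Qed.

Lemma pp_wires : G = (pp + c_anc kg)%N.
Proof. by rewrite /c_wires kg_in. Qed.

Let F_eq := sign_wires HP.
Let F_sg := sg_wires HP.

Lemma path_col (j i : nat) : (j < k)%N -> (j.+1 %/ 2 ^ i < W)%N.
Proof. by move=> lt_j; rewrite ltnS; apply: leq_trans (leq_div _ _) _. Qed.

Lemma path_node_nodes j i : (j < k)%N -> (i < n)%N -> (path_node P j i < nodes P)%N.
Proof.
move=> lt_j lt_i; have := path_col (n - i) lt_j; rewrite /path_node /nodes.
have : (i.+1 * W <= n * W)%N by rewrite leq_mul2r lt_i orbT.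
by rewrite mulSn; lia.
Qed.

Lemma path_node_leaf j : path_node P j n = (nodes P + j)%N.
Proof. by rewrite /path_node subnn divn1 /nodes; lia. Qed.

Lemma keys_slots : (keys P < slots P)%N.
Proof. by rewrite /keys /nodes /slots /width; lia. Qed.

Lemma path_node_keys j i : (j < k)%N -> (i <= n)%N -> (path_node P j i < keys P)%N.
Proof.
move=> lt_j; rewrite leq_eqVlt => /orP[/eqP->|lt_i];
  first by rewrite path_node_leaf /keys ltn_add2l.
by apply: leq_trans (path_node_nodes lt_j lt_i) _; rewrite leq_addr.
Qed.

Lemma child_slots b v : (v < nodes P)%N -> (child P b v < slots P)%N.
Proof.
rewrite /nodes ltnS /child /slots => le_v.
have : (v %/ W <= n)%N by rewrite -(mulnK n (ltn0Sn k)) leq_div2r.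
have : ((2 * v + b) %% W < W)%N by rewrite ltn_mod.
rewrite mulnS => H1 H2.
have : (W * (v %/ W) <= n * W)%N by rewrite mulnC leq_mul2r H2 orbT.
by lia.
Qed.

(** The verification key of the root is built into the oracle and sits in no register; the
    positivity of children and of path successors ensures that no gate has to copy it. *)
Lemma child_gt0 b v : (0 < child P b v)%N.
Proof. by rewrite /child mulnS !addn_gt0. Qed.

Lemma path_node_gt0 j i : (0 < path_node P j i.+1)%N.
Proof. by rewrite /path_node mulSn !addn_gt0. Qed.

Definition off (r : reg) : nat :=
  match r with
  | RIn => off_in P
  | ROne => off_one P
  | RKey v => off_key P v
  | RSig v => off_sig P v
  | RBlk j => off_blk P j
  end.

Definition len (r : reg) : nat :=
  match r with
  | RIn => sk + pp
  | ROne => 2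
  | RKey v => G
  | RSig v => F
  | RBlk j => share_len P
  end%N.

Definition regs : seq reg :=
  [:: RIn, ROne & [seq RKey v | v <- iota 0 (slots P)] ++
    ([seq RSig v | v <- iota 0 (slots P)] ++ [seq RBlk j | j <- iota 0 k])].

Lemma mem_regs r : (r \in regs) =
  match r with RKey v => v < slots P | RSig v => v < slots P | RBlk j => j < k
             | _ => true end%N.
Proof.
have out (g : nat -> reg) s r' : (forall v, r' <> g v) -> (r' \in [seq g v | v <- s]) =
  false.
  by move=> H; apply/negbTE/mapP => -[v _ /H].
have inj (g : nat -> reg) m v : injective g -> (g v \in [seq g v | v <- iota 0 m]) = (v
  < m)%N.
  by move=> /mem_map->; rewrite mem_iota.
rewrite /regs !inE !mem_cat; case: r => [||v|v|j]; rewrite ?eqxx ?orbT //;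
  do 2!(case: eqP => // _) => /=.
- by rewrite (inj RKey) ?(out RSig) ?(out RBlk) ?orbF // => x y [].
- by rewrite (inj RSig) ?(out RKey) ?(out RBlk) ?orbF // => x y [].
- by rewrite (inj RBlk) ?(out RKey) ?(out RSig) // => x y [].
Qed.

Local Notation N := (off_sig P (slots P)).

Lemma mul_block v m l : (v < m)%N -> (v * l + l <= m * l)%N.
Proof. by move=> lt_v; rewrite -mulSnr leq_mul2r lt_v orbT. Qed.

Lemma off_bound : {in regs, forall r, (off r + len r <= N)%N}.
Proof.
move=> r; rewrite mem_regs /off_sig.
case: r => [||v|v|j] /=; rewrite /off_sig /off_key /off_one /off_in /off_blk; try lia.
- by move=> /(mul_block G); lia.
- by move=> /(mul_block F); lia.
- by move=> /(mul_block (share_len P)); lia.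
Qed.

Lemma off_disjoint : {in regs &, forall r r', r != r' ->
  (off r + len r <= off r')%N \/ (off r' + len r' <= off r)%N}.
Proof.
move=> r r'; rewrite !mem_regs.
have blk v v' l (g : nat -> reg) : g v != g v' ->
    (v * l + l <= v' * l)%N \/ (v' * l + l <= v * l)%N.
  move=> ne; have : v != v' by apply: contra_neq ne => ->.
  by rewrite neq_ltn => /orP[] /(mul_block l); [left | right].
case: r r' => [||v|v|j] [||v'|v'|j'] H1 H2 ne; rewrite /=;
  rewrite /off_sig /off_key /off_one /off_in /off_blk;
  try (have := mul_block G H1); try (have := mul_block G H2);
  try (have := mul_block F H1); try (have := mul_block F H2);
  try (have := mul_block (share_len P) H1); try (have := mul_block (share_len P) H2);
  try (have := blk _ _ G _ ne); try (have := blk _ _ F _ ne);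
  try (have := blk _ _ (share_len P) _ ne); try lia;
  by rewrite eqxx in ne.
Qed.

Variable f : oracle.

Local Notation Lay := (layout regs off len N).
Local Notation evolves := (evolves N f).
Local Notation z := (nseq G false).
Local Notation zF := (nseq F false).

Definition vk_of (c : seq bits) (v : nat) : bits := take vk (drop sk (nth z c v)).

(* The memory when the keys [c] have been generated (the key of the root, [c_0],
   is not an output of the adversary's circuit), the nodes [v < size d] have
   signed and the shares [blk] are complete. *)
Definition mem (inp one : bits) (c d blk : seq bits) : memory reg := fun r =>
  match r with
  | RIn => inp
  | ROne => one
  | RKey v => if (0 < v < size c)%N then nseq sk false ++ drop sk (nth z c v) else z
  | RSig v =>
      if (v < size d)%N then nth zF d v
      else if (v < size c)%N && ~~ (nodes P <= v < nodes P + size blk)%N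
      then take sk (nth z c v) ++ nseq (F - sk) false else zF
  | RBlk j => if (j < size blk)%N then nth [::] blk j else nseq (share_len P) false
  end.

Definition wf_mem (c d blk : seq bits) : Prop :=
  [/\ forall v, size (nth z c v) = G, forall v, size (nth zF d v) = F
    & forall j, (j < size blk)%N -> size (nth [::] blk j) = share_len P].

Lemma size_nth_word l m w v : w \in words m (strs l) -> size (nth (nseq l false) w v) = l.
Proof.
move=> Hw; have [lt_v|ge_v] := ltnP v m.
  by have := nth_word (nseq l false) Hw lt_v; rewrite mem_strs => /eqP.
by rewrite nth_default ?size_nseq // (size_word Hw).
Qed.

Lemma sk_wires : (sk <= F)%N.
Proof. by rewrite F_eq; lia. Qed.

Lemma size_mem inp one c d blk r : size inp = (sk + pp)%N -> size one = 2%N ->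
  wf_mem c d blk -> size (mem inp one c d blk r) = len r.
Proof.
have Hk := key_wires; have Hs := sk_wires.
move=> Si So [Hc Hd Hb]; case: r => [||v|v|j] //=.
- case: ifP => _; last by rewrite size_nseq.
  by rewrite size_cat size_nseq size_drop Hc; lia.
- case: ifP => _; first exact: Hd.
  case: ifP => _; last by rewrite size_nseq.
  by rewrite size_cat size_nseq size_takel ?Hc; lia.
- by case: ifP => [/Hb|_]; rewrite ?size_nseq.
Qed.

Lemma key_content inp one c d blk v : wf_mem c d blk -> (0 < v)%N ->
  mem inp one c d blk (RKey v)
    = nseq sk false ++ vk_of c v ++ drop (sk + vk) (nth z c v).
Proof.
move=> [Hc _ _] v_gt0; have Hk := key_wires; rewrite /= v_gt0 /vk_of.
have -> : drop (sk + vk) (nth z c v) = drop vk (drop sk (nth z c v)).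
  by rewrite drop_drop addnC.
rewrite cat_take_drop; case: ifP => //= ge_v.
by rewrite nth_default 1?leqNgt ?ge_v // drop_nseq -nseqD; congr nseq; lia.
Qed.

Lemma size_vk_of c d blk v : wf_mem c d blk -> size (vk_of c v) = vk.
Proof.
by case=> Hc _ _; have Hk := key_wires; rewrite size_takel // size_drop Hc; lia.
Qed.

Lemma layout0 X : (forall r i, r \in regs -> (i < len r)%N -> nth false (X r) i =
  false) ->
  Lay X = nseq N false.
Proof.
move=> H; apply: (@eq_from_nth _ false); rewrite size_layout ?size_nseq // => i lt_i.
rewrite nth_nseq lt_i; have [/hasP[r Hr Hi]|Ho] := boolP (has (inreg off len i) regs).
  rewrite (nth_layout_in off_bound off_disjoint _ Hr) // H //.
  by move: Hi; rewrite /inreg; lia.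
by rewrite nth_layout_out.
Qed.

(** The input arrives on wires that may belong to the shares, so the first [move] falls outside the
    register calculus and is followed on raw strings. *)
Lemma evolves_copied s d l x y : size x = N -> (s + l <= N)%N -> (d + l <= N)%N ->
  (s + l <= d)%N \/ (d + l <= s)%N -> copied s d l x = y ->
  evolves (copy s d l) (ket x) (ket y).
Proof.
move=> Sx Hs Hd disj <-; split; first exact: copy_wf.
move=> w Sw; rewrite apply_copy // /ket; congr (_%:R); congr nat_of_bool.
by apply/eqP/eqP => [<-|->]; rewrite copiedK ?Sx ?Sw.
Qed.

Lemma copied_clear p b c : copied (size (p ++ b)) 0 (size p) (p ++ b ++ p ++ c)
  = nseq (size p) false ++ b ++ p ++ c.
Proof.
apply: (@eq_from_nth _ false) => [|i]; rewrite size_mkseq;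
  first by rewrite !size_cat size_nseq.
move=> lt_i; rewrite nth_mkseq // add0n subn0 !(nth_cat _ p) !(nth_cat _ (nseq _ _))
  size_nseq.
case: ifP => Hi /=; last by rewrite addbF.
have -> : (size (p ++ b) + i < size p)%N = false by rewrite size_cat; lia.
rewrite nth_cat; have -> : (size (p ++ b) + i - size p < size b)%N = false by rewrite
  size_cat; lia.
rewrite nth_cat; have -> : (size (p ++ b) + i - size p - size b = i)%N by rewrite
  size_cat; lia.
by rewrite Hi addbb nth_nseq Hi.
Qed.

Lemma eq_lay X Y : X =1 Y -> Lay X = Lay Y.
Proof. by move=> E; apply: (layout_ext off_bound off_disjoint) => r i _ _; rewrite E. Qed.

Lemma evolves_eq gs psi X Y : X =1 Y ->
  evolves gs psi (ket (Lay X)) -> evolves gs psi (ket (Lay Y)).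
Proof. by move=> /eq_lay->. Qed.

Lemma slots_gt0 : (0 < slots P)%N.
Proof. by rewrite /slots /width; lia. Qed.

Lemma evolves_input u p : size u = sk -> size p = pp ->
  evolves (move 0 (off_in P) (sk + pp)) (ket ((u ++ p) ++ nseq (N - (sk + pp)) false))
    (ket (Lay (mem (u ++ p) (nseq 2 false) [::] [::] [::]))).
Proof.
move=> Su Sp; pose B := (k * share_len P)%N; pose R := (N - (off_in P + (sk + pp)))%N.
have lt_N : (off_in P + (sk + pp) <= N)%N.
  by rewrite /off_sig /off_one; lia.
have Ein : off_in P = (sk + pp + B)%N by rewrite /off_in /B addnC.
have Sup : size (u ++ p) = (sk + pp)%N by rewrite size_cat Su Sp.
have E0 : nseq (N - (sk + pp)) false = nseq B false ++ nseq (sk + pp) false ++ nseq R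
  false.
  by rewrite -!nseqD; congr nseq; rewrite /R; lia.
have E1 : Lay (mem (u ++ p) (nseq 2 false) [::] [::] [::])
    = nseq (sk + pp) false ++ nseq B false ++ (u ++ p) ++ nseq R false.
  transitivity (Lay (upd (fun r => nseq (len r) false) RIn (u ++ p))).
    apply: eq_lay => r; rewrite /upd; case: eqP => [->//|].
    by case: r => [||v|v|j] //=; rewrite ?ltn0 ?andbF.
  rewrite (layout_upd off_bound off_disjoint) ?mem_regs //.
  rewrite layout0; last by move=> r i _ _; rewrite nth_nseq if_same.
  rewrite take_nseq ?drop_nseq /=; last lia.
  by rewrite Ein nseqD -catA; congr (_ ++ (_ ++ (_ ++ nseq _ _))); rewrite /R Ein.
rewrite E0 E1; apply: (evolves_cat (phi := ket ((u ++ p) ++ nseq B false ++ (u ++ p) ++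
  nseq R false))).
  apply: evolves_copied; rewrite ?Ein; try lia.
  - by rewrite !size_cat !size_nseq Su Sp /R; lia.
  apply: (@copied_cat [::] (u ++ p)) => //=.
  by rewrite size_cat Sup size_nseq.
apply: evolves_copied; rewrite ?Ein; try lia.
- by rewrite !size_cat !size_nseq Su Sp /R; lia.
by have := copied_clear (u ++ p) (nseq B false) (nseq R false);
  rewrite size_cat Sup size_nseq.
Qed.

Lemma evolves_one inp : size inp = (sk + pp)%N ->
  evolves (flip (off_one P + 1)) (ket (Lay (mem inp (nseq 2 false) [::] [::] [::])))
    (ket (Lay (mem inp [:: false; true] [::] [::] [::]))).
Proof.
move=> Si; have H := @evolves_flip _ _ _ _ _ off_bound off_disjoint f
  (mem inp (nseq 2 false) [::] [::] [::]) ROne 1 [:: false] false [::].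
apply: (evolves_eq (X := upd (mem inp (nseq 2 false) [::] [::] [::]) ROne [:: false;
  true])).
  by move=> r; rewrite /upd; case: eqP => [->|] //; case: r.
by apply: H; rewrite ?mem_regs.
Qed.

Local Notation one := [:: false; true].

(** [w0] is the full final string of the challenger's KeyGen, of which the circuit receives only the
    first [sk] bits. Recording all of it as the key of node 0 lets the root be treated like the
    other nodes. *)
Lemma evolves_root p w0 : size w0 = G -> size p = pp ->
  evolves (move (off_in P) (off_sig P 0) sk)
    (ket (Lay (mem (take sk w0 ++ p) one [::] [::] [::])))
    (ket (Lay (mem (nseq sk false ++ p) one [:: w0] [::] [::]))).
Proof.
move=> Sw Sp; have Hk := key_wires; have Hs := sk_wires; have Hs0 := slots_gt0.
pose X := mem (take sk w0 ++ p) one [::] [::] [::].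
have Su : size (take sk w0) = sk by rewrite size_takel ?Sw; lia.
have H := @evolves_move _ _ _ _ _ off_bound off_disjoint f X RIn (RSig 0) 0 0 sk
  [::] (take sk w0) p [::] (nseq (F - sk) false).
rewrite !addn0 in H.
apply: (evolves_eq (X := upd (upd X (RSig 0) ([::] ++ take sk w0 ++ nseq (F - sk) false))
   RIn ([::] ++ nseq sk false ++ p))).
  move=> r; rewrite /upd /X; case: eqP => [->//|ne1]; case: eqP => [->//|ne].
  case: r ne1 ne => [||v|v|j] //= _ ne.
  - by case: v {ne} => [|v] //=; rewrite !ltnS ltn0.
  - by case: v ne => [|v] // ne.
apply: H; rewrite ?mem_regs ?Su ?cats0 //=.
- by apply/eqP.
- by rewrite -nseqD; congr nseq; lia.
- by rewrite size_cat Su Sp.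
- by rewrite size_nseq.
Qed.

Local Notation inp p := (nseq sk false ++ p).

Lemma evolves_key p w0 c v : size w0 = G -> size p = pp ->
  c \in words v (strs G) -> (v < (keys P).-1)%N ->
  evolves (key_gates P v.+1)
    (ket (Lay (mem (inp p) one (w0 :: c) [::] [::])))
    (fun x => \sum_(y <- strs G) run no_oracle kg p y *
       ket (Lay (mem (inp p) one (w0 :: rcons c y) [::] [::])) x).
Proof.
move=> Sw Sp Hc lt_v; have Hk := key_wires; have Hs := sk_wires; have Hp := pp_wires.
have Sc := size_word Hc; have Hks := keys_slots.
set M := mem _ _ _ _ _.
have wfM : wf_mem (w0 :: c) [::] [::].
  split => // [[|i]|i] //=; first exact: size_nth_word Hc.
  by rewrite nth_nil size_nseq.
have SM r : size (M r) = len r.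
  by apply: size_mem => //; rewrite size_cat size_nseq Sp.
have RK : RKey v.+1 \in regs by rewrite mem_regs; lia.
have RS : RSig v.+1 \in regs by rewrite mem_regs; lia.
have MK : M (RKey v.+1) = z by rewrite /M /= Sc ltnn.
have MS : M (RSig v.+1) = zF by rewrite /M /= Sc ltnn.
pose M1 := upd M (RKey v.+1) ([::] ++ p ++ nseq (G - pp) false).
apply: (evolves_cat (phi := ket (Lay M1))).
  have := @evolves_copy0 _ _ _ _ _ off_bound off_disjoint f M RIn (RKey v.+1) sk 0 pp
    (nseq sk false) p [::] [::] (nseq (G - pp) false).
  rewrite addn0; apply; rewrite ?mem_regs ?SM ?size_nseq ?cats0 ?MK //=.
  - by move: RK; rewrite mem_regs.
  - by apply/eqP.
  - by rewrite -nseqD; congr nseq; lia.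
have kg_gates : all (gate_wf G) (c_gates kg) by case/andP: kg_wf.
have SM1 : size (M1 (RKey v.+1)) = G by rewrite /M1 /upd eqxx /= size_cat Sp size_nseq;
  lia.
apply: evolves_cat; first exact: (evolves_embed off_bound off_disjoint f kg_gates RK).
have EM1 : M1 (RKey v.+1) = p ++ nseq (c_anc kg) false.
  by rewrite /M1 /upd eqxx /=; congr (_ ++ nseq _ _); lia.
rewrite EM1 -/(run no_oracle kg p).
(* By linearity it is enough to follow one outcome [y] of KeyGen. *)
suff H y : y \in strs G -> evolves (move (off_key P v.+1) (off_sig P v.+1) sk)
    (ket (Lay (upd M1 (RKey v.+1) y)))
    (ket (Lay (mem (inp p) one (w0 :: rcons c y) [::] [::]))).
  apply: evolves_sum => //.
  have Hn : nseq G false \in strs G by rewrite mem_strs size_nseq.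
  by have [] := H _ Hn.
move/size_strs => Sy; set M2 := upd M1 _ _.
have M2K : M2 (RKey v.+1) = y by rewrite /M2 /upd eqxx.
have M2S : M2 (RSig v.+1) = zF by rewrite /M2 /M1 /upd; case: eqP => // _; case: eqP.
apply: (evolves_eq (X := upd (upd M2 (RSig v.+1) ([::] ++ take sk y ++ nseq (F - sk)
  false))
   (RKey v.+1) ([::] ++ nseq sk false ++ drop sk y))).
  move=> r; rewrite {1 2}/upd /M2 /M1 /upd /M.
  case: eqP => [->|ne1] /=; first by rewrite size_rcons Sc ltnSn nth_rcons Sc ltnn eqxx.
  case: eqP => [->|ne2] /=.
    rewrite size_rcons Sc ltnSn nth_rcons Sc ltnn eqxx addn0.
    by have -> : (nodes P <= v.+1 < nodes P)%N = false by lia.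
  case: r ne1 ne2 => [||[|v']|[|v']|j] //= ne1 ne2; rewrite size_rcons Sc !ltnS
    nth_rcons Sc.
    have ne : v' <> v by move=> E; apply: ne1; rewrite E.
    have -> : (v' <= v)%N = (v' < v)%N by lia.
    by case: ltnP.
  have ne : v' <> v by move=> E; apply: ne2; rewrite E.
  have -> : (v' <= v)%N = (v' < v)%N by lia.
  by case: ltnP.
have := @evolves_move _ _ _ _ _ off_bound off_disjoint f M2 (RKey v.+1) (RSig v.+1) 0 0 sk
    [::] (take sk y) (drop sk y) [::] (nseq (F - sk) false).
rewrite !addn0; apply; rewrite ?M2K ?M2S ?size_nseq ?size_takel ?Sy //=; try lia.
- by apply/eqP.
- by rewrite cat_take_drop.
- by rewrite -nseqD; congr nseq; lia.
Qed.

Definition node_msg (c : seq bits) (v : nat) : bits :=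
  pad ms (vk_of c (child P 0 v) ++ vk_of c (child P 1 v)).

Lemma evolves_sign p c d v : size p = pp -> c \in words (keys P) (strs G) ->
  d \in words v (strs F) -> (v < nodes P)%N ->
  evolves (sign_gates P v)
    (ket (Lay (mem (inp p) one c d [::])))
    (fun x => \sum_(y <- strs F)
       run no_oracle sgn (take sk (nth z c v) ++ node_msg c v) y *
       ket (Lay (mem (inp p) one c (rcons d y) [::])) x).
Proof.
move=> Sp Hc Hd lt_v; have Hk := key_wires; have Hs := sk_wires.
have Sd := size_word Hd; have Hks := keys_slots; have Sc := size_word Hc.
set M := mem _ _ _ _ _.
have wfM : wf_mem c d [::].
  by split => // i; [apply: size_nth_word Hc | apply: size_nth_word Hd].
have SM r : size (M r) = len r.
  by apply: size_mem => //; rewrite size_cat size_nseq Sp.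
have RS : RSig v \in regs by rewrite mem_regs; move: Hks; rewrite /keys; lia.
have RK b : RKey (child P b v) \in regs by rewrite mem_regs child_slots.
have Svk b := size_vk_of (child P b v) wfM.
have Su : size (take sk (nth z c v)) = sk.
  by case: wfM => H _ _; rewrite size_takel // H; lia.
set u := take sk _ in Su *.
have MS : M (RSig v) = u ++ nseq (F - sk) false.
  rewrite /M /= Sd ltnn Sc addn0.
  have -> : (v < keys P)%N && ~~ (nodes P <= v < nodes P)%N by rewrite /keys; lia.
  by [].
have MK b := @key_content (inp p) one c d [::] (child P b v) wfM (child_gt0 b v).
pose r1 := (F - (sk + vk))%N; pose r2 := (F - (sk + (vk + vk)))%N.
pose M1 := upd M (RSig v) (u ++ vk_of c (child P 0 v) ++ nseq r1 false).
pose M2 := upd M1 (RSig v)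
  ((u ++ vk_of c (child P 0 v)) ++ vk_of c (child P 1 v) ++ nseq r2 false).
have M2S : M2 (RSig v) = (u ++ node_msg c v) ++ nseq (c_anc sgn) false.
  rewrite /M2 /upd eqxx /node_msg /pad -!catA size_cat !Svk -nseqD.
  by do 3 congr (_ ++ _); congr nseq; rewrite /r2; lia.
apply: (evolves_cat (phi := ket (Lay M1))).
  have := @evolves_copy0 _ _ _ _ _ off_bound off_disjoint f M (RKey (child P 0 v))
    (RSig v)
    sk sk vk _ _ _ u (nseq r1 false) (RK 0%N) RS _ (MK 0%N).
  apply; rewrite ?SM ?size_nseq ?Svk ?MS //; first exact/eqP.
  by congr (_ ++ _); rewrite -nseqD; congr nseq; rewrite /r1; lia.
apply: (evolves_cat (phi := ket (Lay M2))).
  have M1K : M1 (RKey (child P 1 v)) = M (RKey (child P 1 v)).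
    by rewrite /M1 /upd; case: eqP.
  have {}M1K := etrans M1K (MK 1%N).
  have := @evolves_copy0 _ _ _ _ _ off_bound off_disjoint f M1 (RKey (child P 1 v))
    (RSig v)
    sk (sk + vk) vk _ _ _ (u ++ vk_of c (child P 0 v)) (nseq r2 false) (RK 1%N) RS _ M1K.
  apply; rewrite /M1 /upd ?eqxx ?SM ?size_cat ?size_nseq ?Svk ?Su //=; first exact/eqP.
  - by rewrite -catA; do 2 congr (_ ++ _); rewrite -nseqD; congr nseq; rewrite /r1 /r2;
    lia.
  - by case: eqP => // _; exact: (SM (RKey (child P 1 v))).
  - by rewrite /r1; lia.
have sgn_gates : all (gate_wf F) (c_gates sgn) by case/andP: sgn_wf.
have SM2 : size (M2 (RSig v)) = F.
  by rewrite M2S /node_msg /pad !(size_cat, size_nseq) Su !Svk; lia.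
have := evolves_embed off_bound off_disjoint f sgn_gates RS erefl SM2.
rewrite M2S -/(run no_oracle sgn (u ++ node_msg c v)); apply: evolves_ext => // x Hx.
apply: big_seq_cond1 => y /size_strs Sy; congr (_ * ket _ _); apply: eq_lay => r.
rewrite /M2 /M1 /upd; case: eqP => [->|ne] /=.
  by rewrite size_rcons Sd ltnSn nth_rcons Sd ltnn eqxx.
rewrite /M; case: r ne => [||v'|v'|j] //= ne; rewrite size_rcons Sd nth_rcons Sd.
have {}ne : v' <> v by move=> E; apply: ne; rewrite E.
have -> : (v' < v.+1)%N = (v' < v)%N by lia.
by case: ltnP.
Qed.

Definition turn_bits (j m : nat) : bits := [seq turn P j i == 1%N | i <- iota 0 m].

Definition path_step (c d : seq bits) (j i : nat) : bits :=
  vk_of c (child P 0 (path_node P j i)) ++ (vk_of c (child P 1 (path_node P j i)) ++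
  (take sg (nth zF d (path_node P j i)) ++ vk_of c (path_node P j i.+1))).

Definition path_steps (c d : seq bits) (j m : nat) : bits :=
  flatten [seq path_step c d j i | i <- iota 0 m].

Definition share (c d : seq bits) (j : nat) : bits :=
  nseq lm false ++ turn_bits j n ++ path_steps c d j n ++ take sk (nth z c (nodes P + j)).

Lemma size_turn_bits j m : size (turn_bits j m) = m.
Proof. by rewrite size_map size_iota. Qed.

Lemma size_path_step c d blk j i : wf_mem c d blk ->
  size (path_step c d j i) = step_len P.
Proof.
move=> wfM; have [_ Hd _] := wfM.
rewrite !size_cat !(size_vk_of _ wfM) size_takel ?Hd ?sg_wires //.
by rewrite /step_len; lia.
Qed.

Lemma size_path_steps c d blk j m : wf_mem c d blk ->
  size (path_steps c d j m) = (m * step_len P)%N.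
Proof.
move=> wfM; elim: m => // m IH.
rewrite /path_steps -[m.+1]addn1 iotaD map_cat flatten_cat size_cat /= cats0.
by rewrite -/(path_steps _ _ _ _) IH (size_path_step _ _ wfM); lia.
Qed.

Lemma size_share c d blk j : wf_mem c d blk -> size (share c d j) = share_len P.
Proof.
move=> wfM; have Hk := key_wires; have [Hc _ _] := wfM.
rewrite !size_cat size_nseq size_turn_bits (size_path_steps _ _ wfM).
by rewrite size_takel ?Hc /share_len /share_sk; lia.
Qed.

Definition fill (M : memory reg) (j : nat) (w : bits) : memory reg :=
  upd M (RBlk j) (w ++ nseq (share_len P - size w) false).

(** Shares are filled from the left, so every copy goes to wires that are still 0. *)
Lemma evolves_write M j r1 u p v w o1 o2 l :
  r1 \in regs -> (j < k)%N -> r1 != RBlk j ->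
  M r1 = u ++ p ++ v -> size (M r1) = len r1 ->
  size u = o1 -> size p = l -> size w = o2 -> (o2 + l <= share_len P)%N ->
  evolves (copy (off r1 + o1) (off_blk P j + o2) l)
    (ket (Lay (fill M j w))) (ket (Lay (fill M j (w ++ p)))).
Proof.
move=> Hr lt_j ne E1 S1 Su Sp Sw le_l.
apply: (evolves_eq (X := upd (fill M j w) (RBlk j)
    (w ++ p ++ nseq (share_len P - size (w ++ p)) false))).
  by move=> r; rewrite /fill /upd; case: eqP; rewrite // catA.
have Fr : fill M j w r1 = M r1 by rewrite /fill /upd (negbTE ne).
apply: (@evolves_copy0 _ _ _ _ _ off_bound off_disjoint f (fill M j w) r1 (RBlk j)
  o1 o2 l u p v w) => //.
- by rewrite mem_regs.
- by rewrite Fr.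
- rewrite /fill /upd eqxx -nseqD size_cat; congr (_ ++ nseq _ _); lia.
- by rewrite Fr.
- by rewrite /fill /upd eqxx size_cat size_nseq /=; lia.
Qed.

Lemma evolves_turns M j : M ROne = one -> (j < k)%N ->
  evolves (flatten [seq turn_gates P j i | i <- iota 0 n])
    (ket (Lay (fill M j (nseq lm false))))
    (ket (Lay (fill M j (nseq lm false ++ turn_bits j n)))).
Proof.
move=> M1 lt_j; pose psi i := ket (Lay (fill M j (nseq lm false ++ turn_bits j i))).
have -> : ket (Lay (fill M j (nseq lm false))) = psi 0%N by rewrite /psi cats0.
apply: evolves_loop => i lt_i; rewrite /psi.
have -> : turn_bits j i.+1 = turn_bits j i ++ [:: turn P j i == 1%N].
  by rewrite /turn_bits -[i.+1]addn1 iotaD map_cat.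
have lt2 : (turn P j i < 2)%N by rewrite ltn_mod.
rewrite catA; apply: (@evolves_write M j ROne (take (turn P j i) one) [::
  turn P j i == 1%N]
  (drop (turn P j i).+1 one)); rewrite ?mem_regs ?M1 //.
- by apply/eqP.
- by case: (turn P j i) lt2 => [|[|]].
- by case: (turn P j i) lt2 => [|[|]].
- by rewrite size_cat size_nseq size_turn_bits.
- by rewrite /share_len /share_sk; lia.
Qed.

Lemma evolves_steps p c d blk j : size p = pp -> wf_mem c d blk ->
  size d = nodes P -> (j < k)%N -> size blk = j ->
  let M := mem (inp p) one c d blk in
  evolves (flatten [seq step_gates P j i | i <- iota 0 n])
    (ket (Lay (fill M j (nseq lm false ++ turn_bits j n))))
    (ket (Lay (fill M j (nseq lm false ++ turn_bits j n ++ path_steps c d j n)))).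
Proof.
move=> Sp wfM Sd lt_j Sb M; have Hk := key_wires; have Hs := sk_wires;
  have Hks := keys_slots.
pose w0 := nseq lm false ++ turn_bits j n.
have Sw0 : size w0 = (lm + n)%N by rewrite size_cat size_nseq size_turn_bits.
pose psi i := ket (Lay (fill M j (w0 ++ path_steps c d j i))).
have -> : ket (Lay (fill M j w0)) = psi 0%N by rewrite /psi cats0.
rewrite (catA (nseq _ _)); apply: evolves_loop => i lt_i; rewrite /psi.
have -> : path_steps c d j i.+1 = path_steps c d j i ++ path_step c d j i.
  by rewrite /path_steps -[i.+1]addn1 iotaD map_cat flatten_cat /= cats0.
pose w := w0 ++ path_steps c d j i.
have Sw : size w = (lm + n + i * step_len P)%N.
  by rewrite size_cat Sw0 (size_path_steps _ _ wfM).
have lt_n := path_node_nodes lt_j lt_i.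
have SM r : size (M r) = len r.
  by apply: size_mem => //; rewrite size_cat size_nseq Sp.
have Svk v := size_vk_of v wfM.
have MK v (H : (0 < v)%N) := @key_content (inp p) one c d blk v wfM H.
have MS : M (RSig (path_node P j i)) = [::] ++ take sg (nth zF d (path_node P j i)) ++
    drop sg (nth zF d (path_node P j i)).
  by rewrite /= cat_take_drop Sd lt_n.
have Ssg : size (take sg (nth zF d (path_node P j i))) = sg.
  by have [_ Hd _] := wfM; rewrite size_takel // Hd sg_wires.
have RKc b : RKey (child P b (path_node P j i)) \in regs by rewrite mem_regs child_slots.
have RKp : RKey (path_node P j i.+1) \in regs.
  by rewrite mem_regs; apply: leq_trans (path_node_keys lt_j lt_i) (ltnW Hks).
have RS : RSig (path_node P j i) \in regs by rewrite mem_regs; move: Hks;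
  rewrite /keys; lia.
have fits : (lm + n + i * step_len P + step_len P <= share_len P)%N.
  have := mul_block (step_len P) lt_i; rewrite /share_len /share_sk; lia.
rewrite /step_len in fits.
rewrite catA -/w /path_step /step_gates; clearbody w.
set o := (lm + n + i * step_len P)%N in Sw fits *.
set v0 := child P 0 _ in RKc *; set v1 := child P 1 _ in RKc *.
set s0 := path_node P j i in RS MS Ssg *; set v2 := path_node P j i.+1 in RKp *.
set g := take sg (nth zF d s0) in MS Ssg *.
have H0 := @evolves_write M j (RKey v0) _ _ _ w sk o vk (RKc 0%N) lt_j _ (MK v0
  (child_gt0 _ _)) (SM _).
have H1 := @evolves_write M j (RKey v1) _ _ _ (w ++ vk_of c v0) sk (o + vk) vk
  (RKc 1%N) lt_j _ (MK v1 (child_gt0 _ _)) (SM _).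
have H2 := @evolves_write M j (RSig s0) _ _ _ ((w ++ vk_of c v0) ++ vk_of c v1)
  0 (o + vk + vk) sg RS lt_j _ MS (SM _).
have H3 := @evolves_write M j (RKey v2) _ _ _ (((w ++ vk_of c v0) ++ vk_of c v1) ++ g)
  sk (o + vk + vk + sg) vk RKp lt_j _ (MK v2 (path_node_gt0 _ _)) (SM _).
rewrite addn0 in H2.
have Sv0 := Svk v0; have Sv1 := Svk v1; have Sv2 := Svk v2.
rewrite !(catA w) !(catA (w ++ _)) !(catA ((w ++ _) ++ _)).
apply: evolves_cat; first by apply: H0; rewrite ?size_nseq ?Sw //; [apply/eqP | lia].
apply: evolves_cat.
  by apply: H1; rewrite ?size_cat ?size_nseq ?Sw ?Sv0 //; [apply/eqP | lia].
apply: evolves_cat.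
  by apply: H2; rewrite ?size_cat ?size_nseq ?Sw ?Sv0 ?Sv1 ?Ssg //; [apply/eqP | lia].
by apply: H3; rewrite ?size_cat ?size_nseq ?Sw ?Sv0 ?Sv1 ?Sv2 ?Ssg //; [apply/eqP | lia].
Qed.

Lemma evolves_share p c d blk j : size p = pp -> c \in words (keys P) (strs G) ->
  d \in words (nodes P) (strs F) -> (j < k)%N -> blk = [seq share c d i | i <- iota 0
    j] ->
  evolves (share_gates P j) (ket (Lay (mem (inp p) one c d blk)))
    (ket (Lay (mem (inp p) one c d (rcons blk (share c d j))))).
Proof.
move=> Sp Hc Hd lt_j Eb; have Sc := size_word Hc; have Sd := size_word Hd.
have Hs := sk_wires; have Hk := key_wires; have Hks := keys_slots.
have Sb : size blk = j by rewrite Eb size_map size_iota.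
have wf0 : wf_mem c d [::].
  by split => // i; [apply: size_nth_word Hc | apply: size_nth_word Hd].
have wfM : wf_mem c d blk.
  have [H1 H2 _] := wf0; split => // i; rewrite Sb => lt_i.
  by rewrite Eb (nth_map 0%N) ?size_iota // (size_share _ wf0).
set M := mem _ _ _ _ _.
have SM r : size (M r) = len r.
  by apply: size_mem => //; rewrite size_cat size_nseq Sp.
have M0 : M =1 fill M j (nseq lm false).
  move=> r; rewrite /fill /upd; case: eqP => // ->.
  rewrite /M /= Sb ltnn size_nseq -nseqD; congr nseq; rewrite /share_len /share_sk; lia.
rewrite (eq_lay M0) /share_gates.
apply: evolves_cat; first exact: evolves_turns.
apply: evolves_cat; first exact: (evolves_steps Sp wfM).
set w := _ ++ _ ++ _; set u := take sk (nth z c (nodes P + j)).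
have Sw : size w = share_sk P.
  by rewrite !size_cat size_nseq size_turn_bits (size_path_steps _ _ wfM) /share_sk; lia.
have Su : size u = sk by have [H _ _] := wfM; rewrite size_takel // H; lia.
have leaf : (nodes P + j < keys P)%N by rewrite /keys ltn_add2l.
have RS : RSig (nodes P + j) \in regs by rewrite mem_regs; lia.
have RB : RBlk j \in regs by rewrite mem_regs.
have ne : RSig (nodes P + j) != RBlk j by apply/eqP.
have MS : M (RSig (nodes P + j)) = [::] ++ u ++ nseq (F - sk) false.
  rewrite /M /= Sd Sc Sb leaf; have -> : (nodes P + j < nodes P)%N = false by lia.
  by have -> : (nodes P <= nodes P + j < nodes P + j)%N = false by lia.
apply: (evolves_eq (X := upd (upd (fill M j w) (RBlk j) (w ++ u ++ [::]))
    (RSig (nodes P + j)) ([::] ++ nseq sk false ++ nseq (F - sk) false))).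
  move=> r; rewrite /fill /upd; case: eqP => [->|ne1].
    rewrite /= size_rcons Sd Sb; have -> : (nodes P + j < nodes P)%N = false by lia.
    have -> : (nodes P <= nodes P + j < nodes P + j.+1)%N by lia.
    by rewrite andbF -nseqD; congr nseq; lia.
  case: eqP => [->|ne2].
    by rewrite /= size_rcons Sb ltnSn nth_rcons Sb ltnn eqxx cats0 /share /w -!catA.
  rewrite /M; case: r ne1 ne2 => [||v|v|i] //= ne1 ne2; rewrite size_rcons Sb.
    have {}ne1 : v <> (nodes P + j)%N by move=> E; apply: ne1; rewrite E.
    by have -> : (v < nodes P + j.+1)%N = (v < nodes P + j)%N by lia.
  have {}ne2 : i <> j by move=> E; apply: ne2; rewrite E.
  have -> : (i < j.+1)%N = (i < j)%N by lia.
  by rewrite nth_rcons Sb; case: ltnP.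
have FS : fill M j w (RSig (nodes P + j)) = M (RSig (nodes P + j)).
  by rewrite /fill /upd (negbTE ne).
have FB : fill M j w (RBlk j) = w ++ nseq sk false ++ [::].
  by rewrite /fill /upd eqxx Sw cats0 /share_len; congr (_ ++ nseq _ _); lia.
have := @evolves_move _ _ _ _ _ off_bound off_disjoint f (fill M j w) (RSig (nodes P + j))
  (RBlk j) 0 (share_sk P) sk [::] u (nseq (F - sk) false) w [::] RS RB ne.
rewrite addn0; apply; rewrite ?FS //.
by rewrite FB cats0 size_cat size_nseq Sw.
Qed.

Lemma evolves_shares p c d : size p = pp -> c \in words (keys P) (strs G) ->
  d \in words (nodes P) (strs F) ->
  evolves (flatten [seq share_gates P j | j <- iota 0 k])
    (ket (Lay (mem (inp p) one c d [::])))
    (ket (Lay (mem (inp p) one c d [seq share c d j | j <- iota 0 k]))).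
Proof.
move=> Sp Hc Hd.
pose psi j := ket (Lay (mem (inp p) one c d [seq share c d i | i <- iota 0 j])).
apply: (@evolves_loop N f (share_gates P) psi k) => j lt_j; rewrite /psi.
rewrite -[j.+1]addn1 iotaD map_cat cats1; exact: evolves_share.
Qed.

Definition key_amp (p w : bits) : algC := run no_oracle kg p w.

Definition sign_amp (u m y : bits) : algC := run no_oracle sgn (u ++ m) y.

Definition final (p : bits) (c d : seq bits) : memory reg :=
  mem (inp p) one c d [seq share c d j | j <- iota 0 k].

(** The branches are indexed by the complete final strings of all KeyGen runs ([c]) and Sign runs
    ([d]), garbage included; everything after these runs permutes basis states and adds no
    branching. *)
Lemma evolves_first_stage p w0 : size w0 = G -> size p = pp ->
  evolves (c_gates (first_stage P))
    (ket ((take sk w0 ++ p) ++ nseq (N - (sk + pp)) false))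
    (fun x => \sum_(c <- words (keys P).-1 (strs G))
       (\prod_(i < (keys P).-1) key_amp p (nth z c i)) *
       \sum_(d <- words (nodes P) (strs F))
         (\prod_(v < nodes P)
            sign_amp (take sk (nth z (w0 :: c) v)) (node_msg (w0 :: c) v) (nth zF d v)) *
         ket (Lay (final p (w0 :: c) d)) x).
Proof.
move=> Sw Sp; have Hk := key_wires.
have Su : size (take sk w0) = sk by rewrite size_takel ?Sw; lia.
cbv beta iota delta [first_stage c_gates].
apply: evolves_cat; first exact: evolves_input.
apply: evolves_cat; first by apply: evolves_one; rewrite size_cat Su Sp.
apply: evolves_cat; first exact: evolves_root.
have zG : z \in strs G by rewrite mem_strs size_nseq.
have zFF : zF \in strs F by rewrite mem_strs size_nseq.
apply: evolves_cat.
  apply: (@evolves_words _ _ _ _ _ _ _ (strs G) z (fun i => key_gates P i.+1)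
    (fun _ _ y => run no_oracle kg p y)
    (fun c => mem (inp p) one (w0 :: c) [::] [::]) _ zG).
  by move=> i c lt_i Hc; apply: evolves_key.
have Hcons c : c \in words (keys P).-1 (strs G) -> w0 :: c \in words (keys P) (strs G).
  move=> Hc; have -> : keys P = (1 + (keys P).-1)%N by rewrite /keys /nodes; lia.
  rewrite -cat1s; apply: words_cat => //.
  by rewrite mem_words /= mem_strs Sw eqxx.
have Hev c : c \in words (keys P).-1 (strs G) ->
  evolves (flatten [seq sign_gates P i | i <- iota 0 (nodes P)] ++
           flatten [seq share_gates P j | j <- iota 0 k])
    (ket (Lay (mem (inp p) one (w0 :: c) [::] [::])))
    (fun x => \sum_(d <- words (nodes P) (strs F))
         (\prod_(v < nodes P)
            sign_amp (take sk (nth z (w0 :: c) v)) (node_msg (w0 :: c) v) (nth zF d v)) *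
         ket (Lay (final p (w0 :: c) d)) x).
  move=> /Hcons Hc; apply: evolves_cat.
    apply: (@evolves_words _ _ _ _ _ _ _ (strs F) zF (sign_gates P)
      (fun i _ y => sign_amp (take sk (nth z (w0 :: c) i)) (node_msg (w0 :: c) i) y)
      (fun d => mem (inp p) one (w0 :: c) d [::]) _ zFF).
    by move=> i d lt_i Hd; apply: evolves_sign.
  have Hn := nseq_words (nodes P) zFF.
  apply: evolves_sum; first by have [] := evolves_shares Sp Hc Hn.
  by move=> d Hd; apply: evolves_shares.
have Hn := nseq_words (keys P).-1 zG.
apply: evolves_sum; first by have [] := Hev _ Hn.
by move=> c; apply: Hev.
Qed.

End FirstStage.

(** * The amplitude of a configuration *)

Lemma exchange_sum (I J : Type) (r : seq I) (s : seq J) (H : I -> J -> algC) :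
  \sum_(i <- r) \sum_(j <- s) H i j = \sum_(j <- s) \sum_(i <- r) H i j.
Proof. exact: exchange_big. Qed.

Lemma big_strs_prefix (a : nat) (z L : bits) (H : bits -> algC) : (a <= size L)%N ->
  \sum_(U <- strs a) (U ++ z == L)%:R * H U = (drop a L == z)%:R * H (take a L).
Proof.
move=> le_a; have St : size (take a L) = a by rewrite size_takel.
rewrite -(big_strs_delta (fun U => _ * H U) St); apply: big_seq_cond1 => U /size_strs SU.
rewrite -{1}(cat_take_drop a L) eqseq_cat ?St // (eq_sym z).
by case: (U == _); rewrite /= ?mulr1 ?mul0r ?mulr0.
Qed.

Section Amplitude.

Variable P : params.
Local Notation sk := (p_sk P).
Local Notation pp := (p_pp P).
Local Notation vk := (p_vk P).
Local Notation sg := (p_sg P).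
Local Notation ms := (p_ms P).
Local Notation lm := (p_lm P).
Local Notation n := (p_n P).
Local Notation dl := (p_dl P).
Local Notation k := (p_k P).
Local Notation kg := (p_kg P).
Local Notation sgn := (p_sgn P).
Local Notation G := (c_wires kg).
Local Notation F := (c_wires sgn).
Local Notation X := (G - sk)%N.
Local Notation B := (k * share_len P)%N.
Local Notation N := (off_sig P (slots P)).
Local Notation Lay := (layout (regs P) (off P) (len P) N).
Local Notation z := (nseq G false).
Local Notation zF := (nseq F false).
Local Notation zx := (nseq X false).

Hypothesis HP : valid_params P.

Let off_bound := off_bound HP.
Let off_disjoint := off_disjoint HP.

Lemma drop_layout_inj M M' r : drop B (Lay M) = drop B (Lay M') ->
  r \in regs P -> (B <= off P r)%N -> size (M r) = len P r -> size (M' r) = len P r ->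
  M r = M' r.
Proof.
move=> E Hr le_B S S'; apply: (@eq_from_nth _ false); rewrite S ?S' // => i lt_i.
have /(congr1 (fun s => nth false s (off P r - B + i))) := E.
rewrite !nth_drop addnA subnKC // !(nth_layout off_bound off_disjoint) //.
Qed.

Lemma drop_layout_ext M M' :
  (forall r, r \in regs P -> (forall j, r != RBlk j) -> M r = M' r) ->
  drop B (Lay M) = drop B (Lay M').
Proof.
move=> E; apply: (@eq_from_nth _ false) => [|i lt_i];
  first by rewrite !size_drop !size_layout.
rewrite !nth_drop.
have [/hasP[r Hr Hi]|Ho] := boolP (has (inreg (off P) (len P) (B + i)) (regs P));
  last first.
  by rewrite !nth_layout_out.
rewrite !(nth_layout_in off_bound off_disjoint _ Hr) // E // => j; apply/eqP => Ej.
move: Hr Hi; rewrite Ej mem_regs /inreg /= /off_blk => /(mul_block (share_len P)); lia.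
Qed.

Lemma drop_layout_off r : (forall j, r != RBlk j) -> (B <= off P r)%N.
Proof.
case: r => [||v|v|j] H //=; rewrite /off_sig /off_key /off_one /off_in; try lia.
by have := H j; rewrite eqxx.
Qed.

Definition vk_at (xs : seq bits) (v : nat) : bits := take vk (nth zx xs v).

Definition msg (dk : bits) (xs : seq bits) (v : nat) : bits :=
  if (v < nodes P)%N then pad ms (vk_at xs (child P 0 v) ++ vk_at xs (child P 1 v))
  else pad ms dk.

(* Amplitude with which a node that signs [m] ends up with [x] on the wires that
   KeyGen outputs besides the signing key, traced out ones included, and with
   [y] on all wires of Sign. *)
Definition node_amp (p x m y : bits) : algC :=
  \sum_(u <- strs sk) key_amp P p (u ++ x) * sign_amp P u m y.

Definition tuples (xs ys : seq bits) (j i : nat) : bits :=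
  vk_at xs (child P 0 (path_node P j i)) ++ (vk_at xs (child P 1 (path_node P j i)) ++
  (take sg (nth zF ys (path_node P j i)) ++ vk_at xs (path_node P j i.+1))).

Definition path_tuples (xs ys : seq bits) (j : nat) : bits :=
  flatten [seq tuples xs ys j i | i <- iota 0 n].

Definition leaf_query (dk : bits) (xs ys : seq bits) (j : nat) : bits :=
  dk ++ turn_bits P j n ++ path_tuples xs ys j ++ take sg (nth zF ys (nodes P + j)).

(** Node 0 is exempt: what accompanies the root's signing key stays with the challenger and is not
    on the adversary's wires. *)
Definition matches (xs c : seq bits) : bool :=
  [forall v : 'I_(keys P), (0 < v)%N ==> (drop sk (nth z c v) == nth zx xs v)].

(* A configuration [(xs, ys)] lists the classical contents [x] and [y] of all
   nodes.  [rest1] and [rest2 j] are the strings it leaves on the wires that the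
   circuits of A and B_j trace out. *)
Definition rest1 (p : bits) (xs ys : seq bits) : bits :=
  drop B (Lay (final P p [seq nseq sk false ++ x | x <- xs] (take (nodes P) ys))).

Definition rest2 (dk : bits) (xs ys : seq bits) (j : nat) : bits :=
  turn_bits P j n ++ path_tuples xs ys j ++ nth zF ys (nodes P + j) ++ dk ++ [:: true].

Section Config.

Variables (xs ys : seq bits).
Hypothesis Hxs : xs \in words (keys P) (strs X).
Hypothesis Hys : ys \in words (keys P) (strs F).

Let Sx := size_word Hxs.
Let Sy := size_word Hys.

Lemma nodes_keys : (nodes P <= keys P)%N.
Proof. by rewrite /keys leq_addr. Qed.

Lemma take_ys : take (nodes P) ys \in words (nodes P) (strs F).
Proof.
have := Hys; rewrite !mem_words => /andP[/eqP Hs]; rewrite -{1}(cat_take_drop (nodes P)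
  ys).
by rewrite all_cat size_takel ?Hs ?nodes_keys // eqxx => /andP[].
Qed.

Lemma pad_xs : [seq nseq sk false ++ x | x <- xs] \in words (keys P) (strs G).
Proof.
have Hk := key_wires HP; rewrite mem_words size_map Sx eqxx all_map;
  apply/allP => x Hx /=.
have := Hxs; rewrite mem_words => /andP[_ /allP /(_ _ Hx)].
by rewrite /= !mem_strs size_cat size_nseq => /eqP->; rewrite subnKC //; lia.
Qed.

Lemma nth_pad_xs v : drop sk (nth z [seq nseq sk false ++ x | x <- xs] v) = nth zx xs v.
Proof.
have Hk := key_wires HP; have [lt_v|ge_v] := ltnP v (size xs).
  by rewrite (nth_map zx) // drop_size_cat // size_nseq.
by rewrite !nth_default ?size_map // drop_nseq.
Qed.

Lemma wf_words c d : c \in words (keys P) (strs G) -> d \in words (nodes P) (strs F) ->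
  wf_mem P c d [seq share P c d j | j <- iota 0 k].
Proof.
move=> Hc Hd.
have wf0 : wf_mem P c d [::].
  by split => // i; [apply: size_nth_word Hc | apply: size_nth_word Hd].
have [H1 H2 _] := wf0; split => // i; rewrite size_map size_iota => lt_i.
by rewrite (nth_map 0%N) ?size_iota // (size_share HP _ wf0).
Qed.

Lemma size_final p c d r : size p = pp -> c \in words (keys P) (strs G) ->
  d \in words (nodes P) (strs F) -> size (final P p c d r) = len P r.
Proof.
move=> Sp Hc Hd; apply: (size_mem HP) => //; first by rewrite size_cat size_nseq Sp.
exact: wf_words.
Qed.

(** Apart from signing keys, A leaves on traced-out wires all that its KeyGen and Sign runs
    produced. This which-path information forbids interference between configurations. *)
Lemma rest1_eq p c d : size p = pp -> c \in words (keys P) (strs G) ->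
  d \in words (nodes P) (strs F) ->
  (drop B (Lay (final P p c d)) == rest1 p xs ys) = matches xs c && (d == take (nodes
    P) ys).
Proof.
move=> Sp Hc Hd; have Hks := keys_slots HP; have Sc := size_word Hc;
  have Sd := size_word Hd.
have Hx := pad_xs; have Hy := take_ys; have Sx' := size_word Hx; have Sy' := size_word Hy.
apply/eqP/andP => [E|[/forallP Hm /eqP Ed]].
  have inj r : r \in regs P -> (forall j, r != RBlk j) ->
      final P p c d r = final P p [seq nseq sk false ++ x | x <- xs] (take (nodes P)
        ys) r.
    move=> Hr Hj; apply: (drop_layout_inj E Hr (drop_layout_off Hj)); exact: size_final.
  split.
    apply/forallP => v; apply/implyP => v_gt0; have lt_v := ltn_ord v.
    have Hr : RKey v \in regs P by rewrite mem_regs; apply: ltn_trans Hks.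
    have Hne j : RKey v != RBlk j by apply/eqP.
    have /eqP := inj _ Hr Hne; rewrite /final /= v_gt0 Sc lt_v Sx' lt_v /=.
    by rewrite eqseq_cat // eqxx nth_pad_xs.
  apply/eqP; apply: (@eq_from_nth _ zF); rewrite Sd ?Sy' // => v lt_v.
  have lt_s : (v < slots P)%N by apply: ltn_trans Hks; apply: leq_trans nodes_keys.
  have Hr : RSig v \in regs P by rewrite mem_regs.
  have Hne j : RSig v != RBlk j by apply/eqP.
  by have := inj _ Hr Hne; rewrite /final /= Sd lt_v Sy' lt_v.
apply: drop_layout_ext => r Hr Hj; rewrite Ed; case: r Hr Hj => [||v|v|j] //= Hr Hj.
- rewrite Sc Sx'; case: ifP => // /andP[v_gt0 lt_v].
  have /implyP/(_ v_gt0)/eqP /= -> := Hm (Ordinal lt_v).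
  by rewrite nth_pad_xs.
- rewrite Sy' Sc Sx' !size_map !size_iota; case: ifP => // ge_v.
  case: ifP => // /andP[]; rewrite /keys; lia.
- by have := Hj j; rewrite eqxx.
Qed.

Lemma block_share p c d j : size p = pp -> c \in words (keys P) (strs G) ->
  d \in words (nodes P) (strs F) -> (j < k)%N ->
  take (share_len P) (drop (j * share_len P) (take B (Lay (final P p c d)))) = share P
    c d j.
Proof.
move=> Sp Hc Hd lt_j; have le_j := mul_block (share_len P) lt_j.
have Hr : RBlk j \in regs P by rewrite mem_regs.
have H1 := off_bound Hr; rewrite /= /off_blk in H1.
have E : final P p c d (RBlk j) = share P c d j.
  by rewrite /final /= size_map size_iota lt_j (nth_map 0%N) ?size_iota // nth_iota.
have Ss : size (share P c d j) = share_len P by rewrite -E size_final.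
have le_B : (B <= N)%N by rewrite /off_sig /off_one /off_in; lia.
apply: (@eq_from_nth _ false) => [|i].
  by rewrite size_takel ?Ss // size_drop size_takel ?size_layout //; lia.
rewrite size_takel; last by rewrite size_drop size_takel ?size_layout //; lia.
move=> lt_i; rewrite nth_take // nth_drop nth_take; last lia.
have := nth_layout off_bound off_disjoint (final P p c d) Hr lt_i.
by rewrite E.
Qed.

Lemma vk_of_at c v : c \in words (keys P) (strs G) ->
  drop sk (nth z c 0) = nth zx xs 0 -> matches xs c -> vk_of P c v = vk_at xs v.
Proof.
move=> Hc H0 /forallP Hm; have Sc := size_word Hc; rewrite /vk_of /vk_at; congr take.
have [lt_v|ge_v] := ltnP v (keys P); last first.
  by rewrite !nth_default ?Sx ?Sc // drop_nseq.
case: v lt_v => // v lt_v.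
by have /eqP := Hm (Ordinal lt_v).
Qed.

End Config.

Lemma first_stage_wires : c_wires (first_stage P) = N.
Proof.
rewrite /c_wires /=; rewrite subnKC //.
by rewrite /off_sig /off_one /off_in; lia.
Qed.

Lemma first_stage_wf : circuit_wf (first_stage P).
Proof.
rewrite /circuit_wf first_stage_wires; apply/andP; split.
  by rewrite /= /off_sig /off_one /off_in; lia.
have [] // := evolves_first_stage HP no_oracle (w0 := z) (p := nseq pp false);
  by rewrite size_nseq.
Qed.

Variables (f : oracle) (p dk m : bits).
Hypothesis Sp : size p = pp.
Hypothesis Sdk : size dk = dl.
Hypothesis Sm : size m = lm.

Definition block (U : bits) (j : nat) : bits :=
  take (share_len P) (drop (j * share_len P) U).

(* Here [x] is the part of the root key that is not the signing key, and [zA] and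
   [zB] are the contents of the wires traced out by A and by the B_j. *)
Definition game_amp (x : bits) (zA : bits) (zB : seq bits) : algC :=
  \sum_(U <- strs B)
    (\sum_(u <- strs sk) key_amp P p (u ++ x) * run f (first_stage P) (u ++ p) (U ++
      zA)) *
    \prod_(j < k) run f (second_stage P) (block U j ++ dk) (m ++ nth [::] zB j).

Lemma run_first_stage u x U zA : size u = sk -> size x = X -> size U = B ->
  size zA = (N - B)%N ->
  run f (first_stage P) (u ++ p) (U ++ zA) =
    \sum_(c <- words (keys P).-1 (strs G))
      (\prod_(i < (keys P).-1) key_amp P p (nth z c i)) *
      \sum_(d <- words (nodes P) (strs F))
        (\prod_(v < nodes P) sign_amp P (take sk (nth z ((u ++ x) :: c) v))
            (node_msg P ((u ++ x) :: c) v) (nth zF d v)) *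
        (U ++ zA == Lay (final P p ((u ++ x) :: c) d))%:R.
Proof.
move=> Su Sx SU SA; have Hk := key_wires HP.
have Sw : size (u ++ x) = G by rewrite size_cat Su Sx; lia.
have [_ E] := evolves_first_stage HP f Sw Sp.
rewrite /run -[c_anc _]/(N - (sk + pp))%N.
have /E : size (U ++ zA) = N.
  by rewrite size_cat SU SA subnKC // /off_sig /off_one /off_in; lia.
by rewrite -{1}Su take_size_cat.
Qed.

(** Fixing the traced-out strings leaves only the signing keys to be summed over. Each enters a
    single node, so the sum of products is a product of [node_amp]; the factors of the leaves come
    from the second-stage circuits. *)
Lemma game_amp_good xs ys :
  xs \in words (keys P) (strs X) -> ys \in words (keys P) (strs F) ->
  (forall j, (j < k)%N -> f (leaf_query dk xs ys j) = true :: m) ->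
  game_amp (nth zx xs 0) (rest1 p xs ys) (mkseq (rest2 dk xs ys) k)
    = \prod_(v < keys P) node_amp p (nth zx xs v) (msg dk xs v) (nth zF ys v).
Proof.
move=> Hxs Hys Hf; have Hk := key_wires HP.
have Sx := size_word Hxs; have Sy := size_word Hys.
have Sx0 : size (nth zx xs 0) = X := size_nth_word 0 Hxs.
have keysE : keys P = (keys P).-1.+1 by rewrite /keys /nodes.
have leN : (B <= N)%N by rewrite /off_sig /off_one /off_in; lia.
have SA : size (rest1 p xs ys) = (N - B)%N by rewrite size_drop size_layout.
have Hcons u c : size u = sk -> c \in words (keys P).-1 (strs G) ->
    (u ++ nth zx xs 0) :: c \in words (keys P) (strs G).
  move=> Su Hc; rewrite keysE -add1n -cat1s; apply: words_cat => //.
  by rewrite mem_words /= mem_strs size_cat Su Sx0 subnKC ?eqxx //; lia.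
(* The contribution of node [v]: the indicator keeps only the keys [w] that extend the prescribed
   [x], which allows summing over whole keys and factorising. *)
pose h v w := (drop sk w == nth zx xs v)%:R *
  (key_amp P p w * sign_amp P (take sk w) (msg dk xs v) (nth zF ys v)) : algC.
transitivity (\sum_(c <- words (keys P) (strs G)) \prod_(v < keys P) h v (nth z c v));
  last first.
  rewrite (big_words_prod _ _ z h); apply: eq_bigr => v _; rewrite /node_amp /h.
  have EG : G = (sk + X)%N by lia.
  rewrite {1}EG big_words_cat; apply: big_seq_cond1 => u /size_strs Su.
  have Sxv : size (nth zx xs v) = X := size_nth_word v Hxs.
  rewrite -(big_strs_delta (fun x => key_amp P p (u ++ x) * sign_amp P u _ _) Sxv).
  apply: eq_bigr => x _; rewrite -Su drop_size_cat // take_size_cat //; ring.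
rewrite /game_amp; under eq_bigr do rewrite big_distrl /=.
rewrite exchange_sum.
have splitG (H : bits -> algC) : \sum_(w <- strs G) H w
    = \sum_(u <- strs sk) \sum_(x <- strs X) H (u ++ x).
  by rewrite -(big_words_cat _ sk X) subnKC //; lia.
have splitC (H : seq bits -> algC) : \sum_(c <- words (keys P) (strs G)) H c
    = \sum_(w <- strs G) \sum_(c <- words (keys P).-1 (strs G)) H (w :: c).
  by case: (keys P) keysE => // q _; rewrite big_words_cons.
rewrite splitC splitG.
apply: big_seq_cond1 => u /size_strs Su; set w0 := u ++ nth zx xs 0.
(* The factor of node 0 forces the remainder of the root key to be the one fixed in [game_amp]. *)
have -> : \sum_(v <- strs X) \sum_(w <- words (keys P).-1 (strs G))
      \prod_(i < keys P) h i (nth z ((u ++ v) :: w) i)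
    = \sum_(w <- words (keys P).-1 (strs G)) \prod_(i < keys P) h i (nth z (w0 :: w) i).
  rewrite -(big_strs_delta (fun x => \sum_(w <- _) \prod_(i < _) h i (nth z ((u ++ x)
    :: w) i)) Sx0).
  apply: big_seq_cond1 => x Hx; have [_|ne] := eqVneq x; first by rewrite mulr1.
  rewrite mulr0 big1 // => w _; have H0 : (0 < keys P)%N by rewrite keysE.
  rewrite (bigD1 (Ordinal H0)) //= /h drop_size_cat // (negbTE ne) !mul0r //.
transitivity (\sum_(U <- strs B) \sum_(c <- words (keys P).-1 (strs G))
   \sum_(d <- words (nodes P) (strs F))
    (key_amp P p w0 * (\prod_(i < (keys P).-1) key_amp P p (nth z c i)) *
     (\prod_(v < nodes P) sign_amp P (take sk (nth z (w0 :: c) v))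
            (node_msg P (w0 :: c) v) (nth zF d v))) *
    ((U ++ rest1 p xs ys == Lay (final P p (w0 :: c) d))%:R *
    \prod_(j < k) run f (second_stage P) (block U j ++ dk)
       (m ++ nth [::] (mkseq (rest2 dk xs ys) k) j))).
  apply: big_seq_cond1 => U /size_strs SU.
  rewrite (run_first_stage Su Sx0 SU SA) -/w0 big_distrr big_distrl /=.
  apply: eq_bigr => c _; rewrite big_distrr big_distrr big_distrl /=.
  by apply: eq_bigr => d _; ring.
rewrite exchange_sum; apply: big_seq_cond1 => c Hc.
have HC := Hcons u c Su Hc; rewrite -/w0 in HC.
rewrite exchange_sum.
(* Summing over [U] leaves the share part of the layout and the condition that the traced-out wires
   agree, which [rest1_eq] splits into conditions on [c] and on [d]. *)
transitivity (\sum_(d <- words (nodes P) (strs F)) (matches xs (w0 :: c))%:R *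
   (\prod_(v < keys P) (key_amp P p (nth z (w0 :: c) v) *
     sign_amp P (take sk (nth z (w0 :: c) v)) (msg dk xs v) (nth zF ys v))) *
   (d == take (nodes P) ys)%:R).
  apply: big_seq_cond1 => d Hd; have Sd := size_word Hd.
  rewrite -big_distrr /= big_strs_prefix ?size_layout //.
  rewrite (rest1_eq Hxs Hys Sp HC Hd) -mulnb natrM.
  have [Hm|_] := boolP (matches _ _); last by rewrite !mul0r mulr0.
  have [Ed|_] := eqVneq; last by rewrite !mulr0 mul0r mulr0.
  rewrite !mul1r mulr1 [X in _ = X]big_split /=.
  have -> : \prod_(v < keys P) key_amp P p (nth z (w0 :: c) v)
      = key_amp P p w0 * \prod_(i < (keys P).-1) key_amp P p (nth z c i).
    by case: (keys P) keysE => // q _; rewrite big_ord_recl.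
  have H0 : drop sk (nth z (w0 :: c) 0) = nth zx xs 0 by rewrite drop_size_cat.
  have Hvk v : vk_of P (w0 :: c) v = vk_at xs v by apply: vk_of_at.
  rewrite -mulrA; congr (_ * _).
  have split_keys (H : nat -> algC) : \prod_(v < keys P) H v
      = \prod_(v < nodes P) H v * \prod_(j < k) H (nodes P + j)%N.
    by rewrite /keys big_split_ord.
  rewrite (split_keys (fun v =>
    sign_amp P (take sk (nth z (w0 :: c) v)) (msg dk xs v) (nth zF ys v))).
  congr (_ * _).
    apply: eq_bigr => v _; rewrite /node_msg /msg ltn_ord !Hvk Ed nth_take //.
  apply: eq_bigr => j _; have lt_j := ltn_ord j.
  have -> : block (take B (Lay (final P p (w0 :: c) d))) j = share P (w0 :: c) d j.
    by apply: block_share; eassumption.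
  rewrite nth_mkseq // /share -!catA /rest2.
  have Esteps : path_steps P (w0 :: c) d j n = path_tuples xs ys j.
    rewrite /path_steps /path_tuples; congr flatten.
    apply/eq_in_map => i; rewrite mem_iota /= => lt_i.
    rewrite /path_step /tuples !Hvk Ed nth_take //; exact: path_node_nodes.
  have wfC : wf_mem P (w0 :: c) d [seq share P (w0 :: c) d j | j <- iota 0 k].
    by apply: wf_words; eassumption.
  have ST := size_path_steps HP j n wfC; rewrite Esteps in ST.
  have Su' : size (take sk (nth z (w0 :: c) (nodes P + j))) = sk.
    by rewrite size_takel // (size_nth_word _ HC); lia.
  have Sy' : size (nth zF ys (nodes P + j)) = F := size_nth_word _ Hys.
  rewrite Esteps (run_second_stage HP (size_turn_bits _ _ _) ST Su' Sdk Sm Sy' (Hf j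
    lt_j)).
  by rewrite /sign_amp /msg ltnNge leq_addr.
have Uy : uniq (words (nodes P) (strs F)) by apply/uniq_words/uniq_strs.
rewrite (big_seq_delta (fun _ => _ * _) Uy (take_ys Hys)).
have [/forallP Hm|] := boolP (matches _ _).
  rewrite mul1r; apply: eq_bigr => v _; rewrite /h.
  suff -> : drop sk (nth z (w0 :: c) v) = nth zx xs v by rewrite eqxx mul1r.
  case: (posnP v) => [->|v_gt0]; first by rewrite drop_size_cat.
  by have := Hm v; rewrite v_gt0 => /eqP.
rewrite negb_forall => /existsP[v]; rewrite negb_imply => /andP[_ /negbTE Hv].
by rewrite mul0r (bigD1 v) //= /h Hv !mul0r.
Qed.

End Amplitude.

(** * The winning probability *)

(** Composition of channels in Kraus form: when [g] and [b] are the conjugates of [f] and [a], the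
    right-hand side is a sum of squared moduli, one for each pair of traced-out contents. *)
Lemma sum_sandwich (T I Z : Type) (s : seq T) (ri : seq I) (rz : seq Z)
    (f g : I -> T -> algC) (a b : Z -> T -> algC) :
  \sum_(u <- s) \sum_(v <- s)
    (\sum_(i <- ri) f i u * g i v) * (\sum_(z <- rz) a z u * b z v)
  = \sum_(i <- ri) \sum_(z <- rz)
      (\sum_(u <- s) f i u * a z u) * (\sum_(v <- s) g i v * b z v).
Proof.
transitivity (\sum_(u <- s) \sum_(i <- ri) \sum_(z <- rz) \sum_(v <- s)
    (f i u * a z u) * (g i v * b z v)).
  apply: eq_bigr => u _; under [RHS]eq_bigr do rewrite exchange_sum.
  rewrite [RHS]exchange_sum; apply: eq_bigr => v _.
  rewrite big_distrl /=; apply: eq_bigr => i _; rewrite big_distrr /=.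
  by apply: eq_bigr => z _; ring.
rewrite exchange_sum; apply: eq_bigr => i _; rewrite exchange_sum; apply: eq_bigr => z _.
rewrite big_distrl /=; apply: eq_bigr => u _; rewrite big_distrr /=.
by apply: eq_bigr.
Qed.

Lemma channel_sum f C x y u v : channel f C x y u v
  = \sum_(z <- strs (c_wires C - c_out C)) run f C u (x ++ z) * (run f C v (y ++ z))^*.
Proof. exact: (big_tuple_strs _ (fun z => run f C u (x ++ z) * (run f C v (y ++
  z))^*)). Qed.

Lemma apply_sum f C rho x y : apply f C rho x y
  = \sum_(u <- strs (c_in C)) \sum_(v <- strs (c_in C)) channel f C x y u v * rho u v.
Proof.
rewrite -(big_tuple_strs _ (fun u => \sum_(v <- _) channel f C x y u v * rho u v)).
apply: eq_bigr => u _.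
exact: (big_tuple_strs _ (fun v => channel f C x y u v * rho u v)).
Qed.

Lemma apply_ketbra f C p x y : size p = c_in C ->
  apply f C (ketbra p) x y = channel f C x y p p.
Proof.
move=> Sp; rewrite apply_sum -(big_strs_delta (fun u => channel f C x y u p) (esym
  (esym Sp))).
apply: eq_bigr => u _; rewrite -(big_strs_delta (fun v => channel f C x y u v) Sp)
  big_distrl /=.
by apply: eq_bigr => v _; rewrite /ketbra /ket; ring.
Qed.

Lemma apply_tensor_ketbra f C a p op x y : c_in C = (a + size p)%N ->
  apply f C (tensor a op (ketbra p)) x y
    = \sum_(u <- strs a) \sum_(v <- strs a) channel f C x y (u ++ p) (v ++ p) * op u v.
Proof.
move=> Ein; rewrite apply_sum Ein !big_words_cat; apply: big_seq_cond1 => u /size_strs Su.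
rewrite -(big_strs_delta (fun u2 => \sum_(v <- strs a) channel f C x y (u ++ u2) (v ++
  p) * op u v) erefl).
apply: big_seq_cond1 => u2 _; rewrite big_words_cat big_distrl /=.
apply: big_seq_cond1 => v /size_strs Sv.
rewrite -(big_strs_delta (fun v2 => channel f C x y (u ++ u2) (v ++ v2) * op u v)
  (erefl (size p))).
rewrite big_distrl /=; apply: eq_bigr => v2 _.
rewrite /tensor /ketbra /ket !take_size_cat // !drop_size_cat //; ring.
Qed.

Lemma nth_reshape_const k l (U : bits) j : (j < k)%N -> size U = (k * l)%N ->
  nth [::] (reshape (mkseq (fun=> l) k) U) j = take l (drop (j * l) U).
Proof.
have -> : mkseq (fun=> l) k = nseq k l.
  apply: (@eq_from_nth _ 0%N); rewrite size_mkseq ?size_nseq // => i lt_i.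
  by rewrite nth_mkseq // nth_nseq lt_i.
elim: k U j => // k IH U [|j] lt_j SU /=; first by rewrite mul0n drop0.
rewrite IH //; last by rewrite size_drop SU mulSn addKn.
by rewrite drop_drop mulSn addnC.
Qed.

Section WinProb.

Variable P : params.
Local Notation sk := (p_sk P).
Local Notation pp := (p_pp P).
Local Notation vk := (p_vk P).
Local Notation lm := (p_lm P).
Local Notation dl := (p_dl P).
Local Notation k := (p_k P).
Local Notation kg := (p_kg P).
Local Notation G := (c_wires kg).
Local Notation B := (k * share_len P)%N.
Local Notation N := (off_sig P (slots P)).
Local Notation WB := (c_wires (second_stage P) - lm)%N.

Hypothesis HP : valid_params P.

Variables (f : oracle) (p dk m : bits).
Hypothesis Sp : size p = pp.

(** The garbage [g] of KeyGen, [zA] of A and [zB] of the second stage add up incoherently; [t]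
    stands for the renormalisation after measuring the root's verification key [x]. *)
Lemma win_prob_sum (op : op) (t : algC) x :
  (forall u v, op u v = t * \sum_(g <- strs (G - (sk + vk)))
     key_amp P p ((u ++ x) ++ g) * (key_amp P p ((v ++ x) ++ g))^*) ->
  win_prob k (fun=> share_len P) (fun=> second_stage P) f
    (apply f (first_stage P) (tensor sk op (ketbra p))) dk m
  = t * \sum_(g <- strs (G - (sk + vk))) \sum_(zA <- strs (N - B))
        \sum_(zB <- words k (strs WB)) `|game_amp P f p dk m (x ++ g) zA zB| ^+ 2.
Proof.
move=> Hop; pose rg := strs (G - (sk + vk)); pose rA := strs (N - B).
pose Psi i U := \sum_(u <- strs sk) key_amp P p ((u ++ x) ++ i.1) *
   run f (first_stage P) (u ++ p) (U ++ i.2) : algC.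
pose rI := [seq (g, zA) | g <- rg, zA <- rA].
have EI (H : bits * bits -> algC) : \sum_(i <- rI) H i = \sum_(g <- rg) \sum_(zA <- rA)
  H (g, zA).
  by rewrite /rI big_flatten big_map; apply: eq_bigr => g _; rewrite big_map.
have Erho U V : apply f (first_stage P) (tensor sk op (ketbra p)) U V
    = t * \sum_(i <- rI) Psi i U * (Psi i V)^*.
  rewrite apply_tensor_ketbra /= ?Sp // EI.
  transitivity (t * \sum_(u <- strs sk) \sum_(v <- strs sk)
     (\sum_(g <- rg) key_amp P p ((u ++ x) ++ g) * (key_amp P p ((v ++ x) ++ g))^*) *
     (\sum_(zA <- rA) run f (first_stage P) (u ++ p) (U ++ zA) * (run f (first_stage P)
       (v ++ p) (V ++ zA))^*)).
    rewrite big_distrr; apply: eq_bigr => u _; rewrite /= big_distrr;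
      apply: eq_bigr => v _ /=.
    rewrite channel_sum Hop /rA -(first_stage_wires P); ring.
  rewrite (sum_sandwich (strs sk) rg rA (fun g u => key_amp P p ((u ++ x) ++ g))
    (fun g v => (key_amp P p ((v ++ x) ++ g))^*)
    (fun zA u => run f (first_stage P) (u ++ p) (U ++ zA))
    (fun zA v => (run f (first_stage P) (v ++ p) (V ++ zA))^*)).
  congr (_ * _); apply: eq_bigr => g _; apply: eq_bigr => zA _; congr (_ * _).
  by rewrite rmorph_sum; apply: eq_bigr => v _; rewrite rmorphM.
have SN : (\sum_(j < k) share_len P = B)%N by rewrite sum_nat_const card_ord.
pose beta zB U := \prod_(j < k) run f (second_stage P) (block P U j ++ dk) (m ++ nth
  [::] zB j).
transitivity (t * \sum_(U <- strs B) \sum_(V <- strs B) (\sum_(i <- rI) Psi i U * (Psi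
  i V)^*) *
   (\sum_(zB <- words k (strs WB)) beta zB U * (beta zB V)^*)).
  rewrite /win_prob SN.
  transitivity (\sum_(U <- strs B) \sum_(V <- strs B) apply f (first_stage P) (tensor
    sk op (ketbra p)) U V *
    \prod_(j < k) channel f (second_stage P) m m (block P U j ++ dk) (block P V j ++ dk)).
    rewrite -big_tuple_strs; apply: eq_bigr => U _; rewrite -big_tuple_strs;
      apply: eq_bigr => V _.
    congr (_ * _); apply: eq_bigr => j _.
    by rewrite !nth_reshape_const ?size_tuple.
  rewrite big_distrr; apply: eq_bigr => U _; rewrite /= big_distrr;
    apply: eq_bigr => V _ /=.
  rewrite Erho mulrA; congr (_ * _).
  under eq_bigr do rewrite channel_sum.
  rewrite -(big_words_prod _ _ [::] (fun j z => run f (second_stage P) (block P U j ++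
    dk) (m ++ z) *
     (run f (second_stage P) (block P V j ++ dk) (m ++ z))^*)).
  apply: eq_bigr => zB _; rewrite big_split /=; congr (_ * _).
  by rewrite rmorph_prod.
rewrite (sum_sandwich (strs B) rI (words k (strs WB)) Psi (fun i V => (Psi i V)^*)
   beta (fun zB V => (beta zB V)^*)) EI.
congr (_ * _); apply: eq_bigr => g _; apply: eq_bigr => zA _; apply: eq_bigr => zB _.
have -> : game_amp P f p dk m (x ++ g) zA zB = \sum_(U <- strs B) Psi (g,
  zA) U * beta zB U.
  apply: eq_bigr => U _; congr (_ * _); apply: eq_bigr => u _.
  by rewrite /= catA.
rewrite normCK rmorph_sum; congr (_ * _); apply: eq_bigr => U _; by rewrite rmorphM.
Qed.

End WinProb.

(** * Good configurations win the game *)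

(** Ancestors of leaves lie in columns below [width], so the reduction modulo [width] does nothing
    there and the child formula reads off the binary expansion of [j.+1]. *)
Lemma path_child P j i : (j < p_k P)%N -> (i < p_n P)%N ->
  path_node P j i.+1 = child P (turn P j i) (path_node P j i).
Proof.
move=> lt_j lt_i; rewrite /child /path_node /turn.
set d := (p_n P - i.+1)%N; have -> : (p_n P - i = d.+1)%N by rewrite /d; lia.
have lt_a := path_col d lt_j; have lt_b := path_col d.+1 lt_j.
rewrite divnMDl ?ltn0Sn // (divn_small lt_b) addn0 [(width P * _)%N]mulnC;
  congr (_ + _)%N.
rewrite mulnDr mulnA -addnA modnMDl expnSr divnMA mulnC -divn_eq.
by rewrite modn_small.
Qed.

Definition attack_params (S : osmac) (n l_m k : nat -> nat) (lam : nat) : params :=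
  Params (l_sk S lam) (l_pp S lam) (l_vk S lam) (l_sig S lam) (l_msg S lam)
    (l_m lam) (n lam) (n lam + lam) (k lam) (keygen_circuit S lam) (sign_circuit S lam).

Lemma attack_params_valid S n l_m k lam :
  large_messages S n -> valid_params (attack_params S n l_m k lam).
Proof.
move=> /(_ lam)[Hvk Hdk]; split => //; rewrite {Hvk Hdk} /=.
all: by case: S => /= ? ? ? ? ? ? ? ? ? ? _ _ _ [[wf _] Hi Ho] [[wf' _] Hi' Ho'] _.
Qed.

Lemma big_pairs (I J : Type) (r : seq I) (s : seq J) (H : I -> J -> algC) :
  \sum_(i <- r) \sum_(j <- s) H i j
    = \sum_(q <- [seq (i, j) | i <- r, j <- s]) H q.1 q.2.
Proof. by rewrite big_flatten big_map; apply: eq_bigr => i _; rewrite big_map. Qed.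

(** Injectivity is what allows distinct configurations to be counted as distinct terms of the sum
    over traced-out strings; the remaining terms are dropped. *)
Lemma le_sum_inj (I J : eqType) (r : seq I) (s : seq J) (h : I -> J) (H : J -> algC) :
  uniq r -> {in r &, injective h} -> (forall i, i \in r -> h i \in s) ->
  (forall j, 0 <= H j) -> \sum_(i <- r) H (h i) <= \sum_(j <- s) H j.
Proof.
move=> Ur inj Hs H0; rewrite -(big_map h xpredT).
have Um : uniq (map h r) by rewrite map_inj_in_uniq.
have sub : {subset map h r <= s} by move=> _ /mapP[i Hi ->]; apply: Hs.
elim: (map h r) s Um sub {Hs} => [|j t IH] s; first by move=> *; rewrite big_nil sumr_ge0.
move=> /= /andP[Hj Ut] sub; have Hjs : j \in s by apply: sub; rewrite mem_head.
rewrite big_cons (perm_big _ (perm_to_rem Hjs)) big_cons /= lerD2l.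
apply: IH => // i Hi; have := sub i; rewrite inE Hi orbT => /(_ isT).
rewrite (perm_mem (perm_to_rem Hjs)) inE => /orP[/eqP E|//].
by rewrite -E Hi in Hj.
Qed.

Arguments words : simpl never.

Section Chain.

Variables (S : osmac) (n l_m k : nat -> nat) (lam : nat).
Hypothesis S_large : large_messages S n.
Local Notation P := (attack_params S n l_m k lam).
Let HP := attack_params_valid l_m k lam S_large.

Local Notation sk := (l_sk S lam).
Local Notation vk := (l_vk S lam).
Local Notation sg := (l_sig S lam).
Local Notation G := (c_wires (keygen_circuit S lam)).
Local Notation F := (c_wires (sign_circuit S lam)).
Local Notation X := (G - sk)%N.
Local Notation zF := (nseq F false).
Local Notation zx := (nseq X false).
Local Notation K := (keys P).

Section Sizes.

Variables (xs ys : seq bits).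
Hypothesis Hxs : xs \in words K (strs X).

Lemma size_vk_at v : size (vk_at P xs v) = vk.
Proof.
rewrite /vk_at /= size_takel // (size_nth_word _ Hxs).
by have /= := key_wires HP; lia.
Qed.

Hypothesis Hys : ys \in words K (strs F).

Lemma size_sig_at v : size (take sg (nth zF ys v)) = sg.
Proof. by rewrite size_takel // (size_nth_word _ Hys); exact: (sg_wires HP). Qed.

Lemma size_tuples j i : size (tuples P xs ys j i) = step_len P.
Proof.
rewrite /tuples !size_cat !size_vk_at (size_sig_at _) /step_len /=; lia.
Qed.

Lemma size_path_tuples j : size (path_tuples P xs ys j) = (n lam * step_len P)%N.
Proof.
rewrite /path_tuples size_flatten /shape -map_comp.
rewrite (eq_map (size_tuples j)) /=; elim: (n lam) {1}0%N => //= l IH i.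
by rewrite IH mulSn.
Qed.

End Sizes.

Variables (pp mvk dk m : bits).
Hypothesis Sp : size pp = l_pp S lam.
Hypothesis Sdk : size dk = (n lam + lam)%N.
Hypothesis Sm : size m = l_m lam.
Hypothesis lt_k : (k lam < 2 ^ n lam)%N.

Definition good (xs ys : seq bits) : bool :=
  [forall v : 'I_K, vrfy S lam pp mvk (vk_at P xs v) (msg P dk xs v) (take sg (nth zF
    ys v))].

Section Config.

Variables (xs ys : seq bits).
Hypothesis Hxs : xs \in words K (strs X).
Hypothesis Hys : ys \in words K (strs F).

Lemma chain_valid_good j : good xs ys -> (j < k lam)%N ->
  forall l i, (i + l)%N = n lam ->
  chain_valid S lam pp mvk dk [seq turn P j t == 1%N | t <- iota i l]
    (vk_at P xs (path_node P j i))
    (flatten [seq tuples P xs ys j t | t <- iota i l]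
      ++ take sg (nth zF ys (nodes P + j))).
Proof.
move=> /forallP Hg lt_j; elim=> [|l IH] i Ei.
  rewrite addn0 in Ei; rewrite Ei [path_node _ _ _](path_node_leaf HP) /=.
  have lt_v : (nodes P + j < K)%N by rewrite /keys ltn_add2l.
  by have := Hg (Ordinal lt_v); rewrite /msg /= ltnNge leq_addr.
have lt_i : (i < n lam)%N by lia.
have lt_v : (path_node P j i < nodes P)%N by apply: path_node_nodes.
have lt_w : (path_node P j i < K)%N by apply: path_node_keys => //; apply: ltnW.
rewrite /= {1 2 3}/tuples -!catA.
have S0 := size_vk_at Hxs (child P 0 (path_node P j i)).
have S1 := size_vk_at Hxs (child P 1 (path_node P j i)).
have S2 := size_sig_at Hys (path_node P j i).
have S3 := size_vk_at Hxs (path_node P j i.+1).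
rewrite !(take_size_cat, drop_size_cat) //.
apply/and3P; split; last by apply: IH; lia.
  by have := Hg (Ordinal lt_w); rewrite /msg /= lt_v.
rewrite (path_child (P := P)) //; have : (turn P j i < 2)%N by rewrite ltn_mod.
by case: (turn P j i) => [|[|]].
Qed.

Lemma oracle_good j : good xs ys -> (j < k lam)%N ->
  ute_oracle S n l_m lam pp mvk dk m (vk_at P xs 0) (leaf_query P dk xs ys j) = true :: m.
Proof.
move=> Hg lt_j; rewrite /ute_oracle /leaf_query.
have St := size_turn_bits P j (n lam).
have Sq := size_path_tuples Hxs Hys j; have Ss := size_sig_at Hys (nodes P + j).
rewrite !(take_size_cat, drop_size_cat) // eqxx /=.
have -> : size (dk ++ turn_bits P j (n lam) ++ path_tuples P xs ys j ++
    take sg (nth zF ys (nodes P + j))) == l_query S n lam.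
  by rewrite !size_cat Sdk St Sq Ss /l_query /step_len /=; apply/eqP; lia.
have := chain_valid_good Hg lt_j (add0n (n lam)).
(* The path starts at the root because [j.+1 <= k < 2 ^ n]: only here does the depth have to exceed
   the logarithm of [k]. *)
have -> : path_node P j 0 = 0%N; last by move=> /= ->.
rewrite /path_node subn0 mul0n divn_small //=.
exact: leq_ltn_trans lt_j lt_k.
Qed.

End Config.

(** [rest1] shows all keys but the root's and the Sign wires of the inner nodes; [rest2 j] shows
    those of the leaf of party [j]; the remainder of the root key is given. *)
Lemma final_inj xs ys xs' ys' :
  xs \in words K (strs X) -> ys \in words K (strs F) ->
  xs' \in words K (strs X) -> ys' \in words K (strs F) ->
  nth zx xs 0 = nth zx xs' 0 -> rest1 P pp xs ys = rest1 P pp xs' ys' ->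
  (forall j, (j < k lam)%N -> rest2 P dk xs ys j = rest2 P dk xs' ys' j) ->
  xs = xs' /\ ys = ys'.
Proof.
move=> Hxs Hys Hxs' Hys' E0 E1 E2.
have Sx := size_word Hxs; have Sx' := size_word Hxs'.
have Sy := size_word Hys; have Sy' := size_word Hys'.
have := @rest1_eq P HP xs ys Hxs Hys pp _ _ Sp (pad_xs HP Hxs' Hys') (take_ys Hys').
rewrite -/(rest1 P pp xs' ys') -E1 eqxx => /esym/andP[/forallP Hm /eqP Ed].
have Ex : xs = xs'.
  apply: (@eq_from_nth _ zx); rewrite Sx ?Sx' // => v lt_v.
  case: (posnP v) => [->//|v_gt0].
  by have := Hm (Ordinal lt_v); rewrite /= v_gt0 (nth_pad_xs HP) => /eqP.
split=> //; apply: (@eq_from_nth _ zF); rewrite Sy ?Sy' // => v lt_v.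
have [lt_n|ge_n] := ltnP v (nodes P).
  by rewrite -(nth_take _ lt_n) -Ed nth_take.
have lt_j : (v - nodes P < k lam)%N by move: lt_v; rewrite /keys /=; lia.
have Ev : v = (nodes P + (v - nodes P))%N by rewrite subnKC.
have /eqP := E2 _ lt_j; rewrite /rest2 -Ev eqseq_cat // eqxx /=.
rewrite eqseq_cat ?(size_path_tuples Hxs Hys) ?(size_path_tuples Hxs' Hys') //.
rewrite eqseq_cat ?(size_nth_word _ Hys) ?(size_nth_word _ Hys') //.
by move=> /and3P[_ /eqP].
Qed.

Lemma game_lower_bound :
  \sum_(xs <- words K (strs X)) \sum_(ys <- words K (strs F)) (good xs ys)%:R *
    \prod_(v < K) `|node_amp P pp (nth zx xs v) (msg P dk xs v) (nth zF ys v)| ^+ 2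
  <= \sum_(x <- strs vk) \sum_(g <- strs (G - (sk + vk)))
     \sum_(zA <- strs (off_sig P (slots P) - k lam * share_len P))
     \sum_(zB <- words (k lam) (strs (c_wires (second_stage P) - l_m lam)))
       `|game_amp P (ute_oracle S n l_m lam pp mvk dk m x) pp dk m (x ++ g) zA zB| ^+ 2.
Proof.
have HK := key_wires HP; rewrite /= in HK.
pose rA := strs (off_sig P (slots P) - k lam * share_len P).
pose rB := words (k lam) (strs (c_wires (second_stage P) - l_m lam)).
(* [w] is the remainder [x ++ g] of the root key; its first [vk] bits are the verification key built
   into the oracle. *)
pose H w q := `|game_amp P (ute_oracle S n l_m lam pp mvk dk m (take vk w)) pp dk m w
  q.1 q.2| ^+ 2.
have -> : \sum_(x <- strs vk) \sum_(g <- strs (G - (sk + vk))) \sum_(zA <- rA)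
     \sum_(zB <- rB)
       `|game_amp P (ute_oracle S n l_m lam pp mvk dk m x) pp dk m (x ++ g) zA zB| ^+ 2
  = \sum_(w <- strs X) \sum_(q <- [seq (zA, zB) | zA <- rA, zB <- rB]) H w q.
  have -> : X = (vk + (G - (sk + vk)))%N by lia.
  rewrite big_words_cat; apply: big_seq_cond1 => x /size_strs Sx; apply: eq_bigr => g _.
  rewrite big_pairs; apply: eq_bigr => q _; by rewrite /H take_size_cat.
rewrite !big_pairs.
set pairs := [seq (i, j) | i <- words K (strs X), j <- words K (strs F)].
pose h (q : seq bits * seq bits) :=
  (nth zx q.1 0, (rest1 P pp q.1 q.2, mkseq (rest2 P dk q.1 q.2) (k lam))).
have Hpairs q : q \in pairs -> q.1 \in words K (strs X) /\ q.2 \in words K (strs F).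
  by move=> /allpairsP[[a b] /= [Ha Hb ->]].
have -> : \sum_(q <- pairs) (good q.1 q.2)%:R *
      \prod_(v < K) `|node_amp P pp (nth zx q.1 v) (msg P dk q.1 v) (nth zF q.2 v)| ^+ 2
    = \sum_(q <- [seq q <- pairs | good q.1 q.2]) H (h q).1 (h q).2.
  rewrite big_filter [RHS]big_mkcond; apply: big_seq_cond1 => q /Hpairs[Hxs Hys].
  case: ifP => Hg; last by rewrite mul0r.
  rewrite mul1r /H /h /= (game_amp_good HP Sp Sdk Sm Hxs Hys); last first.
    by move=> j lt_j; apply: oracle_good.
  by rewrite normr_prod prodrXl.
apply: (le_sum_inj (H := fun q => H q.1 q.2)).
- apply: filter_uniq; apply: allpairs_uniq; try by apply/uniq_words/uniq_strs.
  by move=> [a b] [a' b'] _ _ [-> ->].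
- move=> [xs ys] [xs' ys']; rewrite !mem_filter => /andP[_ /Hpairs[/= Hxs Hys]].
  move=> /andP[_ /Hpairs[/= Hxs' Hys']] [E0 E1 E2].
  have [|-> ->] // := final_inj Hxs Hys Hxs' Hys' E0 E1.
  move=> j lt_j; have /(congr1 (fun s => nth [::] s j)) := E2.
  by rewrite !nth_mkseq.
- move=> [xs ys]; rewrite mem_filter => /andP[_ /Hpairs[/= Hxs Hys]].
  apply/allpairsP; exists (h (xs, ys)); split => //=.
    by rewrite mem_strs (size_nth_word _ Hxs).
  apply/allpairsP; exists (h (xs, ys)).2; split => //=.
    by rewrite mem_strs /rest1 size_drop size_layout.
  rewrite mem_words size_mkseq eqxx all_map; apply/allP => j; rewrite mem_iota /= => lt_j.
  rewrite mem_strs /rest2 !size_cat (size_turn_bits P) (size_path_tuples Hxs Hys).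
  rewrite (size_nth_word _ Hys) Sdk (second_stage_wires HP) /share_sk /=; apply/eqP; lia.
- by move=> q; rewrite exprn_ge0.
Qed.

End Chain.

(** * The honest experiment of a single node *)

Lemma expect_bind (T U : Type) (d : dist T) (h : T -> dist U) F :
  expect (bind d h) F = expect d (fun x => expect (h x) F).
Proof.
rewrite /expect /bind big_flatten big_map; apply: eq_bigr => q _.
by rewrite big_map big_distrr; apply: eq_bigr => r _ /=; rewrite mulrA.
Qed.

Lemma expect_ret (T : Type) (x : T) F : expect (ret x) F = F x.
Proof. by rewrite /expect big_seq1 mul1r. Qed.

Lemma expect_measure l rho F :
  expect (measure l rho) F = \sum_(x <- strs l) rho x x * F x.
Proof.
rewrite /expect /measure big_map big_enum.
exact: (big_tuple_strs _ (fun x => rho x x * F x)).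
Qed.

Lemma le_expect_uniform l (A : {set l.-tuple bool}) F c : A != set0 ->
  (forall x, size x = l -> c <= F x) -> c <= expect (uniform A) F.
Proof.
move=> A0 Hc; rewrite /expect /uniform big_map -big_distrr /= big_enum /=.
have A_gt0 : (0 < #|A|)%N by rewrite card_gt0.
rewrite mulrC ler_pdivlMr ?ltr0n // mulr_natr -sumr_const.
by apply: ler_sum => x _; apply: Hc; rewrite size_tuple.
Qed.

Fixpoint best (T : Type) (F : T -> algC) (x : T) (s : seq T) : T :=
  if s is y :: s' then let z := best F x s' in if F y <= F z then z else y else x.

Lemma best_in (T : eqType) F (x : T) s : best F x s \in x :: s.
Proof.
elim: s => [|y s IH] /=; first by rewrite mem_head.
by case: ifP => _; move: IH; rewrite !inE ?eqxx ?orbT // => /orP[]->; rewrite ?orbT.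
Qed.

(** The order of [algC] is only partial; real values are comparable, and this is what a maximum
    needs. *)
Lemma best_max (T : eqType) F (x : T) s :
  (forall y, F y \is Num.real) -> {in x :: s, forall y, F y <= F (best F x s)}.
Proof.
move=> HF; elim: s => [|y s IH] w /=; first by rewrite inE => /eqP->.
rewrite !inE => Hw; have [le_y|] := boolP (F y <= _); last first.
  rewrite -real_ltNge // => /ltW lt_y; case/or3P: Hw => [/eqP->|/eqP-> //|Hw].
    by apply: le_trans lt_y; apply: IH; rewrite mem_head.
  by apply: le_trans lt_y; apply: IH; rewrite inE Hw orbT.
case/or3P: Hw => [/eqP->|/eqP-> //|Hw]; first by apply: IH; rewrite mem_head.
by apply: IH; rewrite inE Hw orbT.
Qed.

Lemma le_sum_seq (T : eqType) (s : seq T) (F H : T -> algC) :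
  {in s, forall x, F x <= H x} -> \sum_(x <- s) F x <= \sum_(x <- s) H x.
Proof. by move=> le_FH; rewrite big_seq [leRHS]big_seq; apply: ler_sum. Qed.

Section Honest.

Variables (S : osmac) (n l_m k : nat -> nat) (lam : nat).
Hypothesis S_large : large_messages S n.
Local Notation P := (attack_params S n l_m k lam).
Let HP := attack_params_valid l_m k lam S_large.

Local Notation sk := (l_sk S lam).
Local Notation vk := (l_vk S lam).
Local Notation sg := (l_sig S lam).
Local Notation ms := (l_msg S lam).
Local Notation G := (c_wires (keygen_circuit S lam)).
Local Notation F := (c_wires (sign_circuit S lam)).
Local Notation X := (G - sk)%N.
Local Notation zF := (nseq F false).
Local Notation zx := (nseq X false).
Local Notation K := (keys P).

(* [measure_last] renormalises by the probability of the outcome, which cancels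
   against its weight, except for outcomes of probability 0, where the inverse
   is the junk value 0. *)
Lemma keygen_expect (p : bits) (W : op * bits -> algC) (R : bits -> algC) :
  size p = l_pp S lam ->
  (forall op t x, (forall u v, op u v = t * \sum_(g <- strs (G - (sk + vk)))
     key_amp P p ((u ++ x) ++ g) * (key_amp P p ((v ++ x) ++ g))^*) ->
     W (op, x) = t * R x) ->
  (forall x, (forall u g, u \in strs sk -> g \in strs (G - (sk + vk)) ->
     key_amp P p ((u ++ x) ++ g) = 0) -> R x = 0) ->
  expect (keygen S lam p) W = \sum_(x <- strs vk) R x.
Proof.
move=> Sp HW HR; rewrite /keygen /measure_last /expect big_map big_enum /=.
rewrite -(big_tuple_strs _ R); apply: eq_bigr => x _.
have Hin : size p = c_in (keygen_circuit S lam) by rewrite (v_kg_in HP).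
have Hrho a b : apply no_oracle (keygen_circuit S lam) (ketbra p) a b
    = \sum_(g <- strs (G - (sk + vk))) key_amp P p (a ++ g) * (key_amp P p (b ++ g))^*.
  by rewrite apply_ketbra // channel_sum (v_kg_out HP).
set q := \sum_(u : sk.-tuple bool) _.
have Eq : q = \sum_(u <- strs sk) \sum_(g <- strs (G - (sk + vk))) `|key_amp P p ((u ++
  x) ++ g)| ^+ 2.
  rewrite /q -(big_tuple_strs _ (fun u => \sum_(g <- _) `|key_amp P p ((u ++ x) ++ g)|
    ^+ 2)).
  apply: eq_bigr => u _; rewrite Hrho; apply: eq_bigr => g _; by rewrite normCK.
rewrite (HW _ q^-1 x) => [|u v]; last by rewrite Hrho.
have [q0|q0] := eqVneq q 0; last by rewrite mulrA divff ?mul1r.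
rewrite q0 mul0r HR // => u g Hu Hg; apply/eqP.
have nn u' : 0 <= \sum_(g <- strs (G - (sk + vk))) `|key_amp P p ((u' ++ x) ++ g)| ^+ 2.
  by apply: sumr_ge0 => g' _; rewrite exprn_ge0.
have := q0; rewrite Eq => /eqP; rewrite (big_rem u) //= paddr_eq0 ?nn //; last first.
  by apply: sumr_ge0 => u' _; exact: nn.
move=> /andP[]; rewrite (big_rem g) //= paddr_eq0 ?exprn_ge0 //; last first.
  by apply: sumr_ge0 => g' _; rewrite exprn_ge0.
by move=> /andP[]; rewrite expf_eq0 /= normr_eq0.
Qed.

(** The probability that an honest node signing [mu] ends with [x] beside its signing key and [y] on
    the wires of Sign, garbage included. *)
Definition mass (p x mu y : bits) : algC := `|node_amp P p x mu y| ^+ 2.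

Lemma mass_ge0 p x mu y : 0 <= mass p x mu y.
Proof. by rewrite exprn_ge0. Qed.

Definition key_mass (p x : bits) : algC := \sum_(u <- strs sk) `|key_amp P p (u ++ x)|
  ^+ 2.

(** Sign is unitary before wires are traced out, so summing over [y] gives the norm of the state it
    acts on. Hence the law of [x], and of the verification key in it, does not depend on the message
    signed. *)
Lemma sum_mass p x mu : size mu = ms -> \sum_(y <- strs F) mass p x mu y = key_mass p x.
Proof.
move=> Smu; have HF := sign_wires HP; rewrite /= in HF.
have gates : all (gate_wf F) (c_gates (sign_circuit S lam)) by case/andP: (v_sgn_wf HP).
pose m0 := mu ++ nseq (c_anc (sign_circuit S lam)) false.
have Sm0 : size m0 = (F - sk)%N by rewrite size_cat size_nseq Smu; lia.
pose psi : vec := fun y => \sum_(u <- strs sk) key_amp P p (u ++ x) * ket (u ++ m0) y.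
transitivity (norm2 F (foldl (apply_gate no_oracle) psi (c_gates (sign_circuit S lam)))).
  apply: big_seq_cond1 => y /size_strs Sy; rewrite (apply_gates_sum _ _ _ _ gates) //.
  by rewrite /mass /node_amp /sign_amp /run; under eq_bigr do rewrite -catA.
rewrite norm2_gates // /norm2.
have EF : F = (sk + (F - sk))%N by lia.
rewrite EF big_words_cat; apply: big_seq_cond1 => u /size_strs Su.
have psiE y2 : psi (u ++ y2) = key_amp P p (u ++ x) * (y2 == m0)%:R.
  rewrite -(big_strs_delta (fun u' => key_amp P p (u' ++ x) * (y2 == m0)%:R) Su).
  apply: big_seq_cond1 => u' /size_strs Su'.
  rewrite /ket eqseq_cat ?Su ?Su' // (eq_sym u') -mulnb natrM; ring.
rewrite -(big_strs_delta (fun=> `|key_amp P p (u ++ x)| ^+ 2) Sm0).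
apply: eq_bigr => y2 _; rewrite psiE; case: (y2 == m0); rewrite ?mulr1 // !mulr0.
by rewrite normr0 expr0n.
Qed.

Lemma sum_key_mass p : size p = l_pp S lam -> \sum_(x <- strs X) key_mass p x = 1.
Proof.
move=> Sp; have HK := key_wires HP; have Hpp := pp_wires HP; rewrite /= in HK Hpp.
have gates : all (gate_wf G) (c_gates (keygen_circuit S lam)) by case/andP: (v_kg_wf HP).
rewrite exchange_sum -(big_words_cat _ sk X (fun w => `|key_amp P p w| ^+ 2)).
rewrite subnKC; last by lia.
rewrite -[LHS]/(norm2 G _) norm2_gates // norm2_ket // size_cat size_nseq Sp /=; lia.
Qed.

Lemma sign_expect p x mu op t (H : bits -> bool) : size mu = ms ->
  (forall u v, op u v = t * \sum_(g <- strs (G - (sk + vk)))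
     key_amp P p ((u ++ x) ++ g) * (key_amp P p ((v ++ x) ++ g))^*) ->
  expect (sign S lam op mu) (fun s => (H s)%:R)
    = t * \sum_(g <- strs (G - (sk + vk))) \sum_(y <- strs F)
        mass p (x ++ g) mu y * (H (take sg y))%:R.
Proof.
move=> Smu Hop; rewrite /sign expect_measure.
have Hsg := sg_wires HP; rewrite /= in Hsg.
have Hin : c_in (sign_circuit S lam) = (sk + size mu)%N by rewrite (v_sgn_in HP) Smu.
transitivity (\sum_(s <- strs sg) t * \sum_(g <- strs (G - (sk + vk)))
   \sum_(z <- strs (F - sg)) mass p (x ++ g) mu (s ++ z) * (H s)%:R).
  apply: eq_bigr => s _; rewrite (apply_tensor_ketbra _ _ _ _ Hin).
  transitivity (t * (\sum_(u <- strs sk) \sum_(v <- strs sk)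
     (\sum_(g <- strs (G - (sk + vk))) key_amp P p ((u ++ x) ++ g) * (key_amp P p ((v
       ++ x) ++ g))^*) *
     (\sum_(z <- strs (F - sg)) run no_oracle (sign_circuit S lam) (u ++ mu) (s ++ z) *
        (run no_oracle (sign_circuit S lam) (v ++ mu) (s ++ z))^*)) * (H s)%:R).
    congr (_ * _); rewrite big_distrr; apply: eq_bigr => u _; rewrite /= big_distrr.
    apply: eq_bigr => v _ /=; rewrite channel_sum Hop (v_sgn_out HP) /=; ring.
  rewrite (sum_sandwich (strs sk) _ _ (fun g u => key_amp P p ((u ++ x) ++ g))
    (fun g v => (key_amp P p ((v ++ x) ++ g))^*)
    (fun z u => run no_oracle (sign_circuit S lam) (u ++ mu) (s ++ z))
    (fun z v => (run no_oracle (sign_circuit S lam) (v ++ mu) (s ++ z))^*)).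
  rewrite -mulrA; congr (_ * _); rewrite big_distrl; apply: eq_bigr => g _;
    rewrite /= big_distrl.
  apply: eq_bigr => z _ /=; congr (_ * _); rewrite /mass.
  have -> : node_amp P p (x ++ g) mu (s ++ z) = \sum_(u <- strs sk)
      key_amp P p ((u ++ x) ++ g) * run no_oracle (sign_circuit S lam) (u ++ mu) (s ++ z).
    by apply: eq_bigr => u _; rewrite catA.
  by rewrite normCK rmorph_sum; congr (_ * _); apply: eq_bigr => v _; rewrite rmorphM.
rewrite -big_distrr; congr (_ * _) => /=; rewrite exchange_sum; apply: eq_bigr => g _.
have EF : F = (sg + (F - sg))%N by lia.
rewrite [in RHS]EF big_words_cat; apply: big_seq_cond1 => s /size_strs Ss.
by apply: eq_bigr => z _; rewrite take_size_cat.
Qed.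

End Honest.

(** * The union bound *)

Lemma prod_split_at (R : comNzRingType) (H : nat -> R) v r :
  \prod_(w < v + r.+1) H w = (\prod_(w < v) H w) * H v * \prod_(j < r) H (v + j.+1)%N.
Proof.
by rewrite big_split_ord big_ord_recl /= addn0 mulrA.
Qed.

Lemma big_words_split_at (R : comNzRingType) (T : Type) (s : seq T) v r (H : seq T -> R) :
  \sum_(w <- words (v + r.+1) s) H w
    = \sum_(a <- words v s) \sum_(b <- words r s) \sum_(x <- s) H (a ++ x :: b).
Proof.
rewrite big_words_cat; apply: eq_bigr => a _.
by rewrite big_words_cons exchange_big.
Qed.

Lemma nth_cat_at (T : Type) (x0 : T) a x b w : w != size a ->
  nth x0 (a ++ x :: b) w = nth x0 (a ++ x0 :: b) w.
Proof.
move=> ne; rewrite !nth_cat; case: ltnP => // le_w.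
by have -> : (w - size a = (w - size a).-1.+1)%N by lia.
Qed.

(** Children are numbered above their parents; hence no node signs its own key. *)
Lemma child_gt P b v : (v < child P b v)%N.
Proof.
rewrite /child; apply: leq_trans (leq_addr _ _).
by rewrite mulnC ltn_ceil.
Qed.

Section Union.

Variables (S : osmac) (n l_m k : nat -> nat) (lam : nat).
Hypothesis S_large : large_messages S n.
Local Notation P := (attack_params S n l_m k lam).
Let HP := attack_params_valid l_m k lam S_large.

Local Notation sk := (l_sk S lam).
Local Notation vk := (l_vk S lam).
Local Notation sg := (l_sig S lam).
Local Notation ms := (l_msg S lam).
Local Notation G := (c_wires (keygen_circuit S lam)).
Local Notation F := (c_wires (sign_circuit S lam)).
Local Notation X := (G - sk)%N.
Local Notation zF := (nseq F false).
Local Notation zx := (nseq X false).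
Local Notation K := (keys P).
Local Notation mass := (mass S n l_m k lam).
Local Notation key_mass := (key_mass S n l_m k lam).

Variables (p dk : bits).
Hypothesis Sp : size p = l_pp S lam.
Hypothesis Sdk : size dk = (n lam + lam)%N.

Definition bad (mvk x mu y : bits) : bool := ~~ vrfy S lam p mvk (take vk x) mu (take
  sg y).

Definition fail_at (mvk x mu : bits) : algC :=
  \sum_(y <- strs F) mass p x mu y * (bad mvk x mu y)%:R.

Definition fail (mvk mu : bits) : algC := \sum_(x <- strs X) fail_at mvk x mu.

Definition good_mass (mvk : bits) : algC :=
  \sum_(xs <- words K (strs X)) \sum_(ys <- words K (strs F))
    (good S n l_m k lam p mvk dk xs ys)%:R *
    \prod_(v < K) mass p (nth zx xs v) (msg P dk xs v) (nth zF ys v).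

Definition bad_mass (mvk : bits) (v : nat) : algC :=
  \sum_(xs <- words K (strs X)) \sum_(ys <- words K (strs F))
    (bad mvk (nth zx xs v) (msg P dk xs v) (nth zF ys v))%:R *
    \prod_(w < K) mass p (nth zx xs w) (msg P dk xs w) (nth zF ys w).

Lemma size_msg xs v : xs \in words K (strs X) -> size (msg P dk xs v) = ms.
Proof.
move=> Hxs; have Hv b := size_vk_at S_large Hxs b; have [H1 H2] := S_large lam.
rewrite /msg /pad; case: ifP => _; rewrite size_cat size_nseq.
  by rewrite size_cat !Hv /=; lia.
by rewrite Sdk /=; lia.
Qed.

(** Messages depend on [xs] only, so the [ys] are summed out first; what remains is a product over
    independent keys. *)
Lemma total_mass : \sum_(xs <- words K (strs X)) \sum_(ys <- words K (strs F))
    \prod_(v < K) mass p (nth zx xs v) (msg P dk xs v) (nth zF ys v) = 1.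
Proof.
transitivity (\sum_(xs <- words K (strs X)) \prod_(v < K) key_mass p (nth zx xs v)).
  apply: big_seq_cond1 => xs Hxs.
  rewrite (big_words_prod _ _ zF (fun v y => mass p (nth zx xs v) (msg P dk xs v) y)).
  by apply: eq_bigr => v _; rewrite sum_mass // size_msg.
rewrite (big_words_prod _ _ zx (fun _ x => key_mass p x)).
by rewrite big1 // => v _; exact: sum_key_mass.
Qed.

Lemma prod_mass_ge0 xs ys :
  0 <= \prod_(w < K) mass p (nth zx xs w) (msg P dk xs w) (nth zF ys w).
Proof. by apply: prodr_ge0 => w _; exact: mass_ge0. Qed.

(** For each configuration, 1 minus the number of bad nodes is at most the indicator of [good];
    weighting with the total mass 1 gives the claim. *)
Lemma union_bound mvk : 1 - \sum_(v < K) bad_mass mvk v <= good_mass mvk.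
Proof.
rewrite -total_mass.
have -> : \sum_(v < K) bad_mass mvk v = \sum_(xs <- words K (strs X)) \sum_(ys <- words
  K (strs F))
   (\sum_(v < K) (bad mvk (nth zx xs v) (msg P dk xs v) (nth zF ys v))%:R) *
    \prod_(w < K) mass p (nth zx xs w) (msg P dk xs w) (nth zF ys w).
  rewrite exchange_big; apply: eq_bigr => xs _; rewrite exchange_big;
    apply: eq_bigr => ys _.
  by rewrite big_distrl.
rewrite -sumrB; apply: ler_sum => xs _; rewrite -sumrB; apply: ler_sum => ys _.
rewrite -[X in X - _]mul1r -mulrBl; apply: ler_wpM2r; first exact: prod_mass_ge0.
rewrite lerBlDr; have [_|] := boolP (good _ _ _ _ _ _ _ _ _ _).
  by rewrite lerDl; apply: sumr_ge0 => v _; rewrite ler0n.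
rewrite negb_forall => /existsP[v Hv]; rewrite add0r (bigD1 v) //= /bad Hv lerDl.
by apply: sumr_ge0 => w _; rewrite ler0n.
Qed.

Definition weight (a : seq bits) : algC := \prod_(x <- a) key_mass p x.

Lemma key_mass_ge0 x : 0 <= key_mass p x.
Proof. by apply: sumr_ge0 => u _; rewrite exprn_ge0. Qed.

Lemma weight_ge0 a : 0 <= weight a.
Proof. by apply: prodr_ge0 => x _; exact: key_mass_ge0. Qed.

Lemma weightE a r : size a = r -> weight a = \prod_(i < r) key_mass p (nth zx a i).
Proof. by move=> <-; rewrite /weight (big_nth zx) big_mkord. Qed.

Lemma sum_weight r : \sum_(a <- words r (strs X)) weight a = 1.
Proof.
transitivity (\sum_(a <- words r (strs X)) \prod_(i < r) key_mass p (nth zx a i)).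
  by apply: big_seq_cond1 => a /size_word; exact: weightE.
rewrite (big_words_prod _ _ zx (fun _ x => key_mass p x)).
by rewrite big1 // => v _; exact: sum_key_mass.
Qed.

(* The message of node [v] does not depend on the key of [v], as the children of
   [v] are other nodes: the key of [v] can be summed over last. *)
Lemma bad_massE mvk v : (v < K)%N -> bad_mass mvk v =
  \sum_(a <- words v (strs X)) \sum_(b <- words (K - v.+1) (strs X))
    weight a * weight b * fail mvk (msg P dk (a ++ zx :: b) v).
Proof.
move=> lt_v; rewrite /bad_mass.
pose Q xs w := if w == v then fail_at mvk (nth zx xs v) (msg P dk xs v) else key_mass p
  (nth zx xs w).
transitivity (\sum_(xs <- words K (strs X)) \prod_(w < K) Q xs w).
  apply: big_seq_cond1 => xs Hxs.
  pose q w y := mass p (nth zx xs w) (msg P dk xs w) y *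
    (if w == v then (bad mvk (nth zx xs v) (msg P dk xs v) y)%:R else 1).
  transitivity (\sum_(ys <- words K (strs F)) \prod_(w < K) q w (nth zF ys w)).
    apply: eq_bigr => ys _; rewrite /q [RHS]big_split /= mulrC; congr (_ * _).
    rewrite (bigD1 (Ordinal lt_v)) //= eqxx big1 ?mulr1 // => w.
    by rewrite -val_eqE /= => /negbTE->.
  rewrite (big_words_prod _ _ zF q); apply: eq_bigr => w _; rewrite /q /Q.
  case: eqP => [->|_] //; under eq_bigr do rewrite mulr1.
  by rewrite sum_mass // size_msg.
have EK : K = (v + (K - v.+1).+1)%N by lia.
move: EK; move: (K - v.+1)%N => r EK; rewrite EK big_words_split_at.
apply: big_seq_cond1 => a Ha; have Sa := size_word Ha.
apply: big_seq_cond1 => b Hb; have Sb := size_word Hb.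
rewrite /fail big_distrr; apply: eq_bigr => x _ /=.
rewrite (prod_split_at (Q (a ++ x :: b))) mulrAC; congr (_ * _ * _).
- rewrite (weightE Sa); apply: eq_bigr => w _; rewrite /Q.
  have -> : (w == v :> nat) = false by have := ltn_ord w; lia.
  by rewrite nth_cat Sa ltn_ord.
- rewrite (weightE Sb); apply: eq_bigr => w _; rewrite /Q.
  have -> : (v + w.+1 == v)%N = false by lia.
  rewrite nth_cat Sa; have -> : (v + w.+1 < v)%N = false by lia.
  by have -> : (v + w.+1 - v = w.+1)%N by lia.
rewrite /Q eqxx nth_cat Sa ltnn subnn /=; congr fail_at.
rewrite /msg; case: ifP => // _; rewrite /vk_at !(nth_cat_at _ x) //.
all: by rewrite Sa; have := child_gt P 0 v; have := child_gt P 1 v; lia.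
Qed.

(** The law of the message of node [v] does not involve [mvk]. The average over [mvk] can be moved
    inside, where a bound for each fixed message suffices. *)
Lemma bad_mass_le (s : seq bits) (om : bits -> algC) (M : algC) v : (v < K)%N ->
  (forall mu, size mu = ms -> \sum_(mvk <- s) om mvk * fail mvk mu <= M) ->
  \sum_(mvk <- s) om mvk * bad_mass mvk v <= M.
Proof.
move=> lt_v HM.
have -> : \sum_(mvk <- s) om mvk * bad_mass mvk v =
  \sum_(a <- words v (strs X)) \sum_(b <- words (K - v.+1) (strs X))
    weight a * weight b * \sum_(mvk <- s) om mvk * fail mvk (msg P dk (a ++ zx :: b) v).
  rewrite [RHS](_ : _ = \sum_(mvk <- s) om mvk * \sum_(a <- words v (strs X))
     \sum_(b <- words (K - v.+1) (strs X)) weight a * weight b * fail mvk (msg P dk (a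
       ++ zx :: b) v)).
    by apply: eq_bigr => mvk _; rewrite bad_massE.
  under [RHS]eq_bigr do rewrite big_distrr.
  rewrite [RHS]exchange_big; apply: eq_bigr => a _ /=.
  under [RHS]eq_bigr do rewrite big_distrr.
  rewrite [RHS]exchange_big; apply: eq_bigr => b _ /=.
  by rewrite big_distrr; apply: eq_bigr => mvk _ /=; ring.
have -> : M = \sum_(a <- words v (strs X)) \sum_(b <- words (K - v.+1) (strs X)) weight
  a * weight b * M.
  under eq_bigr do rewrite -big_distrl -big_distrr /= sum_weight mulr1.
  by rewrite -big_distrl /= sum_weight mul1r.
apply: le_sum_seq => a Ha; apply: le_sum_seq => b Hb.
apply: ler_wpM2l; first by rewrite mulr_ge0 ?weight_ge0.
apply: HM; apply: size_msg.
have -> : K = (v + (K - v.+1).+1)%N by lia.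
apply: words_cat => //; rewrite -add1n -cat1s; apply: words_cat => //.
by rewrite mem_words /= mem_strs size_nseq eqxx.
Qed.

End Union.

(** * From correctness to the winning probability *)

Lemma setup_valid S lam : [/\ circuit_wf (setup_circuit S lam),
  c_in (setup_circuit S lam) = 0%N
  & c_out (setup_circuit S lam) = (l_pp S lam + l_mvk S lam)%N].
Proof. by case: S => /= ? ? ? ? ? ? ? ? ? ? _ _ [[wf _] Hi Ho] _ _ _; split. Qed.

Section Game.

Variables (S : osmac) (n l_m k : nat -> nat) (lam : nat).
Hypothesis S_large : large_messages S n.
Local Notation P := (attack_params S n l_m k lam).
Let HP := attack_params_valid l_m k lam S_large.

Local Notation sk := (l_sk S lam).
Local Notation vk := (l_vk S lam).
Local Notation sg := (l_sig S lam).
Local Notation ms := (l_msg S lam).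
Local Notation G := (c_wires (keygen_circuit S lam)).
Local Notation F := (c_wires (sign_circuit S lam)).
Local Notation X := (G - sk)%N.
Local Notation K := (keys P).
Local Notation mass := (mass S n l_m k lam).
Local Notation key_mass := (key_mass S n l_m k lam).
Local Notation fail := (fail S n l_m k lam).
Local Notation good_mass := (good_mass S n l_m k lam).

Definition setup_weight (x : bits) : algC :=
  apply no_oracle (setup_circuit S lam) (ketbra [::]) x x.

Lemma setup_weightE x : setup_weight x =
  \sum_(z <- strs (c_wires (setup_circuit S lam) - (l_pp S lam + l_mvk S lam)))
    `|run no_oracle (setup_circuit S lam) [::] (x ++ z)| ^+ 2.
Proof.
have [_ Hin Hout] := setup_valid S lam.
rewrite /setup_weight apply_ketbra ?Hin // channel_sum Hout.
by apply: eq_bigr => z _; rewrite normCK.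
Qed.

Lemma setup_weight_ge0 x : 0 <= setup_weight x.
Proof. by rewrite setup_weightE; apply: sumr_ge0 => z _; rewrite exprn_ge0. Qed.

Lemma sum_setup_weight : \sum_(p <- strs (l_pp S lam)) \sum_(mvk <- strs (l_mvk S lam))
  setup_weight (p ++ mvk) = 1.
Proof.
have [wf Hin Hout] := setup_valid S lam.
rewrite -big_words_cat; under eq_bigr do rewrite setup_weightE.
have /andP[le_out gates] := wf; rewrite Hout in le_out.
rewrite -(big_words_cat _ _ _ (fun w => `|run no_oracle (setup_circuit S lam) [::] w|
  ^+ 2)).
rewrite subnKC // -[LHS]/(norm2 _ _) norm2_gates // norm2_ket //.
by rewrite size_nseq /c_wires Hin.
Qed.

Lemma expect_setup (Psi : bits * bits -> algC) : expect (setup S lam) Psi =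
  \sum_(p <- strs (l_pp S lam)) \sum_(mvk <- strs (l_mvk S lam))
    setup_weight (p ++ mvk) * Psi (p, mvk).
Proof.
rewrite /setup expect_bind expect_measure big_words_cat.
apply: big_seq_cond1 => p /size_strs Sp; apply: eq_bigr => mvk _.
by rewrite expect_ret take_size_cat // drop_size_cat.
Qed.

Lemma splitX (H : bits -> algC) : \sum_(x <- strs X) H x
  = \sum_(x <- strs vk) \sum_(g <- strs (G - (sk + vk))) H (x ++ g).
Proof.
have HK := key_wires HP; rewrite /= in HK.
by rewrite -big_words_cat; congr (\sum_(x <- strs _) _); lia.
Qed.

(** Deferred measurement: measuring the verification key and later the signature gives the same law
    as reading all wires at the end, which [mass] describes. *)
Lemma honest_prob p mvk mu : size p = l_pp S lam -> size mu = ms ->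
  expect (keygen S lam p) (fun '(sk, vk) => expect (sign S lam sk mu)
     (fun s => (vrfy S lam p mvk vk mu s)%:R)) = 1 - fail p mvk mu.
Proof.
move=> Sp Smu.
pose R x := \sum_(g <- strs (G - (sk + vk))) \sum_(y <- strs F)
  mass p (x ++ g) mu y * (vrfy S lam p mvk x mu (take sg y))%:R.
rewrite (keygen_expect S_large (k := k) (l_m := l_m) (R := R) Sp); first last.
- move=> x H0; rewrite /R big_seq big1 // => g Hg; rewrite big1 // => y _.
  rewrite /mass /node_amp big_seq big1 ?normr0 ?expr0n ?mul0r // => u Hu.
  by rewrite catA H0 ?mul0r.
- move=> op t x Hop; exact: (sign_expect S_large (fun s => vrfy S lam p mvk x mu s) Smu
  Hop).
rewrite -(sum_key_mass l_m k S_large Sp) /fail -sumrB splitX.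
apply: big_seq_cond1 => x /size_strs Sx; apply: eq_bigr => g _.
rewrite /fail_at -(sum_mass l_m k S_large p (x ++ g) Smu) -sumrB.
apply: eq_bigr => y _; rewrite /bad take_size_cat //.
by case: (vrfy _ _ _ _ _ _ _); rewrite /= ?mulr1 ?mulr0 ?subr0 ?subrr.
Qed.

Lemma fail_ge0 p mvk mu : 0 <= fail p mvk mu.
Proof.
apply: sumr_ge0 => x _; apply: sumr_ge0 => y _; apply: mulr_ge0; last by rewrite ler0n.
exact: mass_ge0.
Qed.

Definition weighted_fail (p mu : bits) : algC :=
  \sum_(mvk <- strs (l_mvk S lam)) setup_weight (p ++ mvk) * fail p mvk mu.

Lemma weighted_fail_ge0 p mu : 0 <= weighted_fail p mu.
Proof.
by apply: sumr_ge0 => mvk _; apply: mulr_ge0; [exact: setup_weight_ge0 | exact: fail_ge0].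
Qed.

(* The message of a node depends on pp but not on mvk, and so does the message
   that is the worst one for pp on average over mvk. *)
Definition worst_msg (p : bits) : bits :=
  best (weighted_fail p) (nseq ms false) (strs ms).

Lemma size_worst_msg p : size (worst_msg p) = ms.
Proof.
have := best_in (weighted_fail p) (nseq ms false) (strs ms).
by rewrite -/(worst_msg p) inE => /predU1P[->|/size_strs //]; rewrite size_nseq.
Qed.

Lemma worst_msg_max p mu : size mu = ms ->
  weighted_fail p mu <= weighted_fail p (worst_msg p).
Proof.
move=> Smu; apply: best_max; last by rewrite inE mem_strs Smu eqxx orbT.
by move=> y; apply: ger0_real; exact: weighted_fail_ge0.
Qed.

(** Correctness is applied to the message function [worst_msg]; this is where messages depending on
    pp are needed. *)
Lemma worst_fail_le (e : algC) :
  (forall m, (forall pp, size (m pp) = ms) ->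
    1 - e <= prob
        (let* (pp, mvk) := setup S lam in
         let* (sk, vk) := keygen S lam pp in
         let* sg := sign S lam sk (m pp) in
         ret (vrfy S lam pp mvk vk (m pp) sg))) ->
  \sum_(p <- strs (l_pp S lam)) weighted_fail p (worst_msg p) <= e.
Proof.
move=> /(_ _ size_worst_msg); rewrite /prob expect_bind expect_setup.
have -> : \sum_(p <- strs (l_pp S lam)) \sum_(mvk <- strs (l_mvk S lam))
    setup_weight (p ++ mvk) * expect
      (let* (sk, vk) := keygen S lam p in
       let* sg := sign S lam sk (worst_msg p) in
       ret (vrfy S lam p mvk vk (worst_msg p) sg)) (fun b => b%:R)
  = 1 - \sum_(p <- strs (l_pp S lam)) weighted_fail p (worst_msg p).
  rewrite -[X in _ = X - _]sum_setup_weight -sumrB; apply: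
    big_seq_cond1 => p /size_strs Sp.
  rewrite -sumrB; apply: eq_bigr => mvk _.
  rewrite expect_bind -[X in _ = X - _]mulr1 -mulrBr; congr (_ * _).
  rewrite -honest_prob ?size_worst_msg //; apply: eq_bigr => -[q [sk' vk']] _ /=.
  congr (_ * _); rewrite expect_bind; apply: eq_bigr => s _ /=; by rewrite expect_ret.
by rewrite lerD2l lerN2.
Qed.

Lemma game_fixed p mvk dk m : size p = l_pp S lam -> size dk = (n lam + lam)%N ->
  size m = l_m lam -> (k lam < 2 ^ n lam)%N ->
  good_mass p dk mvk <= expect (ute_enc S n l_m lam (p, mvk, dk) m) (fun ct =>
     win_prob (k lam) (fun=> share_len P) (fun=> second_stage P) (ct_oracle ct)
       (apply (ct_oracle ct) (first_stage P)
          (tensor sk (ct_q ct) (ketbra (ct_c ct)))) dk m).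
Proof.
move=> Sp Sdk Sm lt_k; apply: le_trans (game_lower_bound S_large mvk Sp Sdk Sm lt_k) _.
rewrite /ute_enc expect_bind.
pose R x := \sum_(g <- strs (G - (sk + vk)))
     \sum_(zA <- strs (off_sig P (slots P) - k lam * share_len P))
     \sum_(zB <- words (k lam) (strs (c_wires (second_stage P) - l_m lam)))
       `|game_amp P (ute_oracle S n l_m lam p mvk dk m x) p dk m (x ++ g) zA zB| ^+ 2.
rewrite (keygen_expect S_large (k := k) (l_m := l_m) (R := R) Sp) //.
- move=> op t x Hop; rewrite expect_ret /=; exact: (@win_prob_sum P _ p _ _ Sp op t x
  Hop).
- move=> x H0; rewrite /R big_seq big1 // => g Hg; rewrite big1 // => zA _;
  rewrite big1 // => zB _.
  rewrite /game_amp big1 ?normr0 ?expr0n // => U _; rewrite big_seq big1 ?mul0r // => u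
    Hu.
  by rewrite catA H0 ?mul0r.
Qed.

(** [dk] and the plaintext are treated pointwise, but pp and mvk are not: correctness controls only
    an average over Setup, so the weights stay until the failures of the [K] nodes have been
    separated. *)
Lemma game_bound (M : forall lam, {set (l_m lam).-tuple bool}) (e : algC) :
  M lam != set0 -> (k lam < 2 ^ n lam)%N ->
  (forall m, (forall pp, size (m pp) = ms) ->
    1 - e <= prob
        (let* (pp, mvk) := setup S lam in
         let* (sk, vk) := keygen S lam pp in
         let* sg := sign S lam sk (m pp) in
         ret (vrfy S lam pp mvk vk (m pp) sg))) ->
  1 - K%:R * e <= unclonable_game (mac_chain S n M) k
    (fun lam _ => share_len (attack_params S n l_m k lam))
    (fun lam => first_stage (attack_params S n l_m k lam))
    (fun lam _ => second_stage (attack_params S n l_m k lam)) lam.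
Proof.
move=> M0 lt_k /worst_fail_le He.
rewrite /unclonable_game expect_bind /= /ute_gen expect_bind.
apply: le_expect_uniform => [|dk Sdk].
  by apply/set0Pn; exists (nseq_tuple _ false); rewrite inE.
rewrite expect_bind expect_setup.
apply: le_trans (_ : \sum_(p <- strs (l_pp S lam)) \sum_(mvk <- strs (l_mvk S lam))
   setup_weight (p ++ mvk) * good_mass p dk mvk <= _); last first.
  apply: le_sum_seq => p /size_strs Sp; apply: ler_sum => mvk _.
  apply: ler_wpM2l; first exact: setup_weight_ge0.
  rewrite expect_ret expect_bind; apply: le_expect_uniform => // m Sm.
  rewrite expect_bind; apply: le_trans (game_fixed mvk Sp Sdk Sm lt_k) _.
  rewrite le_eqVlt; apply/orP; left; apply/eqP; apply: eq_bigr => ct _.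
  by rewrite expect_ret.
apply: le_trans (_ : \sum_(p <- strs (l_pp S lam)) \sum_(mvk <- strs (l_mvk S lam))
   setup_weight (p ++ mvk) * (1 - \sum_(v < K) bad_mass S n l_m k lam p dk mvk v) <=
     _); last first.
  apply: le_sum_seq => p /size_strs Sp; apply: ler_sum => mvk _.
  by apply: ler_wpM2l; [exact: setup_weight_ge0 | exact: union_bound].
have -> : \sum_(p <- strs (l_pp S lam)) \sum_(mvk <- strs (l_mvk S lam))
   setup_weight (p ++ mvk) * (1 - \sum_(v < K) bad_mass S n l_m k lam p dk mvk v)
  = 1 - \sum_(p <- strs (l_pp S lam)) \sum_(v < K) \sum_(mvk <- strs (l_mvk S lam))
      setup_weight (p ++ mvk) * bad_mass S n l_m k lam p dk mvk v.
  rewrite -[X in _ = X - _]sum_setup_weight -sumrB; apply: eq_bigr => p _.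
  rewrite [X in _ = _ - X]exchange_big -sumrB; apply: eq_bigr => mvk _ /=.
  by rewrite mulrBr mulr1 big_distrr.
rewrite lerD2l lerN2; apply: le_trans (_ : \sum_(p <- strs (l_pp S lam))
    K%:R * weighted_fail p (worst_msg p) <= _); last first.
  by rewrite -big_distrr; apply: ler_wpM2l; rewrite ?ler0n.
apply: le_sum_seq => p /size_strs Sp.
rewrite mulr_natl -[X in _ *+ X]card_ord -sumr_const; apply: ler_sum => v _.
apply: (bad_mass_le S_large Sp Sdk) => // mu; exact: worst_msg_max.
Qed.

End Game.

(** * Asymptotics and conclusion *)

Lemma osmac_pt (S : osmac) :
  [/\ pt (l_pp S), pt (l_sk S), pt (l_vk S), pt (l_sig S)
    & pt (keygen_circuit S) /\ pt (sign_circuit S)].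
Proof.
case: S => /= ? ? ? ? ? ? ? ? ? ? [Hpp _ Hsk] [Hvk _ Hsg] _ [[_ Hk] _ _] [[_ Hs] _ _] _.
by split; [exact: (@polytime_pt nat_enc) Hpp | exact: (@polytime_pt nat_enc) Hsk
  | exact: (@polytime_pt nat_enc) Hvk | exact: (@polytime_pt nat_enc) Hsg
  | split; [exact: (@polytime_pt circuit_enc) Hk | exact: (@polytime_pt circuit_enc) Hs]].
Qed.

Lemma polyb_nat (g : nat -> nat) : @polyb nat_enc g ->
  exists d, forall lam, (2 <= lam)%N -> (g lam <= lam ^ d)%N.
Proof.
(* The factor 3 comes from [(sz lam).+2 = 2 * lam + 3 <= lam ^ 3] for [lam >= 2]. *)
case=> d Hg; exists (3 * d)%N => lam le2; apply: leq_trans (Hg lam) _.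
by rewrite expnM; apply: leq_exp2rW; rewrite sz_nat !expnS expn0; nia.
Qed.

Lemma pow_superlog (n : nat -> nat) d : superlogarithmic n ->
  exists N, forall lam, (N <= lam)%N -> (lam ^ d < 2 ^ n lam)%N.
Proof.
(* With [t] the logarithm, [lam < 2 ^ t.+1], and [d * t.+1 <= 2 * d * t < (2 * d + 1) * t <= n lam]
   because [t > 0]. *)
move=> /(_ (2 * d + 1)%N)[N HN]; exists (maxn N 2) => lam.
rewrite geq_max => /andP[/HN le_n lam_gt1].
set t := trunc_log 2 lam in le_n.
have lt_t : (lam < 2 ^ t.+1)%N by apply: trunc_log_ltn.
have t_gt0 : (0 < t)%N.
  by rewrite lt0n; apply/eqP => t0; rewrite t0 in lt_t; lia.
apply: leq_ltn_trans (_ : (2 ^ t.+1) ^ d < _)%N; first by apply/leq_exp2rW/ltnW.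
by rewrite -expnM ltn_exp2l //; nia.
Qed.

Theorem theorem4p7 (S : osmac) (n : nat -> nat) (l_m : nat -> nat)
    (M : forall lam : nat, {set (l_m lam).-tuple bool})
    (n_poly : poly_param n) (l_m_poly : poly_param l_m)
    (M_nonempty : forall lam : nat, M lam <> set0)
    (S_large : large_messages S n)
    (S_correct : osmac_correct S)
    (n_superlog : superlogarithmic n)
    (k : nat -> nat) (k_poly : poly_param k) :
  ~ ow_unclonable_secure (mac_chain S n M) k.
Proof.
pose P := attack_params S n l_m k.
have pt_n : pt n := polytime_pt (B := nat_enc) n_poly.
have pt_lm : pt l_m := polytime_pt (B := nat_enc) l_m_poly.
have pt_k : pt k := polytime_pt (B := nat_enc) k_poly.
have [pt_pp pt_sk pt_vk pt_sg [pt_kg pt_sgn]] := osmac_pt S.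
have pt_dl : pt (fun lam => n lam + lam)%N := pt_add pt_n (pt_id _).
have HP lam : valid_params (P lam) := attack_params_valid l_m k lam S_large.
have pt_A := @pt_first_stage P pt_sk pt_pp pt_vk pt_sg pt_lm pt_n pt_k pt_kg pt_sgn.
have pt_B := @pt_second_stage P pt_sk pt_vk pt_sg pt_lm pt_n pt_dl pt_sgn.
move=> /(_ (fun lam _ => share_len (P lam)) (fun lam => first_stage (P lam))
  (fun lam _ => second_stage (P lam))) secure.
have {}secure : negligible (unclonable_game (mac_chain S n M) k
    (fun lam _ => share_len (P lam)) (fun lam => first_stage (P lam))
    (fun lam _ => second_stage (P lam))).
  apply: secure => //.
  - split=> [lam|]; first exact: first_stage_wf (HP lam).
    exact: (pt_polytime (B := circuit_enc) pt_A (polyb_const _ 1)).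
  - by move=> lam; rewrite sum_nat_const card_ord.
  split=> [lam j _|]; first exact: second_stage_wf (HP lam).
  (* All parties run the same circuit; the index [j < k lam] only has to be short enough to be
     read. *)
  apply: (pt_polytime (B := circuit_enc) pt_B (pt_size pt_k)) => lam j lt_j.
  have := sz_nat j; have := sz_nat (k lam); rewrite /sz /=; lia.
have [d1 Hd1] : exists d, forall lam, (2 <= lam)%N -> (keys (P lam) <= lam ^ d)%N.
  apply: polyb_nat; apply: pt_nat_size; rewrite /keys /nodes /width /=.
  by apply: pt_add => //; apply/pt_S/pt_mul => //; apply: pt_S.
have [d2 Hd2] := polyb_nat (pt_nat_size pt_k).
have [N2 HN2] := pow_superlog d2 n_superlog.
(* With at most [lam ^ d1] nodes, the exponent [d1.+1] makes the total failure at most [1 / lam]. *)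
have [e neg_e He] := S_correct; have [N1 HN1] := neg_e d1.+1.
have [N3 HN3] := secure 1%N.
(* From [lam = 3] on, the winning probability and the failure are each at most [1 / 3], while the
   lower bound makes them add up to at least 1. *)
pose lam := (maxn (maxn N1 N2) (maxn N3 3))%N.
have [le1 le2 le3 le4] : [/\ (N1 <= lam)%N, (N2 <= lam)%N, (N3 <= lam)%N & (3 <= lam)%N].
  by rewrite /lam; split; lia.
have lam_gt1 : (2 <= lam)%N by lia.
have lam_gt0 : 0 < (lam%:R : algC) by rewrite ltr0n; lia.
have lt_k : (k lam < 2 ^ n lam)%N by apply: leq_ltn_trans (HN2 lam le2); exact: Hd2.
have M0 : M lam != set0 by apply/eqP; exact: M_nonempty.
have low := game_bound S_large M0 lt_k (He lam).
have Ke : `|(keys (P lam))%:R * e lam| <= lam%:R^-1.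
  rewrite normrM normr_nat; apply: le_trans (_ : lam%:R ^+ d1 * (lam%:R ^+ d1.+1)^-1 <=
    _).
    by apply: ler_pM (HN1 lam le1); rewrite ?ler0n // -natrX ler_nat; exact: Hd1.
  by rewrite exprS invfM mulrCA divff ?mulr1 // expf_neq0 // gt_eqF.
have up := HN3 lam le3; rewrite expr1 in up.
have inv3 : (lam%:R^-1 : algC) <= 3^-1.
  by rewrite lef_pV2 ?posrE ?ltr0n ?ler_nat; lia.
have one_le : 1 <= (3^-1 + 3^-1 : algC).
  rewrite lerBlDr in low; apply: (le_trans low).
  rewrite -[leLHS]ger0_norm; last by apply: (le_trans _ low); exact: ler01.
  by apply: le_trans (ler_normD _ _) _; apply: lerD; apply: le_trans inv3.
move: one_le; rewrite -(ler_pM2l (_ : 0 < 3 :> algC)) ?ltr0n //.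
by rewrite mulrDr mulfV ?pnatr_eq0 // mulr1 -(natrD _ 1 1) ler_nat.
Qed.
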